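(* Let $(E_2,\varphi_2)$ be the rank $2$ Drinfeld module over $K=\mathbb F_q(\theta)$ given by $\varphi_2(t)=\theta+b\tau-\tau^2$ with $b\in K$ such that the following conditions hold: (i) there is a (non-zero) prime ideal $\ell\subseteq\mathbb F_q[\theta]$, $\ell\ne(\theta)$, such that $v_\ell(b)<0$ and $\gcd(q,v_\ell(b))=1$; (ii) $\mathrm{Gal}(K(\varphi_2[t])/K)\supseteq\mathrm{SL}_2(\mathbb F_q)$. Then the $t$-adic Galois representation associated to $E_2$ is surjective, i.e. $\mathrm{Gal}(K_2/K)\cong\mathrm{GL}_2(\mathbb F_q[[t]])$, where $K_2=\bigcup_{k\ge1}K(\varphi_2[t^k])$.
   Context: $q$ is a power of a prime, $v_\ell$ is the $\ell$-adic valuation on $K$. $K\{\tau\}$ is the twisted polynomial ring with $\tau c=c^q\tau$, $\tau$ acting as $x\mapsto x^q$; $\varphi_2$ is an $\mathbb F_q$-algebra homomorphism $\mathbb F_q[t]\to K\{\tau\}$. $\varphi_2[t^k]=\ker\varphi_2(t^k)\subseteq K^{\mathrm{sep}}$ is free of rank $2$ over $\mathbb F_q[t]/(t^k)$; $\mathrm{Gal}(K(\varphi_2[t])/K)$ is viewed in $\mathrm{GL}_2(\mathbb F_q)$ via its action on $\varphi_2[t]\cong\mathbb F_q^2$. The $t$-adic Galois representation $\mathrm{Gal}(K^{\mathrm{sep}}/K)\to\mathrm{GL}_2(\mathbb F_q[[t]])$ is the action on the Tate module $\varprojlim_k\varphi_2[t^k]\cong\mathbb F_q[[t]]^2$; it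 factors through an injection of $\mathrm{Gal}(K_2/K)$. *)

(* Defs.v *)
From HB Require Import structures.
From mathcomp Require Import all_boot all_order all_algebra all_fingroup all_solvable all_field.
From mathcomp Require Import boolp.

Set Implicit Arguments.
Unset Strict Implicit.
Unset Printing Implicit Defensive.

Import Order.TTheory GRing.Theory Num.Theory.
Local Open Scope ring_scope.

Section Frobenius.
Variables (F : finFieldType) (K : fieldType) (c : {rmorphism F -> K}).

Lemma pnat_card n : [pchar K].-nat (#|F| ^ n)%N.
Proof.
rewrite pnatX; apply/orP; left.
have [p p_pr pF] := finPcharP F.
have pK : p \in [pchar K] by rewrite (fmorph_pchar c).
rewrite (eq_pnat _ (pcharf_eq pK)) -cardsT.
exact: (abelem_pgroup (fin_ring_pchar_abelem pF)).
Qed.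

(* [c] is an argument only because it makes the map a ring morphism. *)
Definition qfrob of {rmorphism F -> K} := fun (n : nat) (x : K) => x ^+ (#|F| ^ n).

Lemma qfrob_zmod_morphism n : zmod_morphism (qfrob c n).
Proof.
move=> x y; rewrite /qfrob exprDn_pchar ?pnat_card //; congr (_ + _).
have nneg : (- y) ^+ (#|F| ^ n) + y ^+ (#|F| ^ n) = 0.
  by rewrite -exprDn_pchar ?pnat_card // addNr expr0n expn_eq0 -leqn0 leqNgt
    (ltnW (finNzRing_gt1 _)).
by apply/eqP; rewrite -subr_eq0 opprK; apply/eqP.
Qed.

Lemma qfrob_monoid_morphism n : monoid_morphism (qfrob c n).
Proof. by split=> [|x y]; rewrite /qfrob ?expr1n ?exprMn. Qed.

HB.instance Definition _ n :=
  GRing.isZmodMorphism.Build K K (qfrob c n) (@qfrob_zmod_morphism n).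
HB.instance Definition _ n :=
  GRing.isMonoidMorphism.Build K K (qfrob c n) (@qfrob_monoid_morphism n).

Lemma qfrob0 x : qfrob c 0 x = x. Proof. by []. Qed.

Lemma qfrob_add m n x : qfrob c m (qfrob c n x) = qfrob c (m + n) x.
Proof. by rewrite /qfrob -exprM -expnD addnC. Qed.

Lemma qfrob_const n a : qfrob c n (c a) = c a.
Proof.
elim: n => [|n IHn] //; rewrite -[n.+1]addn1 -qfrob_add.
by rewrite {2}/qfrob expn1 -rmorphXn expf_card IHn.
Qed.

End Frobenius.

Section Twisted.
Variables (F : finFieldType) (K : fieldType) (c : {rmorphism F -> K}).

(* The coefficients of \sum_i a_i tau^i are stored as the polynomial           *)
(* \sum_i a_i 'X^i.                                                            *)
Definition tpoly of {rmorphism F -> K} : Type := {poly K}.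
Local Notation T := (tpoly c).

HB.instance Definition _ := GRing.Zmodule.copy T {poly K}.

Implicit Types p q r : {poly K}.

(* a tau^i (\sum_j b_j tau^j) = a \sum_j b_j^(q^i) tau^(i + j)                 *)
Definition tmul p q : {poly K} :=
  \sum_(i < size p) p`_i *: (map_poly (qfrob c i) q * 'X^i).

Lemma tmulE n p q : (size p <= n)%N ->
  tmul p q = \sum_(i < n) p`_i *: (map_poly (qfrob c i) q * 'X^i).
Proof.
move=> le_pn; rewrite /tmul.
rewrite (big_ord_widen _ (fun i => p`_i *: (map_poly (qfrob c i) q * 'X^i)) le_pn).
rewrite big_mkcond /=; apply: eq_bigr => i _.
by case: ltnP => // lt_pi; rewrite nth_default ?scale0r.
Qed.

Lemma tmulDl p p' q : tmul (p + p') q = tmul p q + tmul p' q.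
Proof.
pose n := maxn (size p) (size p').
rewrite !(@tmulE n) ?leq_maxl ?leq_maxr ?(leq_trans (size_polyD _ _)) //.
by rewrite -big_split; apply: eq_bigr => i _; rewrite coefD scalerDl.
Qed.

Lemma tmulDr p q q' : tmul p (q + q') = tmul p q + tmul p q'.
Proof.
rewrite -big_split; apply: eq_bigr => i _.
by rewrite rmorphD mulrDl scalerDr.
Qed.

Lemma tmul0l q : tmul 0 q = 0.
Proof. by rewrite /tmul size_poly0 big_ord0. Qed.

Lemma tmul0r p : tmul p 0 = 0.
Proof. by apply: big1 => i _; rewrite rmorph0 mul0r scaler0. Qed.

Lemma tmulZl a p q : tmul (a *: p) q = a *: tmul p q.
Proof.
rewrite (@tmulE (size p)) ?size_scale_leq // scaler_sumr.
by apply: eq_bigr => i _; rewrite coefZ scalerA.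
Qed.

Lemma tmulXn i q : tmul 'X^i q = map_poly (qfrob c i) q * 'X^i.
Proof.
rewrite /tmul size_polyXn (bigD1 ord_max) //= coefXn eqxx scale1r big1 ?addr0 //.
move=> j; rewrite -val_eqE /= => ne_ji.
by rewrite coefXn (negPf ne_ji) scale0r.
Qed.

Lemma tmul_suml I (s : seq I) (P : pred I) (f : I -> {poly K}) q :
  tmul (\sum_(i <- s | P i) f i) q = \sum_(i <- s | P i) tmul (f i) q.
Proof. exact: (big_morph (tmul^~ q) (fun p p' => tmulDl p p' q) (tmul0l q)). Qed.

Lemma tmul_sumr I (s : seq I) (P : pred I) (f : I -> {poly K}) p :
  tmul p (\sum_(i <- s | P i) f i) = \sum_(i <- s | P i) tmul p (f i).
Proof. exact: (big_morph (tmul p) (tmulDr p) (tmul0r p)). Qed.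

Lemma map_qfrobZXn i b j q :
  map_poly (qfrob c i) (b *: (map_poly (qfrob c j) q * 'X^j)) * 'X^i =
  qfrob c i b *: (map_poly (qfrob c (i + j)) q * 'X^(i + j)).
Proof.
rewrite map_polyZ rmorphM /= map_polyXn -map_poly_comp -scalerAl -mulrA -exprD.
rewrite [(j + i)%N]addnC; congr (_ *: (_ * _)).
by apply: eq_map_poly => x; rewrite /= qfrob_add.
Qed.

Lemma tmulA : associative tmul.
Proof.
move=> p q r; rewrite {1}/tmul [tmul p q]/tmul tmul_suml; apply: eq_bigr => i _.
rewrite tmulZl; congr (_ *: _).
rewrite -[in RHS](coefK q) poly_def !rmorph_sum !mulr_suml tmul_suml /=.
apply: eq_bigr => j _; rewrite map_qfrobZXn.
have -> : map_poly (qfrob c i) (q`_j *: 'X^j) * 'X^i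
          = qfrob c i q`_j *: 'X^(i + j).
  by rewrite map_polyZ map_polyXn -scalerAl -exprD addnC.
by rewrite tmulZl tmulXn.
Qed.

Lemma tmul1l : left_id 1 tmul.
Proof.
by move=> p; rewrite -(expr0 'X) tmulXn mulr1 map_poly_id // => x _; apply: qfrob0.
Qed.

Lemma tmul1r : right_id 1 tmul.
Proof.
move=> p; rewrite -[RHS]coefK poly_def; apply: eq_bigr => i _.
by rewrite rmorph1 mul1r.
Qed.

Lemma tone_neq0 : (1 : {poly K}) != 0 :> T.
Proof. exact: oner_neq0. Qed.

HB.instance Definition _ := GRing.Zmodule_isNzRing.Build T
  tmulA tmul1l tmul1r tmulDl tmulDr tone_neq0.

Definition tscale (a : F) (p : T) : T := c a *: (p : {poly K}).

Fact tscaleA a b p : tscale a (tscale b p) = tscale (a * b) p.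
Proof. by rewrite /tscale scalerA rmorphM. Qed.
Fact tscale1 : left_id 1 tscale.
Proof. by move=> p; rewrite /tscale rmorph1 scale1r. Qed.
Fact tscaleDr : right_distributive tscale +%R.
Proof. by move=> a p q; apply: scalerDr. Qed.
Fact tscaleDl p : {morph tscale^~ p : a b / a + b}.
Proof. by move=> a b; rewrite /tscale rmorphD scalerDl. Qed.

HB.instance Definition _ := GRing.Zmodule_isLmodule.Build F T
  tscaleA tscale1 tscaleDr tscaleDl.

Fact tscaleAl (a : F) (p q : T) : a *: (p * q) = (a *: p) * q.
Proof. by symmetry; apply: tmulZl. Qed.

HB.instance Definition _ := GRing.Lmodule_isLalgebra.Build F T tscaleAl.

Fact tscaleAr (a : F) (p q : T) : a *: (p * q) = p * (a *: q).
Proof.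
rewrite /GRing.scale /= /tscale /GRing.mul /= /tmul scaler_sumr.
apply: eq_bigr => i _; rewrite map_polyZ /= qfrob_const -scalerAl !scalerA.
by rewrite mulrC.
Qed.

HB.instance Definition _ := GRing.Lalgebra_isAlgebra.Build F T tscaleAr.

Definition tconst (a : K) : T := a%:P.
Definition tau : T := 'X.

Lemma tau_const a : tau * tconst a = tconst (a ^+ #|F|) * tau.
Proof.
rewrite /GRing.mul /= /tau /tconst -['X]expr1 tmulXn -!alg_polyC tmulZl tmul1l.
by rewrite map_polyZ rmorph1 -scalerAl mul1r.
Qed.

End Twisted.

Section Action.
Variables (F : finFieldType) (K L : fieldType).
Variables (c : {rmorphism F -> K}) (iota : {rmorphism K -> L}).
Implicit Types (p q : tpoly c) (x y : L).

(* \sum_i a_i tau^i acts as x |-> \sum_i a_i x^(q^i) *)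
Definition tact p x : L :=
  \sum_(i < size (p : {poly K})) iota (p : {poly K})`_i * x ^+ (#|F| ^ i).

Let frobL n := qfrob (iota \o c) n.

Lemma tactE n p x : (size (p : {poly K}) <= n)%N ->
  tact p x = \sum_(i < n) iota (p : {poly K})`_i * frobL i x.
Proof.
move=> le_pn; rewrite /tact.
rewrite (big_ord_widen _ (fun i => iota (p : {poly K})`_i * frobL i x) le_pn).
rewrite big_mkcond /=; apply: eq_bigr => i _.
by case: ltnP => // lt_pi; rewrite nth_default ?rmorph0 ?mul0r.
Qed.

Lemma tactDl p q x : tact (p + q) x = tact p x + tact q x.
Proof.
pose n := maxn (size (p : {poly K})) (size (q : {poly K})).
rewrite !(@tactE n) ?leq_maxl ?leq_maxr ?(leq_trans (size_polyD _ _)) //.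
by rewrite -big_split; apply: eq_bigr => i _; rewrite coefD rmorphD mulrDl.
Qed.

Lemma tactDr p x y : tact p (x + y) = tact p x + tact p y.
Proof.
rewrite !(@tactE _ _ _ (leqnn _)) -big_split; apply: eq_bigr => i _.
by rewrite /frobL rmorphD mulrDr.
Qed.

Lemma tact0l x : tact 0 x = 0.
Proof. by rewrite /tact size_poly0 big_ord0. Qed.

Lemma tact0r p : tact p 0 = 0.
Proof.
by rewrite (@tactE _ _ _ (leqnn _)) big1 // => i _; rewrite /frobL rmorph0 mulr0.
Qed.

Lemma tact_suml I (s : seq I) (f : I -> {poly K}) x :
  tact (\sum_(i <- s) f i) x = \sum_(i <- s) tact (f i) x.
Proof. exact: (big_morph (tact^~ x) (fun p q => tactDl p q x) (tact0l x)). Qed.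

Lemma tactZl a (p : {poly K}) x : tact (a *: p) x = iota a * tact p x.
Proof.
rewrite (@tactE (size p)) ?size_scale_leq // (@tactE _ _ _ (leqnn _)) mulr_sumr.
by apply: eq_bigr => i _; rewrite coefZ rmorphM mulrA.
Qed.

Lemma tact_shift i (q : {poly K}) x :
  tact (map_poly (qfrob c i) q * 'X^i) x = frobL i (tact q x).
Proof.
rewrite (@tactE (i + size q)); last first.
  apply: leq_trans (size_polyMleq _ _) _.
  by rewrite size_polyXn addnS /= addnC leq_add2l size_poly.
rewrite (@tactE _ q _ (leqnn _)) /frobL rmorph_sum big_split_ord /= big1 ?add0r.
  apply: eq_bigr => j _; rewrite coefMXn ltnNge leq_addr /= addKn coef_map /=.
  rewrite rmorphM /= qfrob_add; congr (_ * _).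
  by rewrite /qfrob rmorphXn.
by move=> j _; rewrite coefMXn ltn_ord rmorph0 mul0r.
Qed.

Lemma tactM p q x : tact (p * q) x = tact p (tact q x).
Proof.
rewrite {1}/GRing.mul /= /tmul tact_suml (@tactE _ p _ (leqnn _)).
by apply: eq_bigr => i _; rewrite tactZl tact_shift.
Qed.

End Action.

Section IntermediateFields.
Variables (K L : fieldType) (iota : {rmorphism K -> L}).

Record intermediate := Intermediate {
  carrier : {pred L};
  carrier_divring : divring_closed carrier;
  carrier_base : forall a, iota a \in carrier
}.

HB.instance Definition _ (E : intermediate) :=
  GRing.isDivringClosed.Build L (carrier E) (carrier_divring E).

Record ifield (E : intermediate) := IField {
  ifval : L;
  ifvalP : ifval \in carrier E
}.

HB.instance Definition _ E := [isSub for @ifval E].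
HB.instance Definition _ E := [Choice of ifield E by <:].
HB.instance Definition _ E := [SubChoice_isSubUnitRing of ifield E by <:].
HB.instance Definition _ E := [SubNzRing_isSubComNzRing of ifield E by <:].
HB.instance Definition _ E :=
  [SubComUnitRing_isSubIntegralDomain of ifield E by <:].
HB.instance Definition _ E := [SubIntegralDomain_isSubField of ifield E by <:].

Definition ibase E (a : K) : ifield E := IField (carrier_base E a).

Lemma ibase_zmod_morphism E : zmod_morphism (@ibase E).
Proof. by move=> a b; apply: val_inj; rewrite rmorphB /= rmorphB. Qed.
Lemma ibase_monoid_morphism E : monoid_morphism (@ibase E).
Proof.
by split=> [|a b]; apply: val_inj; rewrite /= ?(rmorph1 iota) ?(rmorphM iota).
Qed.

HB.instance Definition _ E :=
  GRing.isZmodMorphism.Build K (ifield E) (@ibase E) (@ibase_zmod_morphism E).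
HB.instance Definition _ E :=
  GRing.isMonoidMorphism.Build K (ifield E) (@ibase E) (@ibase_monoid_morphism E).

Section Adjoin.
Variable S : L -> Prop.

Definition adjoin_pred : {pred L} := [pred x | `[< forall E : intermediate,
  (forall y, S y -> y \in carrier E) -> x \in carrier E >]].

Lemma adjoin_divring : divring_closed adjoin_pred.
Proof.
split=> [|x y|x y]; rewrite ?inE; first by apply/asboolP => E _; apply: rpred1.
  move=> /asboolP xE /asboolP yE; apply/asboolP => E SE.
  by rewrite rpredB ?xE ?yE.
move=> /asboolP xE /asboolP yE; apply/asboolP => E SE.
by rewrite rpred_div ?xE ?yE.
Qed.

Lemma adjoin_base a : iota a \in adjoin_pred.
Proof. by rewrite inE; apply/asboolP => E _; apply: carrier_base. Qed.

Definition adjoin : intermediate := Intermediate adjoin_divring adjoin_base.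

End Adjoin.

Lemma adjoin_subset (S S' : L -> Prop) : (forall x, S x -> S' x) ->
  {subset carrier (adjoin S) <= carrier (adjoin S')}.
Proof.
move=> SS' x; rewrite !inE => /asboolP xS; apply/asboolP => E S'E.
by apply: xS => y /SS'; apply: S'E.
Qed.

(* K^sep: every element is a root of a separable polynomial over K, and every  *)
(* nonconstant separable polynomial over L has a root in L.                    *)
Definition separable_closure : Prop :=
  (forall x : L, exists2 p : {poly K}, separable_poly p & root (map_poly iota p) x)
  /\ (forall p : {poly L}, separable_poly p -> (1 < size p)%N -> exists x, root p x).

End IntermediateFields.

Section GaloisGroup.
Variables (K M : fieldType) (j : {rmorphism K -> M}).

Definition is_Kaut (s : M -> M) : Prop :=
  [/\ zmod_morphism s, monoid_morphism s, bijective s & forall a, s (j a) = j a].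

Record Gal := MkGal { galfun :> M -> M; galfunP : `[< is_Kaut galfun >] }.

HB.instance Definition _ := [isSub for galfun].
HB.instance Definition _ := [Choice of Gal by <:].

Fact gal_one_subproof : `[< is_Kaut idfun >].
Proof. by apply/asboolP; split=> //; exists idfun. Qed.

Fact gal_mul_subproof (s t : Gal) : `[< is_Kaut (s \o t) >].
Proof.
have /asboolP[sB sM sK sj] := galfunP s; have /asboolP[tB tM tK tj] := galfunP t.
apply/asboolP; split=> [x y||| a] /=; last by rewrite tj sj.
- by rewrite tB sB.
- by split=> [|x y] /=; rewrite ?tM ?sM.
exact: bij_comp.
Qed.

Fact gal_inv_subproof (s : Gal) :
  {t : M -> M | [/\ `[< is_Kaut t >], cancel s t & cancel t s]}.
Proof.
apply: cid; have /asboolP[sB sM [t st ts] sj] := galfunP s.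
exists t; split=> //; apply/asboolP; split=> [x y||| a].
- by apply: (can_inj st); rewrite sB !ts.
- by split=> [|x y]; apply: (can_inj st); rewrite ?sM !ts ?sM.
- by exists s.
by rewrite -{1}(sj a) st.
Qed.

Definition gal_one := MkGal gal_one_subproof.
Definition gal_mul s t := MkGal (gal_mul_subproof s t).
Definition gal_inv s :=
  let: exist _ h := gal_inv_subproof s in MkGal (let: And3 h1 _ _ := h in h1).

Fact gal_mulA : associative gal_mul. Proof. by move=> s t u; apply: val_inj. Qed.
Fact gal_mul1l : left_id gal_one gal_mul. Proof. by move=> s; apply: val_inj. Qed.
Fact gal_mul1r : right_id gal_one gal_mul. Proof. by move=> s; apply: val_inj. Qed.
Fact gal_mulVl : left_inverse gal_one gal_inv gal_mul.
Proof.
move=> s; apply: val_inj; rewrite /= /gal_inv.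
by case: gal_inv_subproof => t [? st ts]; apply: funext => x /=; apply: st.
Qed.
Fact gal_mulVr : right_inverse gal_one gal_inv gal_mul.
Proof.
move=> s; apply: val_inj; rewrite /= /gal_inv.
by case: gal_inv_subproof => t [? st ts]; apply: funext => x /=; apply: ts.
Qed.

HB.instance Definition _ := isGroup.Build Gal
  gal_mulA gal_mul1l gal_mul1r gal_mulVl gal_mulVr.

End GaloisGroup.

Section PowerSeries.
Variable R : comNzRingType.

Record fps := Fps { fps_coef : nat -> R }.

HB.instance Definition _ := [isNew for fps_coef].
HB.instance Definition _ := [Choice of fps by <:].

Implicit Types a b d : fps.

Definition fps_trunc n a : {poly R} := \poly_(i < n) fps_coef a i.

Lemma fpsP a b : fps_coef a =1 fps_coef b -> a = b.
Proof. by case: a b => a [b] /= /funext ->. Qed.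

Definition fps_add a b := Fps (fun n => fps_coef a n + fps_coef b n).
Definition fps_opp a := Fps (fun n => - fps_coef a n).
Definition fps_zero := Fps (fun=> 0).
Definition fps_one := Fps (fun n => (n == 0)%:R).
Definition fps_mul a b :=
  Fps (fun n => \sum_(i < n.+1) fps_coef a i * fps_coef b (n - i)).

Fact fps_addA : associative fps_add.
Proof. by move=> a b d; apply: fpsP => n; apply: addrA. Qed.
Fact fps_addC : commutative fps_add.
Proof. by move=> a b; apply: fpsP => n; apply: addrC. Qed.
Fact fps_add0 : left_id fps_zero fps_add.
Proof. by move=> a; apply: fpsP => n; apply: add0r. Qed.
Fact fps_addN : left_inverse fps_zero fps_opp fps_add.
Proof. by move=> a; apply: fpsP => n; apply: addNr. Qed.

HB.instance Definition _ :=
  GRing.isZmodule.Build fps fps_addA fps_addC fps_add0 fps_addN.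

Lemma coef_fps_trunc n a i : (i < n)%N -> (fps_trunc n a)`_i = fps_coef a i.
Proof. by rewrite coef_poly => ->. Qed.

Lemma fps_coef_mul N n a b : (n < N)%N ->
  fps_coef (fps_mul a b) n = (fps_trunc N a * fps_trunc N b)`_n.
Proof.
move=> lt_nN; rewrite coefM; apply: eq_bigr => i _.
by rewrite !coef_fps_trunc ?(leq_ltn_trans _ lt_nN) ?leq_subr // -ltnS.
Qed.

Fact fps_mulC : commutative fps_mul.
Proof.
by move=> a b; apply: fpsP => n; rewrite !(@fps_coef_mul n.+1) // mulrC.
Qed.
Fact fps_mulA : associative fps_mul.
Proof.
move=> a b d; apply: fpsP => n.
transitivity ((fps_trunc n.+1 a * (fps_trunc n.+1 b * fps_trunc n.+1 d))`_n).
  rewrite coefM; apply: eq_bigr => i _.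
  by rewrite coef_fps_trunc // -fps_coef_mul // ltnS leq_subr.
rewrite mulrA coefM; apply: eq_bigr => i _.
by rewrite coef_fps_trunc ?ltnS ?leq_subr // -fps_coef_mul.
Qed.
Fact fps_mul1 : left_id fps_one fps_mul.
Proof.
move=> a; apply: fpsP => n /=; rewrite big_ord_recl /= mul1r subn0 big1 ?addr0 //.
by move=> i _; rewrite mul0r.
Qed.
Fact fps_mulDl : left_distributive fps_mul fps_add.
Proof.
move=> a b d; apply: fpsP => n /=; rewrite -big_split.
by apply: eq_bigr => i _; rewrite mulrDl.
Qed.
Fact fps_one_neq0 : fps_one != fps_zero.
Proof.
apply/eqP => /(congr1 (fun a => fps_coef a 0)) /= /eqP.
by rewrite oner_eq0.
Qed.

HB.instance Definition _ := GRing.Zmodule_isComNzRing.Build fps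
  fps_mulA fps_mulC fps_mul1 fps_mulDl fps_one_neq0.

Definition fps_unit : {pred fps} := [pred a | `[< exists b, b * a = 1 >]].
Definition fps_inv a : fps :=
  if pselect (exists b, b * a = 1) is left ex_b then projT1 (cid ex_b) else a.

Fact fps_mulV : {in fps_unit, left_inverse 1 fps_inv *%R}.
Proof.
move=> a; rewrite inE /fps_inv => /asboolP ex_b.
by case: pselect => // {}ex_b; case: cid.
Qed.
Fact fps_unitP a b : b * a = 1 -> fps_unit a.
Proof. by move=> ba1; apply/asboolP; exists b. Qed.
Fact fps_inv_out : {in [predC fps_unit], fps_inv =1 id}.
Proof.
by move=> a; rewrite !inE /fps_inv => /asboolPn; case: pselect.
Qed.

HB.instance Definition _ := GRing.ComNzRing_hasMulInverse.Build fps
  fps_mulV fps_unitP fps_inv_out.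

End PowerSeries.

(* The library's {'GL_n[R]} requires a finite ring R. *)
Section GeneralLinear.
Variables (n : nat) (R : comUnitRingType).

Record GLmx := MkGLmx { glval :> 'M[R]_n; glvalP : glval \in unitmx }.

HB.instance Definition _ := [isSub for glval].
HB.instance Definition _ := [Choice of GLmx by <:].

Fact gl_mul_subproof (A B : GLmx) : A *m B \in unitmx.
Proof. by rewrite unitmx_mul !glvalP. Qed.
Fact gl_inv_subproof (A : GLmx) : invmx A \in unitmx.
Proof. by rewrite unitmx_inv glvalP. Qed.

Definition gl_one := MkGLmx (unitmx1 R n).
Definition gl_mul A B := MkGLmx (gl_mul_subproof A B).
Definition gl_inv A := MkGLmx (gl_inv_subproof A).

Fact gl_mulA : associative gl_mul.
Proof. by move=> A B C; apply: val_inj; apply: mulmxA. Qed.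
Fact gl_mul1l : left_id gl_one gl_mul.
Proof. by move=> A; apply: val_inj; apply: mul1mx. Qed.
Fact gl_mul1r : right_id gl_one gl_mul.
Proof. by move=> A; apply: val_inj; apply: mulmx1. Qed.
Fact gl_mulVl : left_inverse gl_one gl_inv gl_mul.
Proof. by move=> A; apply: val_inj; apply: mulVmx; apply: glvalP. Qed.
Fact gl_mulVr : right_inverse gl_one gl_inv gl_mul.
Proof. by move=> A; apply: val_inj; apply: mulmxV; apply: glvalP. Qed.

HB.instance Definition _ := isGroup.Build GLmx
  gl_mulA gl_mul1l gl_mul1r gl_mulVl gl_mulVr.

End GeneralLinear.

Section Torsion.
Variables (F : finFieldType) (K L : fieldType).
Variables (c : {rmorphism F -> K}) (iota : {rmorphism K -> L}).
Variable phi : {lrmorphism {poly F} -> tpoly c}.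

Definition dact (a : {poly F}) (x : L) : L := tact iota (phi a) x.

Lemma dactM a b x : dact (a * b) x = dact a (dact b x).
Proof. by rewrite /dact rmorphM tactM. Qed.

Definition torsion (k : nat) (x : L) : Prop := dact 'X^k x = 0.

Lemma torsionS k x : torsion k x -> torsion k.+1 x.
Proof. by rewrite /torsion exprS dactM => ->; apply: tact0r. Qed.

Lemma torsion_leq k l x : (k <= l)%N -> torsion k x -> torsion l x.
Proof.
move=> /subnK <-; elim: (l - k)%N => // n IHn kx; rewrite addSn.
exact/torsionS/IHn.
Qed.

Definition torsion_field (k : nat) : intermediate iota := adjoin iota (torsion k).

Definition tower_pred : {pred L} :=
  [pred x | `[< exists2 k, (1 <= k)%N & x \in carrier (torsion_field k) >]].

Lemma tower_divring : divring_closed tower_pred.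
Proof.
have common x y : x \in tower_pred -> y \in tower_pred -> exists k,
    [/\ (1 <= k)%N, x \in carrier (torsion_field k)
      & y \in carrier (torsion_field k)].
  rewrite !inE => /asboolP[k k1 xk] /asboolP[l l1 yl]; exists (maxn k l).
  split; first by rewrite leq_max k1.
    by apply: adjoin_subset xk => z; apply/torsion_leq/leq_maxl.
  by apply: adjoin_subset yl => z; apply/torsion_leq/leq_maxr.
split=> [|x y xT yT|x y xT yT]; rewrite inE; apply/asboolP.
- by exists 1 => //; apply: rpred1.
- by have [k [k1 xk yk]] := common x y xT yT; exists k => //; apply: rpredB.
by have [k [k1 xk yk]] := common x y xT yT; exists k => //; apply: rpred_div.
Qed.

Lemma tower_base a : iota a \in tower_pred.
Proof. by rewrite inE; apply/asboolP; exists 1 => //; apply: carrier_base. Qed.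

(* \bigcup_(k >= 1) K(phi[t^k]) *)
Definition torsion_tower : intermediate iota := Intermediate tower_divring tower_base.

Section ModT.
Variable u : 'I_2 -> ifield (torsion_field 1).

(* an isomorphism phi[t] ~ F^2, given by the preimages of the standard basis *)
Definition torsion_basis : Prop :=
  (forall i, torsion 1 (ifval (u i))) /\
  (forall x : L, torsion 1 x ->
     exists! a : 'cV[F]_2, x = \sum_i iota (c (a i 0)) * ifval (u i)).

Definition mod_t_matrix (s : Gal (@ibase K L iota (torsion_field 1)))
    (A : 'M[F]_2) : Prop :=
  forall j, s (u j) = \sum_i ibase (torsion_field 1) (c (A i j)) * u i.

End ModT.

Definition mod_t_image_contains_SL2 : Prop :=
  exists2 u, torsion_basis u &
    forall A : 'M[F]_2, \det A = 1 -> exists s, mod_t_matrix u s A.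

(* [x k] is the component in phi[t^k]; [x 0] = 0 is redundant. *)
Definition tate (x : nat -> L) : Prop :=
  (forall k, torsion k (x k)) /\ (forall k, dact 'X (x k.+1) = x k).

(* F[[t]] acts on phi[t^k] through F[t]/(t^k). *)
Definition tate_scale (a : fps F) (x : nat -> L) : nat -> L :=
  fun k => dact (fps_trunc k a) (x k).

Section TAdic.
Variable e : 'I_2 -> nat -> L.

Definition tate_basis : Prop :=
  (forall i, tate (e i)) /\
  (forall x, tate x ->
     exists! a : 'cV[fps F]_2,
       forall k, x k = \sum_i tate_scale (a i 0) (e i) k).

Definition tadic_matrix (s : Gal iota) (A : 'M[fps F]_2) : Prop :=
  forall j k, s (e j k) = \sum_i tate_scale (A i j) (e i) k.

Definition tadic_surjective : Prop :=
  forall A : GLmx 2 (fps F), exists s : Gal iota, tadic_matrix s A.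

(* The t-adic representation factors through an isomorphism of Gal(K_2/K) onto *)
(* GL_2(F[[t]]).                                                               *)
Definition tadic_induces_iso : Prop :=
  exists f : Gal (@ibase K L iota torsion_tower) -> GLmx 2 (fps F),
    [/\ {morph f : s1 s2 / (s1 * s2)%g}, bijective f
      & forall (s : Gal iota) (s2 : Gal (@ibase K L iota torsion_tower)),
          (forall y : ifield torsion_tower, s (ifval y) = ifval (s2 y)) -> tadic_matrix s (f s2)].

End TAdic.
End Torsion.

Section RationalFunctions.
Variable F : finFieldType.

Definition ratfun : fieldType := {fraction {poly F}}.
Definition ratconst : {rmorphism F -> ratfun} := (@tofrac {poly F}) \o polyC.
Definition theta : ratfun := tofrac 'X.

Definition phi2 (b : ratfun) : {poly F} -> tpoly ratconst :=
  horner_alg (tconst ratconst theta + tconst ratconst b * tau ratconst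
              - tau ratconst ^+ 2).

HB.instance Definition _ b := GRing.RMorphism.on (phi2 b).

Fact phi2_scalable b : scalable (phi2 b).
Proof. by move=> a p; rewrite -mul_polyC rmorphM /= /phi2 horner_algC mulr_algl. Qed.

HB.instance Definition _ b :=
  GRing.isScalable.Build F {poly F} (tpoly ratconst) *:%R (phi2 b)
    (@phi2_scalable b).

Lemma phi2_t b : phi2 b 'X =
  tconst ratconst theta + tconst ratconst b * tau ratconst - tau ratconst ^+ 2.
Proof. exact: horner_algX. Qed.

Implicit Type I : prime_idealr {poly F}.

(* p lies in the n-th power of I; the factor a is needed for n = 0 *)
Definition ideal_pow I (n : nat) (p : {poly F}) : Prop :=
  exists m (a : 'I_m -> {poly F}) (u : 'I_m -> 'I_n -> {poly F}),
    (forall i j, u i j \in I) /\ p = \sum_i a i * \prod_j u i j.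

Definition ideal_ord I (p : {poly F}) (n : nat) : Prop :=
  ideal_pow I n p /\ ~ ideal_pow I n.+1 p.

(* [valuation I b v] is v_I(b) = v, for I nonzero. It holds for no integer v   *)
(* when b = 0, where v_I(b) is infinite.                                       *)
Definition valuation I (b : ratfun) (v : int) : Prop :=
  exists n d m k, [/\ d != 0, b = tofrac n / tofrac d,
    ideal_ord I n m, ideal_ord I d k & v = m%:Z - k%:Z].

End RationalFunctions.

(* Main.v *)
From HB Require Import structures.
From mathcomp Require Import all_boot all_order all_algebra all_fingroup all_solvable all_field.
From mathcomp Require Import boolp.
From mathcomp Require classical_sets.
From mathcomp Require Import zify ring lra.
Require Import Defs.
Set Implicit Arguments.
Unset Strict Implicit.
Unset Printing Implicit Defensive.
Import Order.TTheory GRing.Theory Num.Theory.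
Local Open Scope ring_scope.

(** Write F for F_q, L for K^sep, fr for the q-power Frobenius acting on the
    coefficients of a power series over L, and encode a compatible system (x_k)
    of t^k-torsion points as the series X = sum x_k t^k.  The Tate module is then
      T = { X in L[[t]] | X_0 = 0 and theta X + b fr(X) - fr(fr(X)) = t X },
    on which F[[t]] acts by multiplication of series (tateSP, tate_scaleE).  The
    point is to produce inside the image of Galois in GL_2(F[[t]]) three kinds
    of elements: all transvections along one line, an element that moves this
    line modulo t, and elements of every determinant.

    Transvections.  At the place ell the module has potentially stable reduction of
    rank one.  After adjoining to K all constants and a (q-1)-st root vpi of ell, and
    closing the result in L for the ell-adic topology, one gets a henselian
    field E with value group Z and algebraically closed residue field.  There
    phi(t) has a root m in E, and conjugating by m factors it as
      m^-1 phi(t) m = (theta + mu tau)(1 - tau),  mu = m^(q^2-1) of value > 0.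
    Dividing 1 successively by this operator never leaves E and gives a Tate
    element X fixed by Gal(L/E).  The operator also kills an element of negative
    value; dividing this one gives Y with components of value
    n - n(q+1)/q^k where n = - v_ell(b).  As n is prime to q, the k-th component
    of Y has degree at least q^k over E.  The Wronskian X fr(Y) - fr(X) Y is
    essentially the Tate element of a Carlitz module, which is unramified at
    ell, so Gal(L/E) fixes it and maps Y to Y + a X with a in F[[t]].  There are
    only q^k possibilities for the k-th component, so all occur, and by
    compactness every a occurs (local_transvections).

    SL_2.  Since SL_2(F_q) is contained in the image modulo t, some Galois
    element moves the line of X modulo t, i.e. has a unit as lower left entry.
    Over the local ring F[[t]] it generates SL_2 together with the transvections
    (local_SL2_generated).

    Determinants.  An element of matrix A multiplies the Wronskian of a basis by
    det A.  At the place theta the components of the Carlitz Tate element have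
    value 1/((q-1)q^k), so they are totally ramified, and every unit of F[[t]]
    is a determinant (carlitz_surjective).

    Finally, the image of Gal(L/K) is that of Gal(K_2/K) because automorphisms
    of K_2 extend to L, and an automorphism of K_2 is determined by its action
    on a basis of T (tower_iso). *)

(** * Splitting and minimal polynomials *)

Lemma separable_split (L : fieldType) :
    (forall p : {poly L}, separable_poly p -> (1 < size p)%N -> exists x, root p x) ->
  forall p : {poly L}, separable_poly p ->
  exists2 rs : seq L, uniq rs & p = lead_coef p *: \prod_(r <- rs) ('X - r%:P).
Proof.
move=> rootL p; have [n] := ubnP (size p); elim: n p => // n IHn p /ltnSE le_p_n sep_p.
have p0 := separable_poly_neq0 sep_p.
have [p1 | p_gt1] := leqP (size p) 1.
  exists [::]; rewrite ?big_nil // alg_polyC.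
  by have -> := size1_polyC p1; rewrite lead_coefC.
have [x px] := rootL p sep_p p_gt1.
have [g def_p] := factor_theorem _ _ px.
have sep_g : separable_poly g.
  by apply: dvdp_separable sep_p; rewrite def_p dvdp_mulr.
have g0 := separable_poly_neq0 sep_g.
have sz_p : size p = (size g).+1 by rewrite def_p size_Mmonic ?monicXsubC // size_XsubC addn2.
have [|rs uniq_rs def_g] := IHn g _ sep_g; first by rewrite -ltnS -sz_p.
exists (x :: rs) => /=.
  rewrite uniq_rs andbT; apply/negP => rs_x.
  have : root g x by rewrite def_g rootZ ?lead_coef_eq0 // root_prod_XsubC.
  have := separable_coprime sep_p; move/(_ g ('X - x%:P)); rewrite def_p dvdpp => /(_ isT).
  by rewrite coprimep_XsubC => /negP.
rewrite big_cons [('X - _) * _]mulrC def_p lead_coefM lead_coefXsubC mulr1.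
by rewrite scalerAl -def_g.
Qed.

(** Minimality is expressed by divisibility, so that it applies to a subfield
    given by any embedding j. *)
Lemma minimal_poly (E L : fieldType) (j : {rmorphism E -> L}) x :
    algebraicOver j x ->
  exists p : {poly E}, [/\ p != 0, root (map_poly j p) x
    & forall h, root (map_poly j h) x -> p %| h].
Proof.
move=> [p0 nz_p0 rt_p0].
have ex_n : exists n, `[< exists p : {poly E}, [/\ p != 0, root (map_poly j p) x & size p = n] >].
  by exists (size p0); apply/asboolP; exists p0.
case: (ex_minnP ex_n) => n /asboolP[p [nz_p rt_p sz_p]] min_n.
exists p; split=> // h rt_h; apply: contraT => ndiv.
have nz_m : h %% p != 0 by [].
have : (size (h %% p)%R < n)%N by rewrite -sz_p ltn_modp.
rewrite ltnNge min_n //; apply/asboolP; exists (h %% p)%R; split=> //.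
rewrite rootE map_modp -[X in X == 0](addKr (map_poly j (h %/ p) * map_poly j p).[x]).
rewrite -hornerD -map_modp -rmorphM -rmorphD -divp_eq (rootP rt_h) addr0.
by rewrite rmorphM hornerM (rootP rt_p) mulr0 oppr0.
Qed.

(** * Extending partial embeddings *)

Section PartialEmbeddings.
Variables (K L : fieldType) (iota : {rmorphism K -> L}).
Hypothesis sepL : separable_closure iota.

(** The graph of a K-embedding of a subfield of L into L.  A relation rather than
    a function on a subtype: unions of chains are then plain unions, as Zorn's
    lemma requires. *)
Record pembedding (G : L -> L -> Prop) : Prop := PEmbedding {
  pemb_base : forall a, G (iota a) (iota a);
  pembB : forall x y x' y', G x y -> G x' y' -> G (x - x') (y - y');
  pembM : forall x y x' y', G x y -> G x' y' -> G (x * x') (y * y');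
  pembV : forall x y, G x y -> G x^-1 y^-1;
  pemb0 : forall y, G 0 y -> y = 0
}.

Lemma pemb1 G : pembedding G -> G 1 1.
Proof. by move=> pG; rewrite -(rmorph1 iota); apply: pemb_base. Qed.

Lemma pemb_fun G x y y' : pembedding G -> G x y -> G x y' -> y = y'.
Proof.
move=> pG Gxy Gxy'; apply/eqP; rewrite -subr_eq0; apply/eqP.
by apply: (pemb0 pG); rewrite -(subrr x); apply: pembB.
Qed.

Lemma sepL_split p : separable_poly p ->
  exists2 rs : seq L, uniq rs & p = lead_coef p *: \prod_(r <- rs) ('X - r%:P).
Proof. exact: (separable_split sepL.2). Qed.

Section Step.
Variables (E : fieldType) (j sg : {rmorphism E -> L}).
Hypothesis jsg : forall a, exists2 e, j e = iota a & sg e = iota a.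

(** E is a subfield of L through j that contains K; its second embedding sg
    agrees with j on K.  Minimal polynomials over E divide those over K, hence
    stay separable. *)
Lemma sep_minimal_poly x : exists p : {poly E}, [/\ p != 0, root (map_poly j p) x,
   separable_poly p & forall h, root (map_poly j h) x -> p %| h].
Proof.
have [P sepP rtP] := sepL.1 x.
have [lift jlift _] : {f : K -> E & (forall a, j (f a) = iota a) & forall a, sg (f a) = iota a}.
  exists (fun a => s2val (cid2 (jsg a))) => a; first exact: s2valP (cid2 (jsg a)).
  exact: s2valP' (cid2 (jsg a)).
have jP : map_poly iota P = map_poly j (map_poly lift P).
  by rewrite -map_poly_comp_id0 ?rmorph0 //; apply: eq_map_poly => a /=; rewrite jlift.
have P0 := separable_poly_neq0 sepP.
have [] := @minimal_poly E L j x.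
  by exists (map_poly lift P); rewrite -?jP // -(map_poly_eq0 j) -jP map_poly_eq0.
move=> p [p0 rp pmin]; exists p; split=> //.
have : p %| map_poly lift P by apply: pmin; rewrite -jP.
move/dvdp_separable; apply; rewrite -(separable_map j) -jP separable_map //.
Qed.

(** The embedding of E(x) that extends sg and maps x to y. *)
Definition adjoin_graph x y (x' y' : L) : Prop :=
  exists h : {poly E}, x' = (map_poly j h).[x] /\ y' = (map_poly sg h).[y].

Lemma adjoin_graph_pemb x y p : p != 0 ->
    (forall h, root (map_poly j h) x -> p %| h) -> root (map_poly sg p) y ->
    root (map_poly j p) x ->
  pembedding (adjoin_graph x y).
Proof.
move=> p0 pmin py px.
have ker h : (map_poly j h).[x] = 0 -> (map_poly sg h).[y] = 0.
  by move/eqP/pmin/dvdpP=> [g ->]; rewrite rmorphM hornerM (rootP py) mulr0.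
split.
- by move=> a; have [e je sge] := jsg a; exists e%:P; rewrite !map_polyC !hornerC /= je sge.
- move=> _ _ _ _ [h [-> ->]] [h' [-> ->]]; exists (h - h').
  by rewrite !rmorphB !hornerD !hornerN.
- move=> _ _ _ _ [h [-> ->]] [h' [-> ->]]; exists (h * h').
  by rewrite !rmorphM !hornerM.
- move=> _ _ [h [-> ->]].
  have [hx0 | hx] := eqVneq (map_poly j h).[x] 0.
    by exists 0; rewrite !rmorph0 !horner0 hx0 ker // invr0.
  (* otherwise x is a root of h or of a proper factor of p *)
  have cop : coprimep p h.
    apply: contraNT hx; rewrite /coprimep => ncop.
    have [g def_p] := dvdpP _ _ (dvdp_gcdl p h).
    have d0 : gcdp p h != 0 by rewrite gcdp_eq0 negb_and p0.
    move: (px); rewrite {1}def_p rmorphM rootM => /orP[/pmin|].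
      have g0 : g != 0 by apply: contraNneq p0 => g0; rewrite def_p g0 mul0r.
      move/dvdp_leq => /(_ g0); rewrite {1}def_p size_mul //.
      have := d0; rewrite -size_poly_gt0; have := g0; rewrite -size_poly_gt0.
      by move: ncop; lia.
    have [g' def_h] := dvdpP _ _ (dvdp_gcdr p h).
    by rewrite {2}def_h rmorphM hornerM => /rootP ->; rewrite mulr0.
  have [[a b] /= ab1] := Bezout_eq1_coprimepP _ _ cop.
  exists b; split.
    have := congr1 (fun r => (map_poly j r).[x]) ab1.
    rewrite rmorphD !rmorphM rmorph1 hornerD !hornerM (rootP px) mulr0 add0r hornerC => bh1.
    by apply: (mulIf hx); rewrite bh1 mulVf.
  have := congr1 (fun r => (map_poly sg r).[y]) ab1.
  rewrite rmorphD !rmorphM rmorph1 hornerD !hornerM (rootP py) mulr0 add0r hornerC => bh1.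
  have hy : (map_poly sg h).[y] != 0.
    by apply: contra_eq_neq bh1 => ->; rewrite mulr0 eq_sym oner_neq0.
  by apply: (mulIf hy); rewrite bh1 mulVf.
by move=> y' [h [/esym/ker h0 ->]].
Qed.

End Step.

(** An everywhere defined embedding is onto: it permutes the finite set of roots
    of a separable polynomial over K that annihilates a given y. *)
Lemma gal_of_pemb G : pembedding G -> (forall x, exists y, G x y) ->
  exists s : Gal iota, forall x y, G x y -> s x = y.
Proof.
move=> pG totG; pose s x := projT1 (cid (totG x)).
have sP x : G x (s x) by rewrite /s; case: cid.
have Gs x y : G x y -> s x = y by apply: pemb_fun (sP x).
have sB : zmod_morphism s by move=> x y; apply: Gs; apply: pembB.
have sM : monoid_morphism s.
  by split=> [|x y]; apply: Gs; [apply: pemb1 | apply: pembM].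
have si a : s (iota a) = iota a by apply: Gs; apply: pemb_base.
pose sr : {rmorphism L -> L} := HB.pack s (GRing.isZmodMorphism.Build L L s sB)
   (GRing.isMonoidMorphism.Build L L s sM).
have sbij : bijective s.
  have sinj : injective s := fmorph_inj sr.
  suff surj y : exists x, s x = y.
    exists (fun y => projT1 (cid (surj y))) => x; last by case: cid.
    by apply: sinj; case: cid.
  have [P sepP rtP] := sepL.1 y.
  have sepPL : separable_poly (map_poly iota P) by rewrite separable_map.
  have [rs uniq_rs def_P] := sepL_split sepPL.
  have lc0 : lead_coef (map_poly iota P) != 0.
    by rewrite lead_coef_eq0 separable_poly_neq0.
  have rsP x : (x \in rs) = root (map_poly iota P) x.
    by rewrite def_P rootZ // root_prod_XsubC.
  have sub : {subset map s rs <= rs}.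
    move=> _ /mapP[x xrs ->]; rewrite rsP.
    have -> : map_poly iota P = map_poly sr (map_poly iota P).
      by rewrite -map_poly_comp; apply: eq_map_poly => a /=; rewrite si.
    by rewrite (mapf_root sr) -rsP.
  have uniq_srs : uniq (map s rs) by rewrite map_inj_uniq.
  have [|_ eq_rs] := uniq_min_size uniq_srs sub; first by rewrite size_map.
  have : y \in rs by rewrite rsP.
  by rewrite -eq_rs => /mapP[x _ ->]; exists x.
have sG : `[< is_Kaut iota s >] by apply/asboolP; split.
by exists (MkGal sG) => x y /Gs.
Qed.

End PartialEmbeddings.

Section GaloisMorphism.
Variables (K M : fieldType) (j : {rmorphism K -> M}).
Implicit Type s : Gal j.

Lemma gal_zmod_morphism s : zmod_morphism (galfun s).
Proof. by have /asboolP[] := galfunP s. Qed.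
Lemma gal_monoid_morphism s : monoid_morphism (galfun s).
Proof. by have /asboolP[] := galfunP s. Qed.
HB.instance Definition _ s := GRing.isZmodMorphism.Build M M (galfun s) (gal_zmod_morphism s).
HB.instance Definition _ s :=
  GRing.isMonoidMorphism.Build M M (galfun s) (gal_monoid_morphism s).

Lemma gal_fix s a : s (j a) = j a.
Proof. by have /asboolP[] := galfunP s. Qed.

End GaloisMorphism.

(** * Extension to Galois automorphisms, and compactness *)
Section Extension.
Variables (K L : fieldType) (iota : {rmorphism K -> L}).
Hypothesis sepL : separable_closure iota.
Local Notation pembedding := (pembedding iota).

(** One step of the extension: the image of x is any root of the conjugate of
    its minimal polynomial over the domain of G. *)
Lemma pemb_step G x : pembedding G ->
  exists2 G', pembedding G' & (forall y z, G y z -> G' y z) /\ exists y, G' x y.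
Proof.
move=> pG; pose D : {pred L} := [pred x | `[< exists y, G x y >]].
have DP z : reflect (exists y, G z y) (z \in D) by rewrite inE; apply: asboolP.
have D_div : divring_closed D.
  split=> [|y z /DP[y' Gy] /DP[z' Gz]|y z /DP[y' Gy] /DP[z' Gz]]; apply/DP.
  - by exists 1; apply: (pemb1 pG).
  - by exists (y' - z'); apply: (pembB pG).
  by exists (y' / z'); apply: (pembM pG) => //; apply: (pembV pG).
have D_base a : iota a \in D by apply/DP; exists (iota a); apply: (pemb_base pG).
pose E := Intermediate D_div D_base.
pose j : {rmorphism ifield E -> L} := val.
pose sg (e : ifield E) := projT1 (cid (DP _ (ifvalP e))).
have sgP e : G (j e) (sg e) by rewrite /sg; case: cid.
have sgE e y : G (j e) y -> sg e = y by apply: (pemb_fun pG).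
have sgB : zmod_morphism sg by move=> e f; apply: sgE; rewrite rmorphB; apply: (pembB pG).
have sgM : monoid_morphism sg.
  split=> [|e f]; apply: sgE; rewrite ?rmorph1 ?rmorphM; first exact: (pemb1 pG).
  exact: (pembM pG).
pose sgr : {rmorphism ifield E -> L} := HB.pack sg
  (GRing.isZmodMorphism.Build (ifield E) L sg sgB)
  (GRing.isMonoidMorphism.Build (ifield E) L sg sgM).
have jsg a : exists2 e, j e = iota a & sgr e = iota a.
  by exists (ibase E a) => //; apply: sgE; apply: (pemb_base pG).
have [p [p0 px sep_p pmin]] := sep_minimal_poly sepL jsg x.
have [y py] : exists y, root (map_poly sgr p) y.
  apply: sepL.2; first by rewrite separable_map.
  rewrite size_map_poly -(size_map_poly j).
  by apply: root_size_gt1 px; rewrite map_poly_eq0.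
exists (adjoin_graph j sgr x y); first exact: (adjoin_graph_pemb jsg p0 pmin py px).
split=> [z t Gzt|]; last by exists y, 'X; rewrite !map_polyX !hornerX.
have zD : z \in D by apply/DP; exists t.
exists (@IField _ _ _ E z zD)%:P; rewrite !map_polyC !hornerC; split=> //.
by apply/esym/sgE.
Qed.

(** By Zorn's lemma there is a maximal extension, which is everywhere defined by
    the previous step. *)
Lemma gal_extend G : pembedding G ->
  exists s : Gal iota, forall x y, G x y -> s x = y.
Proof.
move=> pG; pose H (A : L * L -> Prop) x y := G x y \/ A (x, y).
have H0 : pembedding (H (fun=> False)).
  split.
  - by move=> a; left; apply: (pemb_base pG).
  - by move=> x y x' y' [Gx|//] [Gx'|//]; left; apply: (pembB pG).
  - by move=> x y x' y' [Gx|//] [Gx'|//]; left; apply: (pembM pG).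
  - by move=> x y [Gx|//]; left; apply: (pembV pG).
  by move=> y [|//]; apply: (pemb0 pG).
(* Zorn's lemma is applied to sets of pairs added to G, so that the empty chain
   is bounded by G itself. *)
have [|A [pA maxA]] := @classical_sets.Zorn_bigcup _ (fun A => pembedding (H A)).
  move=> C CP totC; set U := classical_sets.bigcup _ _.
  have two p p' : H U p.1 p.2 -> H U p'.1 p'.2 -> exists A, [/\ pembedding (H A),
      forall r, A r -> U r, H A p.1 p.2 & H A p'.1 p'.2].
    case: p p' => [x y] [x' y'] /= [Gp|[A CA Ap]] [Gp'|[A' CA' Ap']].
    - by exists (fun=> False); split=> //; left.
    - by exists A'; split; [apply: CP | exists A' | left | right].
    - by exists A; split; [apply: CP | exists A | right | left].
    case: (totC A A' CA CA') => sAA'.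
      by exists A'; split; [apply: CP | exists A' | right; apply: sAA' | right].
    by exists A; split; [apply: CP | exists A | right | right; apply: sAA'].
  have sub A x y : (forall r, A r -> U r) -> H A x y -> H U x y.
    by move=> sAU [Gxy | Axy]; [left | right; apply: sAU].
  split.
  - by move=> a; left; apply: (pemb_base pG).
  - move=> x y x' y' Hx Hx'; have [A [pA sAU Ax Ax']] := two (x, y) (x', y') Hx Hx'.
    by apply: (sub A) => //; apply: (pembB pA).
  - move=> x y x' y' Hx Hx'; have [A [pA sAU Ax Ax']] := two (x, y) (x', y') Hx Hx'.
    by apply: (sub A) => //; apply: (pembM pA).
  - move=> x y Hx; have [A [pA sAU Ax _]] := two (x, y) (x, y) Hx Hx.
    by apply: (sub A) => //; apply: (pembV pA).
  move=> y Hx; have [A [pA sAU Ax _]] := two (0, y) (0, y) Hx Hx.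
  exact: (pemb0 pA).
have [x|s sP] := gal_of_pemb sepL pA; last by exists s => x y Gxy; apply: sP; left.
have [G' pG' [sGG' [y G'xy]]] := pemb_step x pA.
exists y; right; apply: contrapT => nAxy.
pose B (r : L * L) := G' r.1 r.2.
case: (maxA B).
  split; last by move/(_ (x, y) G'xy).
  by case=> z t Azt; apply: sGG'; right.
suff -> : H B = G' by [].
apply/funext => z; apply/funext => t; apply/propext; split; last by right.
by case=> // Gzt; apply: sGG'; left.
Qed.

(** A substitute for the compactness of Galois groups: automorphisms that attain
    the prescribed values up to stage k agree on the fields generated by these
    stages, hence glue to an embedding of their union. *)
Lemma gal_compact (I : Type) (z z' : I -> nat -> L) :
    (forall k, exists s : Gal iota, forall i n, (n <= k)%N -> s (z i n) = z' i n) ->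
  exists s : Gal iota, forall i n, s (z i n) = z' i n.
Proof.
move=> fin; pose s k := projT1 (cid (fin k)).
have sP k i n : (n <= k)%N -> s k (z i n) = z' i n by rewrite /s; case: cid => ? /= h /h.
pose S k x := exists i n, (n <= k)%N /\ x = z i n.
pose Ad k := carrier (adjoin iota (S k)).
have agree k l x : (k <= l)%N -> x \in Ad k -> s l x = s k x.
  move=> le_kl; rewrite inE => /asboolP.
  have dv : divring_closed [pred x | s l x == s k x].
    split=> [|y t|y t]; rewrite !inE ?rmorph1 // => /eqP ey /eqP et.
      by rewrite !rmorphB /= ey et.
    by rewrite !fmorph_div /= ey et.
  have bs a : iota a \in [pred x | s l x == s k x] by rewrite inE /= !gal_fix.
  move/(_ (Intermediate dv bs)) => /= xE; apply/eqP; apply: xE => y [i [n [le_nk ->]]].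
  by rewrite inE /= !sP // (leq_trans le_nk).
have mono k l x : (k <= l)%N -> x \in Ad k -> x \in Ad l.
  move=> le_kl; apply: adjoin_subset => y [i [n [le_nk ->]]].
  by exists i, n; rewrite (leq_trans le_nk).
pose G x y := exists k, x \in Ad k /\ y = s k x.
have two x y x' y' : G x y -> G x' y' -> exists k,
    [/\ x \in Ad k, y = s k x, x' \in Ad k & y' = s k x'].
  move=> [k [xk ->]] [l [xl ->]]; exists (maxn k l).
  have [lk ll] := (leq_maxl k l, leq_maxr k l).
  by rewrite (agree _ _ _ lk) // (agree _ _ _ ll) // (mono _ _ _ lk) // (mono _ _ _ ll).
have pG : pembedding G.
  split.
  - by move=> a; exists 0; rewrite adjoin_base gal_fix.
  - move=> x y x' y' Gx Gx'; have [k [xk -> xk' ->]] := two _ _ _ _ Gx Gx'.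
    by exists k; rewrite rpredB // rmorphB.
  - move=> x y x' y' Gx Gx'; have [k [xk -> xk' ->]] := two _ _ _ _ Gx Gx'.
    by exists k; rewrite rpredM // rmorphM.
  - by move=> x y [k [xk ->]]; exists k; rewrite rpredV fmorphV.
  by move=> y [k [_ ->]]; rewrite rmorph0.
have [t tP] := gal_extend pG; exists t => i n; apply: tP; exists n; split.
  by rewrite inE; apply/asboolP => E; apply; exists i, n.
by rewrite sP.
Qed.

End Extension.

(** * Galois orbits of known size *)
Section Orbits.
Variables (K L : fieldType) (iota : {rmorphism K -> L}).
Hypothesis sepL : separable_closure iota.
Variables (E : fieldType) (j : {rmorphism E -> L}).
Hypothesis subE : forall a, exists e, j e = iota a.

(** The orbit of x under Gal(L/E) has [E(x) : E] elements.  If the degree is at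
    least N and the orbit is confined to N candidates, all of them occur.  This
    is how ramification is turned into Galois elements. *)
Lemma gal_orbit_all N x (S : seq L) y :
    (forall p : {poly E}, p != 0 -> root (map_poly j p) x -> (N < size p)%N) ->
    (size S <= N)%N ->
    (forall s : Gal iota, (forall e, s (j e) = j e) -> s x \in S) ->
  y \in S -> exists2 s : Gal iota, forall e, s (j e) = j e & s x = y.
Proof.
move=> degx szS orbS yS.
have jj a : exists2 e, j e = iota a & j e = iota a by have [e ej] := subE a; exists e.
have [p [p0 px sep_p pmin]] := sep_minimal_poly sepL jj x.
have conj z : root (map_poly j p) z ->
    exists2 s : Gal iota, forall e, s (j e) = j e & s x = z.
  move=> pz; have pG := adjoin_graph_pemb jj p0 pmin pz px.
  have [s sP] := gal_extend sepL pG; exists s => [e|]; apply: sP.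
    by exists e%:P; rewrite !map_polyC !hornerC.
  by exists 'X; rewrite !map_polyX !hornerX.
have [rs uniq_rs def_p] := sepL_split sepL (etrans (separable_map j p) sep_p).
have rsP z : (z \in rs) = root (map_poly j p) z.
  by rewrite def_p rootZ ?lead_coef_eq0 ?map_poly_eq0 // root_prod_XsubC.
have sub : {subset rs <= S}.
  by move=> z; rewrite rsP => /conj[s sE <-]; apply: orbS.
have sz_rs : size p = (size rs).+1.
  rewrite -(size_map_poly j) def_p size_scale ?lead_coef_eq0 ?map_poly_eq0 //.
  by rewrite size_prod_XsubC.
have [|_ eq_rs] := uniq_min_size uniq_rs sub.
  by apply: leq_trans szS _; rewrite -ltnS -sz_rs degx.
by apply: conj; rewrite -rsP eq_rs.
Qed.

End Orbits.

(** * Chevalley's extension theorem *)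
Record subring (L : fieldType) := Subring {
  subring_pred : {pred L};
  subring_predP : subring_closed subring_pred
}.
HB.instance Definition _ L (R : subring L) :=
  GRing.isSubringClosed.Build L (subring_pred R) (subring_predP R).

Section Chevalley.
Variables (L : fieldType) (pi : L).
Hypothesis pi0 : pi != 0.
Implicit Types (R : subring L) (x z : L).
Local Notation "x \inR R" := (x \in subring_pred R) (at level 70).

Definition adjoin_ring_pred R x : {pred L} :=
  [pred y | `[< exists2 h : {poly L}, h \is a polyOver (subring_pred R) & y = h.[x] >]].

Lemma adjoin_ringP R x y :
  reflect (exists2 h : {poly L}, h \is a polyOver (subring_pred R) & y = h.[x])
    (y \in adjoin_ring_pred R x).
Proof. by rewrite inE; apply: asboolP. Qed.

Lemma adjoin_ring_closed R x : subring_closed (adjoin_ring_pred R x).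
Proof.
split=> [|y z /adjoin_ringP[h hR ->] /adjoin_ringP[g gR ->]
  |y z /adjoin_ringP[h hR ->] /adjoin_ringP[g gR ->]]; apply/adjoin_ringP.
- by exists 1; rewrite ?rpred1 ?hornerC.
- by exists (h - g); rewrite ?rpredB ?hornerD ?hornerN.
by exists (h * g); rewrite ?rpredM ?hornerM.
Qed.
Definition adjoin_ring R x := Subring (adjoin_ring_closed R x).

Lemma sub_adjoin_ring R x y : y \inR R -> y \inR adjoin_ring R x.
Proof. by move=> yR; apply/adjoin_ringP; exists y%:P; rewrite ?polyOverC ?hornerC. Qed.

Lemma mem_adjoin_ring R x : x \inR adjoin_ring R x.
Proof. by apply/adjoin_ringP; exists 'X; rewrite ?polyOverX ?hornerX. Qed.

Section Maximal.
Variable R : subring L.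
Hypotheses (piR : pi \inR R) (piVR : pi^-1 \notin subring_pred R).
Hypothesis maxR : forall R', (forall x, x \inR R -> x \inR R') ->
  pi^-1 \notin subring_pred R' -> forall x, x \inR R' -> x \inR R.

Lemma max_adjoin x : x \notin subring_pred R ->
  exists2 h, h \is a polyOver (subring_pred R) & pi * h.[x] = 1.
Proof.
move=> xR; have : pi^-1 \inR adjoin_ring R x.
  apply: contraR xR => piV'; apply: (maxR _ piV') (mem_adjoin_ring R x).
  exact: sub_adjoin_ring.
by case/adjoin_ringP=> h hR eh; exists h => //; rewrite -eh mulfV.
Qed.

(** Otherwise the inverse u^-1 generates over R a ring that contains pi^-1 by
    maximality; clearing the powers of u, which is 1 modulo pi, gives pi^-1 in
    R. *)
Lemma max_unit r : r \inR R -> (1 - pi * r)^-1 \inR R.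
Proof.
move=> rR; set u := 1 - pi * r; apply: contraR piVR => uR.
have u0 : u != 0 by apply: contraNneq uR => ->; rewrite invr0 rpred0.
have uiR : u \inR R by rewrite rpredB ?rpred1 ?rpredM.
have [h hR h1] := max_adjoin uR.
have [r' r'R un] : exists2 r', r' \inR R & u ^+ size h = 1 - pi * r'.
  elim: (size h) => [|n [r' r'R IH]]; first by exists 0; rewrite ?rpred0 // mulr0 subr0.
  exists (r' + r - pi * r' * r); first by rewrite !(rpredB, rpredD, rpredM).
  by rewrite exprS IH /u; ring.
have hu : u ^+ size h * h.[u^-1] \inR R.
  rewrite horner_coef mulr_sumr rpred_sum // => i _.
  rewrite mulrCA rpredM ?(polyOverP hR) // exprVn -expfB ?ltn_ord //.
  by rewrite rpredX.
have -> : pi^-1 = u ^+ size h * h.[u^-1] + r'.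
  apply: (mulfI pi0); rewrite mulfV // mulrDr mulrCA h1 mulr1 un; ring.
by rewrite rpredD.
Qed.

(** N z n bounds by n the number of terms of a relation which witnesses that
    pi is invertible in R[z]. *)
Let N z n := exists h, [/\ h \is a polyOver (subring_pred R), (size h <= n)%N & pi * h.[z] = 1].

(** The relation for z^-1 expresses 1, up to the unit 1 - pi g_0, in terms of
    pi and negative powers of z.  Multiplied by z^n it replaces the leading term
    of the relation for z by lower ones. *)
Lemma max_descent z n m : z != 0 -> N z n.+1 -> N z^-1 m.+1 -> (m <= n)%N -> N z n.
Proof.
move=> z0 [h [hR sz_h h1]] [g [gR sz_g g1]] le_mn.
have u0 : 1 - pi * g`_0 != 0.
  apply: contraNneq piVR => /eqP; rewrite subr_eq0 => /eqP eg.
  by rewrite -[pi^-1]mulr1 eg mulKf // (polyOverP gR).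
have uR := max_unit (polyOverP gR 0).
pose u := (1 - pi * g`_0)^-1.
pose s : {poly L} := \sum_(i < m) g`_i.+1 *: 'X^(n - i.+1).
exists (h - h`_n *: 'X^n + (pi * h`_n * u) *: s).
split.
- rewrite rpredD ?rpredB ?polyOverZ ?rpredM ?(polyOverP hR) ?polyOverXn //.
  by apply: rpred_sum => i _; rewrite polyOverZ ?(polyOverP gR) ?polyOverXn.
- apply/leq_sizeP => k le_nk; rewrite coefD coefB !coefZ coefXn /s coef_sum.
  rewrite big1 ?mulr0 ?addr0 => [|i _].
    case: eqP => [->|/eqP nk]; first by rewrite mulr1 subrr.
    rewrite mulr0 subr0; apply: nth_default; apply: leq_trans sz_h _.
    by rewrite ltn_neqAle eq_sym nk.
  rewrite coefZ coefXn; case: eqP => [ek|]; last by rewrite mulr0.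
  by have := ltn_ord i; move: ek le_mn le_nk; lia.
rewrite !hornerE horner_sum.
have -> : \sum_(i < m) (g`_i.+1 *: 'X^(n - i.+1)).[z] = z ^+ n * (g.[z^-1] - g`_0).
  rewrite (horner_coef_wide _ sz_g) big_ord_recl expr0 mulr1 addrC addKr mulr_sumr.
  apply: eq_bigr => i _; rewrite hornerZ hornerXn lift0.
  rewrite [RHS]mulrCA exprVn; congr (_ * _).
  rewrite -[in RHS](subnK (leq_trans (ltn_ord i) le_mn)) exprD mulfK //.
  exact: expf_neq0.
rewrite -{}h1 -[in RHS](addr0 h.[z]); congr (_ * _).
rewrite -addrA; congr (_ + _).
have -> : pi * h`_n * u * (z ^+ n * (g.[z^-1] - g`_0)) = h`_n * z ^+ n * (u * (pi * g.[z^-1] - pi * g`_0)) by ring.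
by rewrite g1 /u mulVf // mulr1 addNr.
Qed.

(** If neither x nor x^-1 were in R, both would satisfy a relation as above, and
    the descent would shorten the longer one for ever. *)
Lemma max_valuation x : x \inR R \/ x^-1 \inR R.
Proof.
have [->|x0] := eqVneq x 0; first by left; rewrite rpred0.
suff noN s z n m : (n + m <= s)%N -> z != 0 -> N z n -> N z^-1 m -> False.
  case: (boolP (x \inR R)) => [|/max_adjoin[h hR h1]]; first by left.
  case: (boolP (x^-1 \inR R)) => [|/max_adjoin[g gR g1]]; first by right.
  by case: (@noN _ x (size h) (size g) (leqnn _) x0); [exists h | exists g].
have N0 y : ~ N y 0.
  case=> h [_]; rewrite leqn0 size_poly_eq0 => /eqP ->; rewrite horner0 mulr0 => /esym/eqP.
  by rewrite oner_eq0.
elim: s z n m => [|s IH] z [|n] [|m] //= le_s z0 Nz Nz'; try exact: N0 Nz; try exact: N0 Nz'.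
have [le_mn | /ltnW le_nm] := leqP m n.
  by apply: (IH z n m.+1) => //; apply: max_descent Nz Nz' le_mn.
apply: (IH z n.+1 m) => //; first by rewrite addSnnS.
by apply: max_descent le_nm; rewrite ?invr_eq0 ?invrK.
Qed.

End Maximal.

Lemma chevalley (A : subring L) : pi \inR A -> pi^-1 \notin subring_pred A ->
  exists R : subring L, [/\ forall x, x \inR A -> x \inR R,
     pi^-1 \notin subring_pred R & forall x, x \inR R \/ x^-1 \inR R].
Proof.
move=> piA piVA.
pose H (X : L -> Prop) : {pred L} := [pred x | (x \inR A) || `[< X x >]].
have HP (X : L -> Prop) x : reflect (x \inR A \/ X x) (x \in H X).
  by rewrite inE; apply: (iffP orP) => [] [|/asboolP]; by [left | right].
pose P X := subring_closed (H X) /\ pi^-1 \notin H X.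
have P0 : P (fun=> False).
  have memH x : (x \in H (fun=> False)) = (x \inR A).
    by apply/HP/idP => [[]|]; last by left.
  split; last by rewrite memH.
  by split=> [|x y|x y]; rewrite !memH ?rpred1 //; [apply: rpredB | apply: rpredM].
have [|X [[clX piVX] maxX]] := @classical_sets.Zorn_bigcup _ P.
  move=> C CP totC; set U := classical_sets.bigcup _ _.
  have two x y : x \in H U -> y \in H U -> exists X, [/\ P X,
      forall r, r \in H X -> r \in H U, x \in H X & y \in H X].
    have sub X : C X -> forall r, r \in H X -> r \in H U.
      by move=> CX r /HP[rA|Xr]; apply/HP; [left | right; exists X].
    have sub0 r : r \in H (fun=> False) -> r \in H U.
      by move=> /HP[rA|//]; apply/HP; left.
    move=> /HP Hx /HP Hy; case: Hx Hy => [Ax|[X CX Xx]] [Ay|[Y CY Yy]].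
    - by exists (fun=> False); split=> //; apply/HP; left.
    - by exists Y; split; [apply: CP | apply: sub | apply/HP; left | apply/HP; right].
    - by exists X; split; [apply: CP | apply: sub | apply/HP; right | apply/HP; left].
    case: (totC X Y CX CY) => sXY.
      by exists Y; split; [apply: CP | apply: sub | apply/HP; right; apply: sXY | apply/HP; right].
    by exists X; split; [apply: CP | apply: sub | apply/HP; right | apply/HP; right; apply: sXY].
  split; last first.
    apply/negP => Hpi; have [X [[_ /negP nX] _ Xpi _]] := two _ _ Hpi Hpi.
    exact: nX.
  split=> [|x y Hx Hy|x y Hx Hy].
  - by apply/HP; left; rewrite rpred1.
  - by have [X [[[_ clB _] _] sub Xx Xy]] := two _ _ Hx Hy; apply/sub/clB.
  by have [X [[[_ _ clM] _] sub Xx Xy]] := two _ _ Hx Hy; apply/sub/clM.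
pose R := Subring clX.
have AR x : x \inR A -> x \inR R by move=> xA; apply/HP; left.
exists R; split=> //; apply: max_valuation => //; first exact: AR.
move=> R' sRR' piVR' x xR'; apply: contrapT => xR.
pose Y y := y \inR R'.
have HY y : (y \in H Y) = (y \inR R').
  apply/HP/idP => [[/AR/sRR'|] //|]; by right.
case: (maxX Y).
  split; first by move=> y Xy; apply: sRR'; apply/HP; right.
  by move=> /(_ x xR') Xx; apply: xR; apply/HP; right.
split; last by rewrite HY.
by split=> [|y z|y z]; rewrite !HY ?rpred1 //; [apply: rpredB | apply: rpredM].
Qed.

End Chevalley.

(** * Rational valuations from valuation rings *)

(** Values are rational because the extensions of a discrete valuation to K^sep
    have value group in Q.  The value at 0 is arbitrary; the predicates vge and
    vgt below treat it as infinite. *)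
Record qvaluation (L : fieldType) := QValuation {
  qval :> L -> rat;
  qvalM : forall x y, x != 0 -> y != 0 -> qval (x * y) = qval x + qval y;
  qvalD : forall x y, x != 0 -> y != 0 -> x + y != 0 ->
    Num.min (qval x) (qval y) <= qval (x + y)
}.

Section ValuationOfRing.
Variables (L : fieldType) (R : subring L) (pi : L).
Local Notation "x \inR" := (x \in subring_pred R) (at level 70).
Hypotheses (pi0 : pi != 0) (piR : pi \inR) (piVR : pi^-1 \notin subring_pred R).
Hypothesis Rval : forall x, x \inR \/ x^-1 \inR.

Definition vunit x := (x \inR) && (x^-1 \inR).

Lemma vunitM x y : vunit x -> vunit y -> vunit (x * y).
Proof. by move=> /andP[? ?] /andP[? ?]; rewrite /vunit invfM !rpredM. Qed.
Lemma vunitV x : vunit x^-1 = vunit x.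
Proof. by rewrite /vunit invrK andbC. Qed.
Lemma vunit1 : vunit 1. Proof. by rewrite /vunit invr1 rpred1. Qed.
Lemma vunitX x n : vunit x -> vunit (x ^+ n).
Proof. by move=> ux; elim: n => [|n IH]; rewrite ?vunit1 // exprS vunitM. Qed.

Lemma vunit_one_sub a : a \inR -> vunit (1 - pi * a).
Proof.
move=> aR; have uR : 1 - pi * a \inR by rewrite rpredB ?rpred1 ?rpredM.
rewrite /vunit uR /=; set u := 1 - pi * a.
have [|] := Rval (u / pi).
  have -> : u / pi = pi^-1 - a by rewrite /u; field.
  by move=> h; case/negP: piVR; rewrite -[pi^-1](subrK a) rpredD.
rewrite invfM invrK => h.
have [->|u0] := eqVneq u 0; first by rewrite invr0 rpred0.
have -> : u^-1 = 1 + u^-1 * pi * a.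
  by apply: (mulfI u0); rewrite mulrDr mulfV // !mulrA mulfV // /u; ring.
by rewrite rpredD ?rpred1 // rpredM.
Qed.

(** The maximal ideal of the valuation ring R. *)
Definition vmax x := (x == 0) || (x^-1 \notin subring_pred R).

Lemma vmaxD x y : vmax x -> vmax y -> vmax (x + y).
Proof.
have [->|x0] := eqVneq x 0; first by rewrite add0r.
have [->|y0] := eqVneq y 0; first by rewrite addr0.
rewrite /vmax (negPf x0) (negPf y0) /= => xm ym.
have [//|xy0 /=] := eqVneq (x + y) 0.
case: (Rval (y / x)) => [h|].
  apply: contra xm => xyR.
  have -> : x^-1 = (1 + y / x) * (x + y)^-1 by field; rewrite x0 xy0.
  by rewrite rpredM // rpredD ?rpred1.
rewrite invfM invrK mulrC => h.
apply: contra ym => xyR.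
have -> : y^-1 = (1 + x / y) * (x + y)^-1 by field; rewrite y0 xy0.
by rewrite rpredM // rpredD ?rpred1.
Qed.

Lemma vmax_sum I (r : seq I) (P : pred I) (f : I -> L) :
  (forall i, P i -> vmax (f i)) -> vmax (\sum_(i <- r | P i) f i).
Proof.
move=> fm; elim/big_rec: _ => [|i x Pi xm]; first by rewrite /vmax eqxx.
by rewrite vmaxD ?fm.
Qed.

Lemma exists_vmin (s : seq L) x0 : x0 \in s -> x0 != 0 ->
  exists x, [/\ x \in s, x != 0 & forall y, y \in s -> y / x \inR].
Proof.
elim: s x0 => // a s IH x0; rewrite inE.
have [s0|/hasPn ns0] := boolP (has (fun y => y != 0) s).
  case/hasP: s0 => y ys y0 _ _; have [x [xs nx0 xmin]] := IH y ys y0.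
  case: (Rval (a / x)) => [ax|].
    by exists x; split; rewrite ?inE ?xs ?orbT // => z /[!inE] /predU1P[->|/xmin].
  rewrite invfM invrK mulrC => xa.
  have [a0|na0] := eqVneq a 0.
    exists x; split; rewrite ?inE ?xs ?orbT // => z /[!inE] /predU1P[->|/xmin//].
    by rewrite a0 mul0r rpred0.
  exists a; split; rewrite ?inE ?eqxx // => z /[!inE] /predU1P[->|/xmin zx].
    by rewrite mulfV // rpred1.
  have -> : z / a = (z / x) * (x / a) by field; rewrite na0 nx0.
  by rewrite rpredM.
case/predU1P=> [-> na0|x0s nx0]; last by have := ns0 _ x0s; rewrite nx0.
exists a; split; rewrite ?inE ?eqxx // => z /[!inE] /predU1P[->|/ns0].
  by rewrite mulfV // rpred1.
by rewrite negbK => /eqP ->; rewrite mul0r rpred0.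
Qed.

(** This makes the quotient j / N in ring_val unique. *)
Lemma vunit_expz j : vunit (pi ^ j) -> j = 0.
Proof.
have pos n : vunit (pi ^+ n.+1) -> False.
  case/andP=> _ h; case/negP: piVR.
  have -> : pi^-1 = pi ^+ n * (pi ^+ n.+1)^-1.
    by rewrite exprS invfM mulrCA mulfV ?mulr1 // expf_neq0.
  by rewrite rpredM ?rpredX.
case: j => [[|n]|n] //; first by move/pos.
by rewrite -[pi ^ _]/((pi ^+ n.+1)^-1) vunitV => /pos.
Qed.

(** x^N is a unit times pi^j, so that x must have value j / N.  The condition
    valued says that the value group has rank one and is normalised by pi. *)
Definition has_value x (N : nat) (j : int) := (0 < N)%N && vunit (x ^+ N / pi ^ j).
Hypothesis valued : forall x, x != 0 -> exists N j, has_value x N j.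

Definition ring_val x : rat :=
  if pselect (exists Nj : nat * int, has_value x Nj.1 Nj.2) is left e
  then (projT1 (cid e)).2%:~R / (projT1 (cid e)).1%:R else 0.

Lemma has_value_eq x N j N' j' : x != 0 -> has_value x N j -> has_value x N' j' ->
  j * N' = j' * N.
Proof.
move=> x0 /andP[N0 u] /andP[N'0 u']; apply/eqP; rewrite -subr_eq0; apply/eqP.
apply: vunit_expz; rewrite expfzDr // -invr_expz.
have -> : pi ^ (j * N') * (pi ^ (j' * N))^-1
    = (x ^+ N' / pi ^ j') ^+ N * ((x ^+ N / pi ^ j) ^+ N')^-1.
  rewrite !expr_div_n -!exprM [(N' * N)%N]mulnC -!exprz_exp !exprnP.
  have h1 : (pi ^ j') ^ N != 0 by rewrite !expfz_neq0.
  have h2 : (pi ^ j) ^ N' != 0 by rewrite !expfz_neq0.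
  have h3 : x ^ (N * N)%N != 0 by rewrite expfz_neq0.
  have h4 : x ^ (N * N')%N != 0 by rewrite expfz_neq0.
  by field; rewrite h1 h2 h4.
by rewrite vunitM ?vunitX // vunitV vunitX.
Qed.

Lemma ring_valE x N j : x != 0 -> has_value x N j -> ring_val x = j%:~R / N%:R.
Proof.
move=> x0 v; rewrite /ring_val; case: pselect => [e|[]]; last by exists (N, j).
case: (cid e) => [[N' j'] /= v'].
have N0 : N%:R != 0 :> rat by rewrite pnatr_eq0 -lt0n; case/andP: v.
have N'0 : N'%:R != 0 :> rat by rewrite pnatr_eq0 -lt0n; case/andP: v'.
apply/eqP; rewrite eqr_div //; apply/eqP.
by have /(congr1 (fun z : int => z%:~R : rat)) := has_value_eq x0 v v'; rewrite !rmorphM.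
Qed.

Lemma ring_val1 : ring_val 1 = 0.
Proof. by rewrite (@ring_valE _ 1 0) ?oner_neq0 ?mul0r // /has_value /= expr1 divr1 vunit1. Qed.

Lemma ring_val_pi : ring_val pi = 1.
Proof. by rewrite (@ring_valE _ 1 1) // /has_value /= expr1 expr1z mulfV ?vunit1. Qed.

Lemma ring_valM x y : x != 0 -> y != 0 -> ring_val (x * y) = ring_val x + ring_val y.
Proof.
move=> x0 y0; have [N [j v]] := valued x0; have [N' [j' v']] := valued y0.
have [/andP[N0 u] /andP[N'0 u']] := (v, v').
rewrite (ring_valE x0 v) (ring_valE y0 v') (@ring_valE _ (N * N') (j * N' + j' * N)) ?mulf_neq0 //.
  have N0' : N%:R != 0 :> rat by rewrite pnatr_eq0 -lt0n.
  have N'0' : N'%:R != 0 :> rat by rewrite pnatr_eq0 -lt0n.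
  by rewrite natrM rmorphD !rmorphM /= addf_div // !pmulrn.
rewrite /has_value muln_gt0 N0 N'0 /=.
have -> : (x * y) ^+ (N * N') / pi ^ (j * N' + j' * N)
    = (x ^+ N / pi ^ j) ^+ N' * (y ^+ N' / pi ^ j') ^+ N.
  by rewrite expfzDr // invfM exprMn !expr_div_n -!exprM [(N' * N)%N]mulnC -!exprz_exp -!exprnP; ring.
by rewrite vunitM // vunitX.
Qed.

Lemma ring_valV x : x != 0 -> ring_val x^-1 = - ring_val x.
Proof.
move=> x0; apply/eqP; rewrite -addr_eq0 -ring_valM ?invr_eq0 //.
by rewrite mulVf // ring_val1.
Qed.

Lemma ring_val_ge0 x : x != 0 -> (x \inR) = (0 <= ring_val x).
Proof.
have half y : y != 0 -> y \inR -> 0 <= ring_val y.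
  move=> y0 yR; have [N [j v]] := valued y0; rewrite (ring_valE y0 v).
  rewrite divr_ge0 // ler0z; case/andP: v => N0 /andP[_ u].
  case: j u => // n u; case/negP: piVR; rewrite -[pi ^ _]/((pi ^+ n.+1)^-1) in u.
  have -> : pi^-1 = pi ^+ n * (y ^+ N * (y ^+ N / (pi ^+ n.+1)^-1)^-1).
    by rewrite exprS; field; rewrite pi0 oner_eq0 !expf_neq0.
  by rewrite !(rpredM, rpredX).
move=> x0; apply/idP/idP => [/half-> //|v0]; case: (Rval x) => // xVR.
have := half _ (invr_neq0 x0) xVR; rewrite ring_valV // oppr_ge0 => vx0.
have {v0 vx0}v0 : ring_val x = 0 by apply/eqP; rewrite eq_le vx0.
have [N [j v]] := valued x0; move: v0; rewrite (ring_valE x0 v) => /eqP.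
case/andP: v; case: N => // N _ /andP[u _].
have N0 : N.+1%:R != 0 :> rat by rewrite pnatr_eq0.
rewrite mulf_eq0 invr_eq0 (negPf N0) orbF intr_eq0 => /eqP j0.
move: u; rewrite j0 expr0z divr1 => u.
have : x ^+ N.+1 * x^-1 ^+ N \inR by rewrite rpredM // rpredX.
by rewrite exprS exprVn mulfK ?expf_neq0.
Qed.

Lemma ring_valD x y : x != 0 -> y != 0 -> x + y != 0 ->
  Num.min (ring_val x) (ring_val y) <= ring_val (x + y).
Proof.
have half a b : a != 0 -> b != 0 -> a + b != 0 -> ring_val a <= ring_val b ->
    ring_val a <= ring_val (a + b).
  move=> a0 b0 ab0 le_ab.
  have ba : b / a \inR by rewrite ring_val_ge0 ?mulf_neq0 ?invr_eq0 // ring_valM ?ring_valV ?invr_eq0 // subr_ge0.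
  have e : a + b = a * (1 + b / a) by field.
  have nz : 1 + b / a != 0 by apply: contraNneq ab0 => e0; rewrite e e0 mulr0.
  by rewrite e ring_valM // lerDl -ring_val_ge0 // rpredD ?rpred1.
move=> x0 y0 xy0; rewrite ge_min.
have [le|/ltW le] := leP (ring_val x) (ring_val y); first by rewrite half.
by rewrite addrC half ?orbT // addrC.
Qed.

Definition ring_qval := QValuation ring_valM ring_valD.

End ValuationOfRing.

(** * Extending a place of F(theta) to the separable closure *)
Lemma fraction_div (R : idomainType) (x : {fraction R}) :
  exists n d : R, d != 0 /\ x = tofrac n / tofrac d.
Proof.
elim/quotW: x => y.
exists \n_y, \d_y; split; first exact: denom_ratioP.
have d0 : tofrac \d_y != 0 by rewrite tofrac_eq0 denom_ratioP.
apply: (mulIf d0); rewrite divfK //.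
have tE (a : R) : tofrac a = \pi_(FracField.type R)%qT (Ratio a 1) by rewrite piE.
rewrite !tE -[LHS]/(FracField.mul _ _) -FracField.pi_mul.
apply/eqP; rewrite FracField.equivf_def /FracField.mulf.
by rewrite !numden_Ratio ?mulf_neq0 ?oner_eq0 ?denom_ratioP // !mulr1 mulrC.
Qed.

Lemma poly_multiplicity (F : fieldType) (ell : {poly F}) (p : {poly F}) :
    (1 < size ell)%N -> p != 0 ->
  exists n p1, p = ell ^+ n * p1 /\ ~~ (ell %| p1).
Proof.
move=> sz_ell; have [m] := ubnP (size p); elim: m p => // m IH p /ltnSE le_pm p0.
have [/dvdpP[q def_p]|nd] := boolP (ell %| p); last by exists 0%N, p; rewrite expr0 mul1r.
have q0 : q != 0 by apply: contraNneq p0 => q0; rewrite def_p q0 mul0r.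
have ell0 : ell != 0 by rewrite -size_poly_gt0 ltnW.
have [|n [p1 [def_q nd]]] := IH q _ q0.
  apply: leq_trans _ le_pm; rewrite def_p size_mul //.
  by case: (size ell) sz_ell => [|[|k]] // _; rewrite addnS /= addnS ltnS leq_addr.
by exists n.+1, p1; rewrite exprS -mulrA -def_q mulrC.
Qed.

Section PlaceValuation.
Variables (F : finFieldType) (L : fieldType) (iota : {rmorphism ratfun F -> L}).
Hypothesis sepL : separable_closure iota.
Variable ell : {poly F}.
Hypothesis irr_ell : irreducible_poly ell.

(** The polynomial p evaluated at theta, as an element of L. *)
Definition rpol (p : {poly F}) : L := iota (tofrac p).
Lemma rpol_zmod : zmod_morphism rpol.
Proof. by move=> p q; rewrite /rpol !rmorphB. Qed.
Lemma rpol_monoid : monoid_morphism rpol.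
Proof. by split=> [|p q]; rewrite /rpol ?rmorph1 // !rmorphM. Qed.
HB.instance Definition _ := GRing.isZmodMorphism.Build {poly F} L rpol rpol_zmod.
HB.instance Definition _ := GRing.isMonoidMorphism.Build {poly F} L rpol rpol_monoid.

Lemma rpol_eq0 p : (rpol p == 0) = (p == 0).
Proof. by rewrite /rpol fmorph_eq0 tofrac_eq0. Qed.

(** Chevalley's theorem for F[theta] and ell gives a valuation ring of L.  Its
    value group has rational values: among the terms of an algebraic relation
    P(x) = 0 two have the same value, so a power of x is an element of K times
    a unit. *)
Lemma place_valuation : exists w : qvaluation L,
  w (rpol ell) = 1 /\ forall p, ~~ (ell %| p) -> w (rpol p) = 0.
Proof.
have ell_gt1 : (1 < size ell)%N by case: irr_ell.
have ell0 : ell != 0 by rewrite -size_poly_gt0 ltnW.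
set pi := rpol ell; have pi0 : pi != 0 by rewrite rpol_eq0.
pose A0 : {pred L} := [pred x | `[< exists p, x = rpol p >]].
have A0P x : reflect (exists p, x = rpol p) (x \in A0) by rewrite inE; apply: asboolP.
have A0_closed : subring_closed A0.
  split=> [|x y /A0P[p ->] /A0P[q ->]|x y /A0P[p ->] /A0P[q ->]]; apply/A0P.
  - by exists 1; rewrite rmorph1.
  - by exists (p - q); rewrite rmorphB.
  by exists (p * q); rewrite rmorphM.
pose A := Subring A0_closed.
have piA : pi \in subring_pred A by apply/A0P; exists ell.
have piVA : pi^-1 \notin subring_pred A.
  apply/negP => /A0P[p ep].
  have /eqP : pi * rpol p = rpol 1 by rewrite -ep mulfV // rmorph1.
  rewrite -rmorphM -subr_eq0 -rmorphB rpol_eq0 subr_eq0 => /eqP/(congr1 (fun q : {poly F} => size q)).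
  rewrite size_poly1; have [->|p0] := eqVneq p 0; first by rewrite mulr0 size_poly0.
  rewrite size_mul // => e; move: p0 ell_gt1 e; rewrite -size_poly_gt0.
  by case: (size ell) (size p) => [|[|k]] [|m] // _ _; rewrite addSn addnS /= addSn.
have [R [AR piVR Rval]] := chevalley pi0 piA piVA.
have piR := AR _ piA.
have rpolR p : rpol p \in subring_pred R by apply: AR; apply/A0P; exists p.
(* by a Bezout relation with ell *)
have unit_rpol p : ~~ (ell %| p) -> vunit R (rpol p).
  rewrite -(irreducible_poly_coprime _ irr_ell) => /Bezout_eq1_coprimepP[[a b] /= ab].
  have /andP[_ u] := vunit_one_sub pi0 piR piVR Rval (rpolR a).
  rewrite /vunit rpolR /=.
  have e : 1 - pi * rpol a = rpol b * rpol p.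
    by rewrite -(rmorph1 rpol) -ab rmorphD !rmorphM /= -/pi; ring.
  have b0 : rpol b != 0.
    apply: contraNneq piVR => b0; move/eqP: e; rewrite b0 mul0r subr_eq0 => /eqP e.
    by rewrite -[pi^-1]mulr1 e mulKf.
  have := rpredM (rpolR b) u; rewrite {}e.
  by rewrite invfM mulrA mulfV // mul1r.
have valuedK a : a != 0 -> exists j : int, vunit R (iota a / pi ^ j).
  have [n [d [d0 ->]]] := fraction_div a; rewrite mulf_eq0 invr_eq0 !tofrac_eq0 (negPf d0) orbF => n0.
  have [i [n1 [-> un]]] := poly_multiplicity ell_gt1 n0.
  have [k [d1 [-> ud]]] := poly_multiplicity ell_gt1 d0.
  exists (i%:Z - k%:Z); rewrite fmorph_div -![iota (tofrac _)]/(rpol _) !rmorphM !rmorphXn -/pi.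
  have nz m : pi ^+ m != 0 by rewrite expf_neq0.
  have nzd : rpol d1 != 0.
    by rewrite rpol_eq0; apply: contraNneq ud => ->; rewrite dvdp0.
  have -> : pi ^+ i * rpol n1 / (pi ^+ k * rpol d1) / pi ^ (i%:Z - k%:Z) = rpol n1 / rpol d1.
    by rewrite expfzDr // -invr_expz -!exprnP; field; rewrite !nz nzd.
  by rewrite vunitM ?vunitV ?unit_rpol.
have valuedL x : x != 0 -> exists N j, has_value R pi x N j.
  move=> x0; have [P /separable_poly_neq0 P0 /rootP Px] := sepL.1 x.
  pose T i := iota P`_i * x ^+ i.
  (* a term of least value, and then another one of the same value *)
  have [i0 [i0P Ti0 minT]] : exists i0 : 'I_(size P), [/\ true, T i0 != 0
      & forall j : 'I_(size P), T j / T i0 \in subring_pred R].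
    have lc : ((size P).-1 < size P)%N by rewrite ltn_predL size_poly_gt0.
    have [||t [/mapP[i0 _ ->] nz min]] := @exists_vmin _ R Rval [seq T (val i) | i : 'I_(size P)] (T (size P).-1).
    - by apply/mapP; exists (Ordinal lc); rewrite ?mem_enum.
    - by rewrite mulf_neq0 ?expf_neq0 // fmorph_eq0 -lead_coefE lead_coef_eq0.
    exists i0; split=> // j; apply: min; apply/mapP; exists j => //; exact: mem_enum.
  have [j ne_ji uj] : exists2 j : 'I_(size P), j != i0 & ~~ vmax R (T j / T i0).
    apply: contrapT => noj.
    have : vmax R (\sum_(j < size P | j != i0) T j / T i0).
      apply: vmax_sum => // j ne; apply: contrapT => nm; apply: noj.
      by exists j => //; apply/negP.
    have sumT : \sum_(j < size P) T j = 0.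
      by rewrite -[RHS]Px horner_coef size_map_poly; apply: eq_bigr => i _; rewrite coef_map.
    move: sumT; rewrite (bigD1 i0) //= => /eqP; rewrite addrC addr_eq0 => /eqP sumT.
    rewrite -mulr_suml sumT mulNr mulfV // /vmax oppr_eq0 oner_eq0 /= invrN invr1.
    by rewrite rpredN rpred1.
  have {uj} [Tj uj] : T j != 0 /\ vunit R (T j / T i0).
    move: uj; rewrite /vmax negb_or negbK mulf_eq0 negb_or => /andP[/andP[-> _] u].
    by rewrite /vunit u minT.
  have aj0 : P`_j != 0 by apply: contraNneq Tj => a0; rewrite /T a0 rmorph0 mul0r.
  have ai0 : P`_i0 != 0 by apply: contraNneq Ti0 => a0; rewrite /T a0 rmorph0 mul0r.
  clear minT i0P; wlog lt_ij : i0 j ne_ji Ti0 Tj uj aj0 ai0 / (i0 < j)%N.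
    move=> wl; case: (ltngtP i0 j) => [lt|lt|e]; first exact: (wl i0 j).
      by apply: (wl j i0) => //; rewrite 1?eq_sym // -vunitV invfM invrK mulrC.
    by case/eqP: ne_ji; apply: val_inj.
  have [r ur] := valuedK (P`_j / P`_i0) (mulf_neq0 aj0 (invr_neq0 ai0)).
  exists (j - i0)%N, (- r); rewrite /has_value subn_gt0 lt_ij /=.
  have -> : x ^+ (j - i0) / pi ^ (- r) = (T j / T i0) * (iota (P`_j / P`_i0) / pi ^ r)^-1.
    have ej : x ^+ j = x ^+ (j - i0) * x ^+ i0 by rewrite -exprD subnK // ltnW.
    have nzj : iota P`_j != 0 by rewrite fmorph_eq0 aj0.
    have nzi : iota P`_i0 != 0 by rewrite fmorph_eq0 ai0.
    have [nzx nzp] : x ^+ i0 != 0 /\ pi ^ r != 0 by rewrite expf_neq0 ?expfz_neq0.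
    rewrite /T fmorph_div ej -invr_expz; move: nzj nzi nzx nzp.
    move: (iota _) (iota _) (x ^+ i0) (x ^+ _) (pi ^ r) => a c y z t a0 c0 y0 t0.
    by field; rewrite a0 c0 y0 t0 oner_eq0.
  by rewrite vunitM ?vunitV.
exists (ring_qval pi0 piR piVR Rval valuedL); split; first exact: ring_val_pi.
move=> p ndp; rewrite /= (@ring_valE _ R pi pi0 piR piVR _ 1 0) ?mul0r //.
- by rewrite rpol_eq0; apply: contraNneq ndp => ->; rewrite dvdp0.
by rewrite /has_value /= expr1 divr1 unit_rpol.
Qed.

End PlaceValuation.

(** * Calculus of valuations *)
Section ValuationTheory.
Variables (L : fieldType) (w : qvaluation L).
Implicit Types x y : L.

Lemma qval1 : w 1 = 0.
Proof.
by apply: (addrI (w 1)); rewrite -qvalM ?oner_neq0 // mulr1 addr0.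
Qed.

Lemma qvalX x n : x != 0 -> w (x ^+ n) = w x * n%:R.
Proof.
move=> x0; elim: n => [|n IH]; first by rewrite expr0 mulr0 qval1.
by rewrite exprS qvalM ?expf_neq0 // IH -natr1 mulrDr mulr1 addrC.
Qed.

Lemma qvalV x : x != 0 -> w x^-1 = - w x.
Proof.
move=> x0; apply/eqP; rewrite -addr_eq0 -qvalM ?invr_eq0 //.
by rewrite mulVf // qval1.
Qed.

Lemma qval_div x y : x != 0 -> y != 0 -> w (x / y) = w x - w y.
Proof. by move=> x0 y0; rewrite qvalM ?invr_eq0 // qvalV. Qed.

Lemma qvalN x : w (- x) = w x.
Proof.
have [->|x0] := eqVneq x 0; first by rewrite oppr0.
have wN1 : w (-1) = 0.
  have : w ((-1) ^+ 2) = 0 by rewrite sqrrN expr1n qval1.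
  by rewrite qvalX ?oppr_eq0 ?oner_eq0 // => h; lra.
by rewrite -mulN1r qvalM ?wN1 ?add0r // oppr_eq0 oner_eq0.
Qed.

Definition vge (r : rat) x := (x == 0) || (r <= w x).
Definition vgt (r : rat) x := (x == 0) || (r < w x).

Lemma vge0 r : vge r 0. Proof. by rewrite /vge eqxx. Qed.
Lemma vgt0 r : vgt r 0. Proof. by rewrite /vgt eqxx. Qed.
Lemma vgeE r x : x != 0 -> vge r x = (r <= w x).
Proof. by rewrite /vge => /negPf ->. Qed.
Lemma vgtE r x : x != 0 -> vgt r x = (r < w x).
Proof. by rewrite /vgt => /negPf ->. Qed.
Lemma vge_refl x : vge (w x) x. Proof. by rewrite /vge lexx orbT. Qed.

Lemma vgeW r s x : r <= s -> vge s x -> vge r x.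
Proof. by rewrite /vge => rs /orP[->|/(le_trans rs)->] //; rewrite orbT. Qed.
Lemma vgtW r x : vgt r x -> vge r x.
Proof. by rewrite /vgt /vge => /orP[->|/ltW->] //; rewrite orbT. Qed.
Lemma vge_gt r s x : r < s -> vge s x -> vgt r x.
Proof. by rewrite /vge /vgt => rs /orP[->|/(lt_le_trans rs)->] //; rewrite orbT. Qed.

Lemma vgeN r x : vge r (- x) = vge r x.
Proof. by rewrite /vge oppr_eq0 qvalN. Qed.
Lemma vgtN r x : vgt r (- x) = vgt r x.
Proof. by rewrite /vgt oppr_eq0 qvalN. Qed.

Lemma vgeD r x y : vge r x -> vge r y -> vge r (x + y).
Proof.
rewrite /vge; have [->|x0] := eqVneq x 0; first by rewrite add0r.
have [->|y0] := eqVneq y 0; first by rewrite addr0 (negPf x0).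
have [//|xy0 /= rx ry] := eqVneq (x + y) 0.
by apply: le_trans (qvalD w x0 y0 xy0); rewrite le_min rx ry.
Qed.

Lemma vgtD r x y : vgt r x -> vgt r y -> vgt r (x + y).
Proof.
rewrite /vgt; have [->|x0] := eqVneq x 0; first by rewrite add0r.
have [->|y0] := eqVneq y 0; first by rewrite addr0 (negPf x0).
have [//|xy0 /= rx ry] := eqVneq (x + y) 0.
by apply: lt_le_trans (qvalD w x0 y0 xy0); rewrite lt_min rx ry.
Qed.

Lemma vgeB r x y : vge r x -> vge r y -> vge r (x - y).
Proof. by move=> rx ry; rewrite vgeD ?vgeN. Qed.
Lemma vgtB r x y : vgt r x -> vgt r y -> vgt r (x - y).
Proof. by move=> rx ry; rewrite vgtD ?vgtN. Qed.

Lemma vgeM r s x y : vge r x -> vge s y -> vge (r + s) (x * y).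
Proof.
rewrite /vge mulf_eq0; have [//|x0] := eqVneq x 0; have [//|y0 /= rx sy] := eqVneq y 0.
by rewrite qvalM // lerD.
Qed.

Lemma vgtM r s x y : vge r x -> vgt s y -> vgt (r + s) (x * y).
Proof.
rewrite /vge /vgt mulf_eq0; have [//|x0] := eqVneq x 0; have [//|y0 /= rx sy] := eqVneq y 0.
by rewrite qvalM // ler_ltD.
Qed.

Lemma vge_sum r I (s : seq I) (P : pred I) (f : I -> L) :
  (forall i, P i -> vge r (f i)) -> vge r (\sum_(i <- s | P i) f i).
Proof. by move=> rf; elim/big_rec: _ => [|i x Pi xr]; rewrite ?vge0 ?vgeD ?rf. Qed.
Lemma vgt_sum r I (s : seq I) (P : pred I) (f : I -> L) :
  (forall i, P i -> vgt r (f i)) -> vgt r (\sum_(i <- s | P i) f i).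
Proof. by move=> rf; elim/big_rec: _ => [|i x Pi xr]; rewrite ?vgt0 ?vgtD ?rf. Qed.

(** The dominant term determines the value of a sum. *)
Lemma qval_dom x y : x != 0 -> vgt (w x) y -> x + y != 0 /\ w (x + y) = w x.
Proof.
move=> x0 xy; have xy0 : x + y != 0.
  apply: contraTneq xy => /eqP; rewrite addr_eq0 => /eqP ex.
  have y0 : y != 0 by rewrite -oppr_eq0 -ex.
  by rewrite vgtE // ex qvalN ltxx.
split=> //; apply/eqP; rewrite eq_le; apply/andP; split; last first.
  by rewrite -vgeE // vgeD ?vge_refl ?vgtW.
rewrite leNgt; apply/negP => lt.
have : vgt (w x) (x + y - y) by rewrite vgtB // vgtE.
by rewrite addrK vgtE // ltxx.
Qed.

Lemma vintX n x : vge 0 x -> vge 0 (x ^+ n).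
Proof.
move=> x0; elim: n => [|n IH]; first by rewrite expr0 vgeE ?oner_neq0 // qval1.
by rewrite exprS -[0]addr0 vgeM.
Qed.

Lemma vintM x y : vge 0 x -> vge 0 y -> vge 0 (x * y).
Proof. by move=> x0 y0; rewrite -[0]addr0 vgeM. Qed.

Lemma vint1 : vge 0 1.
Proof. by rewrite vgeE ?oner_neq0 // qval1. Qed.

Lemma vint_horner (f : {poly L}) x :
  (forall i, vge 0 f`_i) -> vge 0 x -> vge 0 f.[x].
Proof.
by move=> f0 x0; rewrite horner_coef vge_sum // => i _; rewrite vintM ?vintX.
Qed.

Lemma vint_root (f : {poly L}) x : f \is monic ->
  (forall i, vge 0 f`_i) -> root f x -> vge 0 x.
Proof.
move=> fm f0 /rootP fx; have [->|x0] := eqVneq x 0; first exact: vge0.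
rewrite vgeE // leNgt; apply/negP => x_lt0.
have sz : size f = (size f).-1.+1 by rewrite prednK // size_poly_gt0 monic_neq0.
move: fx; rewrite horner_coef sz big_ord_recr /= -lead_coefE (monicP fm) mul1r addrC.
set n := (size f).-1; case: (posnP n) => [->|n0].
  by rewrite big_ord0 expr0 addr0 => /eqP; rewrite oner_eq0.
move/eqP; apply/negP; have [] // := @qval_dom (x ^+ n) (\sum_(i < n) f`_i * x ^+ i).
  exact: expf_neq0.
apply: vgt_sum => i _; rewrite qvalX // -[_ * _]add0r.
apply: vgtM => //; rewrite vgtE ?expf_neq0 // qvalX //.
by rewrite ltr_nM2l // ltr_nat.
Qed.

(** Values on E are integers.  If i w(x) is not an integer for 0 < i < N, the
    terms of a polynomial of degree < N over E have pairwise distinct values at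
    x and cannot cancel.  So x has degree at least N over E. *)
Lemma deg_bound (E : fieldType) (j : {rmorphism E -> L}) N x :
    (forall e, e != 0 -> exists z : int, w (j e) = z%:~R) -> x != 0 ->
    (forall i (z : int), (0 < i < N)%N -> w x * i%:R <> z%:~R) ->
  forall p : {poly E}, p != 0 -> root (map_poly j p) x -> (N < size p)%N.
Proof.
move=> wE x0 xN p p0 /rootP px; rewrite ltnNge; apply/negP => sz_p.
pose T (i : 'I_(size p)) := j p`_i * x ^+ i.
have lc : ((size p).-1 < size p)%N by rewrite ltn_predL size_poly_gt0.
have lcP : p`_(Ordinal lc) != 0 by rewrite /= -lead_coefE lead_coef_eq0.
case: (@Order.TotalTheory.arg_minP _ rat _ (Ordinal lc) (fun i => p`_i != 0) (fun i => w (T i)) lcP) => i0 pi0 min.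
have Ti0 : T i0 != 0 by rewrite mulf_neq0 ?expf_neq0 // fmorph_eq0.
have : \sum_i T i == 0.
  by rewrite -[X in _ == X]px horner_coef size_map_poly; apply/eqP/eq_bigr => i _; rewrite coef_map.
rewrite (bigD1 i0) //=; apply/negP.
have [] // := @qval_dom (T i0) (\sum_(i | i != i0) T i) Ti0.
apply: vgt_sum => i ne; rewrite /vgt.
have [//|Ti /=] := eqVneq (T i) 0.
have pi : p`_i != 0 by apply: contraNneq Ti => e; rewrite /T e rmorph0 mul0r.
rewrite lt_neqAle min // andbT; apply: contra_neq ne.
have wT (k : 'I_(size p)) : p`_k != 0 -> exists z : int, w (T k) = z%:~R + w x * k%:R.
  move=> pk; have [z ez] := wE _ pk; exists z.
  by rewrite qvalM ?fmorph_eq0 ?expf_neq0 // ez qvalX.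
have [z ez] := wT _ pi0; have [z' ez'] := wT _ pi; rewrite ez ez' => e.
apply: val_inj; case: (ltngtP i i0) => // lt; exfalso.
  apply: (xN (i0 - i)%N (z' - z)); first by have := ltn_ord i0; move: lt sz_p; lia.
  by rewrite natrB 1?ltnW // rmorphB /= mulrBr; lra.
apply: (xN (i - i0)%N (z - z')); first by have := ltn_ord i; move: lt sz_p; lia.
by rewrite natrB 1?ltnW // rmorphB /= mulrBr; lra.
Qed.

End ValuationTheory.

(** * Power series *)
Section FpsRing.
Variable R : comNzRingType.
Implicit Types a b : fps R.

Lemma fps_coefD a b n : fps_coef (a + b) n = fps_coef a n + fps_coef b n.
Proof. by []. Qed.
Lemma fps_coefB a b n : fps_coef (a - b) n = fps_coef a n - fps_coef b n.
Proof. by []. Qed.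
Lemma fps_coef0 n : fps_coef (0 : fps R) n = 0.
Proof. by []. Qed.
Lemma fps_coefM a b n :
  fps_coef (a * b) n = \sum_(i < n.+1) fps_coef a i * fps_coef b (n - i).
Proof. by []. Qed.
Lemma fps_coef_sum I (r : seq I) (P : pred I) (f : I -> fps R) n :
  fps_coef (\sum_(i <- r | P i) f i) n = \sum_(i <- r | P i) fps_coef (f i) n.
Proof. exact: (big_morph (fun a => fps_coef a n) (fun a b => fps_coefD a b n) (fps_coef0 n)). Qed.

Definition fpsT : fps R := Fps (fun n => (n == 1)%:R).
Definition fpsC (x : R) : fps R := Fps (fun n => if n == 0 then x else 0).

Lemma fps_coefTM0 a : fps_coef (fpsT * a) 0 = 0.
Proof. by rewrite fps_coefM big_ord1 mul0r. Qed.
Lemma fps_coefTM a n : fps_coef (fpsT * a) n.+1 = fps_coef a n.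
Proof.
rewrite fps_coefM big_ord_recl mul0r add0r big_ord_recl /= mul1r subn1 /=.
by rewrite big1 ?addr0 // => i _; rewrite mul0r.
Qed.

Lemma fps_coefCM x a n : fps_coef (fpsC x * a) n = x * fps_coef a n.
Proof.
rewrite fps_coefM big_ord_recl /= subn0 big1 ?addr0 // => i _.
by rewrite mul0r.
Qed.

Lemma fpsT_inj : injective ( *%R fpsT).
Proof.
move=> a b e; apply: fpsP => n.
by have := congr1 (fun c => fps_coef c n.+1) e; rewrite !fps_coefTM.
Qed.

Definition fps_shift a : fps R := Fps (fun n => fps_coef a n.+1).

Lemma fps_shiftK a : fps_coef a 0 = 0 -> a = fpsT * fps_shift a.
Proof. by move=> a0; apply: fpsP => -[|n]; rewrite ?fps_coefTM0 ?fps_coefTM. Qed.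

Lemma fps_coefTXM_small a k n : (n < k)%N -> fps_coef (fpsT ^+ k * a) n = 0.
Proof.
elim: k n => // k IH [|n] lt; rewrite exprS -mulrA ?fps_coefTM0 // fps_coefTM.
exact: IH.
Qed.

(** The geometric series of b, whose n-th coefficient is a finite sum. *)
Lemma fps_shift_unit b : fps_coef b 0 = 0 -> exists a, a * (1 - b) = 1.
Proof.
move/fps_shiftK=> eb; exists (Fps (fun n => \sum_(k < n.+1) fps_coef (b ^+ k) n)).
set a := Fps _.
have b_small k n : (n < k)%N -> fps_coef (b ^+ k) n = 0.
  by move=> lt; rewrite eb exprMn fps_coefTXM_small.
have aE N n : (n <= N)%N -> fps_coef a n = fps_coef (\sum_(k < N.+1) b ^+ k) n.
  move=> le; rewrite fps_coef_sum /a /= (big_ord_widen _ (fun k => fps_coef (b ^+ k) n) (_ : n.+1 <= N.+1)%N) //.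
  rewrite big_mkcond; apply: eq_bigr => k _; case: ltnP => // lt.
  by rewrite b_small.
apply: fpsP => n; rewrite fps_coefM.
rewrite (eq_bigr (fun i : 'I_n.+1 => fps_coef (\sum_(k < n.+1) b ^+ k) i * fps_coef (1 - b) (n - i))).
  rewrite -fps_coefM mulrC -[in RHS](subr0 1) fps_coefB.
  have -> : (1 - b) * \sum_(k < n.+1) b ^+ k = 1 - b ^+ n.+1.
    by rewrite -[in RHS](expr1n _ n.+1) subrXX; congr (_ * _); apply: eq_bigr => i _; rewrite expr1n mul1r.
  by rewrite fps_coefB b_small.
by move=> i _; rewrite (aE n) // -ltnS.
Qed.

End FpsRing.

Section FpsMap.
Variables (R R' : comNzRingType) (g : {rmorphism R -> R'}).
Definition fps_map (a : fps R) : fps R' := Fps (fun n => g (fps_coef a n)).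
Lemma fps_map_zmod : zmod_morphism fps_map.
Proof. by move=> a b; apply: fpsP => n; rewrite /= rmorphB. Qed.
Lemma fps_map_monoid : monoid_morphism fps_map.
Proof.
split=> [|a b]; apply: fpsP => n /=; first by rewrite rmorph_nat.
by rewrite rmorph_sum; apply: eq_bigr => i _; rewrite rmorphM.
Qed.
HB.instance Definition _ := GRing.isZmodMorphism.Build (fps R) (fps R') fps_map fps_map_zmod.
HB.instance Definition _ := GRing.isMonoidMorphism.Build (fps R) (fps R') fps_map fps_map_monoid.
Lemma fps_mapT : fps_map (fpsT R) = fpsT R'.
Proof. by apply: fpsP => n /=; rewrite rmorph_nat. Qed.
Lemma fps_mapC x : fps_map (fpsC x) = fpsC (g x).
Proof. by apply: fpsP => -[|n] //=; rewrite rmorph0. Qed.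
End FpsMap.

Section FpsField.
Variable L : fieldType.
Implicit Types a b : fps L.

Lemma fps_unitE a : (a \is a GRing.unit) = (fps_coef a 0 != 0).
Proof.
apply/idP/idP => [|a0].
  case/unitrP=> b [ba _]; apply/negP => /eqP a0.
  have := congr1 (fun c => fps_coef c 0) ba; rewrite fps_coefM big_ord1 a0 mulr0.
  by move/eqP; rewrite eq_sym oner_eq0.
have [|b eb] := @fps_shift_unit L (1 - fpsC (fps_coef a 0)^-1 * a).
  by rewrite fps_coefB fps_coefCM mulVf // subrr.
apply/unitrP; exists (b * fpsC (fps_coef a 0)^-1).
by rewrite [a * _]mulrC -mulrA; move: eb; rewrite opprB addrC subrK => ->.
Qed.

Lemma fps_mulIr a b c : fps_coef a 0 != 0 -> b * a = c * a -> b = c.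
Proof. by rewrite -fps_unitE => ua; apply: mulIr. Qed.

End FpsField.

(** * The Tate module as a module of power series *)
Section TateSeries.
Variables (F : finFieldType) (L : fieldType) (iota : {rmorphism ratfun F -> L}).
Variable b : ratfun F.

Definition scalar : {rmorphism F -> L} := iota \o ratconst F.
Definition frob : {rmorphism L -> L} := qfrob scalar 1.
Lemma frobE x : frob x = x ^+ #|F|. Proof. by []. Qed.

Lemma frob_scalar a : frob (scalar a) = scalar a.
Proof. exact: qfrob_const. Qed.

Lemma frob_fixed x : frob x = x -> exists a, x = scalar a.
Proof.
move=> ex; have := congr1 (fun p => (map_poly scalar p).[x]) (finField_genPoly F).
rewrite rmorphB /= map_polyXn map_polyX hornerD hornerN hornerXn hornerX -frobE ex subrr.
rewrite rmorph_prod horner_prod => /esym/eqP/prodf_eq0[a _].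
rewrite rmorphB /= map_polyX map_polyC hornerXsubC subr_eq0 => /eqP ->.
by exists a.
Qed.

(** embS and frobS are the inclusion F[[t]] -> L[[t]] and the Frobenius of the
    coefficients; by frobS_fixed the image of the former is the fixed ring of
    the latter. *)
Definition embS : {rmorphism fps F -> fps L} := fps_map scalar.
Definition frobS : {rmorphism fps L -> fps L} := fps_map frob.

Lemma frobS_emb a : frobS (embS a) = embS a.
Proof. by apply: fpsP => n /=; rewrite frob_scalar. Qed.

Lemma frobS_fixed X : frobS X = X -> exists a, X = embS a.
Proof.
move=> eX; have ex n : exists a, fps_coef X n = scalar a.
  by apply: frob_fixed; rewrite -[in RHS]eX.
exists (Fps (fun n => projT1 (cid (ex n)))); apply: fpsP => n /=.
by case: cid.
Qed.

Definition th := iota (theta F).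
Definition bb := iota b.

Lemma th_neq0 : th != 0.
Proof. by rewrite fmorph_eq0 tofrac_eq0 polyX_eq0. Qed.

Local Notation phi := (phi2 b).

Lemma tact_const a x : tact iota (tconst (ratconst F) a) x = iota a * x.
Proof.
rewrite (@tactE _ _ _ _ _ 1) ?size_polyC_leq1 // big_ord1.
by rewrite /tconst coefC /qfrob expn0 expr1.
Qed.

Lemma tact_tau x : tact iota (tau (ratconst F)) x = frob x.
Proof.
rewrite (@tactE _ _ _ _ _ 2) ?size_polyX // !big_ord_recl big_ord0 /tau !coefX /=.
by rewrite rmorph0 mul0r rmorph1 mul1r add0r addr0.
Qed.

Lemma dact_t x : dact iota phi 'X x = th * x + bb * frob x - frob (frob x).
Proof.
rewrite /dact /= phi2_t !tactDl tact_const tactM tact_const tact_tau.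
congr (_ + _ + _); rewrite -[in RHS]tact_tau -[in RHS](tact_tau x) -tactM -expr2.
apply/eqP; rewrite -addr_eq0 -tactDl addNr; apply/eqP; exact: tact0l.
Qed.

Lemma dactD a a' x : dact iota phi (a + a') x = dact iota phi a x + dact iota phi a' x.
Proof. by rewrite /dact rmorphD tactDl. Qed.

Lemma dactZ c a x : dact iota phi (c *: a) x = scalar c * dact iota phi a x.
Proof. by rewrite /dact linearZ; apply: tactZl. Qed.

Lemma dact1 x : dact iota phi 1 x = x.
Proof.
by rewrite /dact rmorph1 -[1 : tpoly _]/(tconst (ratconst F) 1) tact_const rmorph1 mul1r.
Qed.

Lemma dact_sum I (r : seq I) (f : I -> {poly F}) x :
  dact iota phi (\sum_(i <- r) f i) x = \sum_(i <- r) dact iota phi (f i) x.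
Proof.
apply: (big_morph (fun a => dact iota phi a x) (fun a a' => dactD a a' x)).
by rewrite /dact rmorph0 tact0l.
Qed.

Definition phiS (X : fps L) : fps L :=
  fpsC th * X + fpsC bb * frobS X - frobS (frobS X).

Definition tateS (X : fps L) : Prop := fps_coef X 0 = 0 /\ phiS X = fpsT L * X.

Lemma tateSP x : tate iota phi x <-> tateS (Fps x).
Proof.
have phiE n : fps_coef (phiS (Fps x)) n = dact iota phi 'X (x n).
  by rewrite dact_t fps_coefB fps_coefD !fps_coefCM.
split=> [[tor tx]|[/= x0 phix]].
  have x0 : x 0%N = 0 by have := tor 0%N; rewrite /torsion expr0 dact1.
  split=> //; apply: fpsP => -[|n]; rewrite phiE ?fps_coefTM0 ?fps_coefTM //=.
  by rewrite x0 /dact tact0r.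
have tx k : dact iota phi 'X (x k.+1) = x k by rewrite -phiE phix fps_coefTM.
split=> //; elim=> [|k IH]; first by rewrite /torsion expr0 dact1.
by rewrite /torsion exprSr dactM tx.
Qed.

Lemma tate_dactXn x i k : tate iota phi x -> (i <= k)%N -> dact iota phi 'X^i (x k) = x (k - i)%N.
Proof.
case=> _ tx; elim: i => [|i IH] lt; first by rewrite expr0 dact1 subn0.
rewrite exprS dactM IH 1?ltnW // -[RHS]tx; congr (dact _ _ _ (x _)).
by move: lt; lia.
Qed.

(** Multiplying by t shifts a Tate sequence by one, so the action of F[[t]] is
    the Cauchy product. *)
Lemma tate_scaleE a x k : tate iota phi x ->
  tate_scale iota phi a x k = fps_coef (embS a * Fps x) k.
Proof.
move=> Tx; have x0 : x 0%N = 0 by case/tateSP: Tx.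
rewrite /tate_scale /fps_trunc poly_def dact_sum fps_coefM big_ord_recr /= subnn x0 mulr0 addr0.
apply: eq_bigr => i _; rewrite dactZ tate_dactXn //.
exact: ltnW (ltn_ord i).
Qed.

Lemma frobST : frobS (fpsT L) = fpsT L. Proof. exact: fps_mapT. Qed.

(** The Moore determinant of X and Y. *)
Definition wronskian (X Y : fps L) := X * frobS Y - frobS X * Y.

Lemma frobS_tate X : tateS X -> frobS (frobS X) = fpsC th * X + fpsC bb * frobS X - fpsT L * X.
Proof. by case=> _ <-; rewrite /phiS opprB addrC subrK. Qed.

(** An explicit Weil pairing: eliminating the second Frobenius with the equation
    of T leaves the equation of a module of rank one. *)
Lemma frobS_wronskian X Y : tateS X -> tateS Y ->
  frobS (wronskian X Y) = (fpsT L - fpsC th) * wronskian X Y.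
Proof.
move=> TX TY; rewrite /wronskian rmorphB !rmorphM /= !frobS_tate //; ring.
Qed.

(** Both series start in degree 1, hence the factor t^2; the remaining constant
    coefficient is the Moore determinant of the t-torsion points, which is
    nonzero when these are linearly independent over F. *)
Lemma wronskian_coef0 X Y : fps_coef X 0 = 0 -> fps_coef Y 0 = 0 ->
  exists2 U, wronskian X Y = fpsT L ^+ 2 * U &
    fps_coef U 0 = fps_coef X 1 * frob (fps_coef Y 1) - frob (fps_coef X 1) * fps_coef Y 1.
Proof.
move=> /fps_shiftK eX /fps_shiftK eY; exists (wronskian (fps_shift X) (fps_shift Y)).
  by rewrite {1}eX {1}eY /wronskian !rmorphM /= frobST; ring.
by rewrite fps_coefB !fps_coefM !big_ord1 /=.
Qed.

Lemma fps_mulT_inj k : injective ( *%R (fpsT L ^+ k)).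
Proof.
elim: k => [|k IH] X Y; first by rewrite expr0 !mul1r.
by rewrite exprS -!mulrA => /(@fpsT_inj L)/IH.
Qed.

(** Two solutions of the same equation fr(X) = om X are proportional over
    F[[t]], because their ratio is fixed by the Frobenius. *)
Lemma frob_ratio om k D N U V : fps_coef om 0 != 0 ->
    frobS D = om * D -> frobS N = om * N ->
    D = fpsT L ^+ k * U -> N = fpsT L ^+ k * V -> fps_coef U 0 != 0 ->
  exists a, N = embS a * D.
Proof.
move=> om0 eD eN defD defN U0; have uU : U \is a GRing.unit by rewrite fps_unitE.
have defN' : N = V / U * D by rewrite defD mulrCA divrK // defN.
have [a ea] : exists a, V / U = embS a.
  apply: frobS_fixed; move: eN; rewrite defN' rmorphM /= eD !mulrA.
  rewrite [frobS _ * om]mulrC defD !mulrA.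
  move/(fps_mulIr U0); rewrite ![_ * _ ^+ k]mulrC => /fps_mulT_inj.
  by rewrite -mulrA ![om * _]mulrC => /(fps_mulIr om0).
by exists a; rewrite -ea.
Qed.

Section Basis.
Variables X Y : fps L.
Hypotheses (TX : tateS X) (TY : tateS Y).
Hypothesis indep : fps_coef X 1 * frob (fps_coef Y 1) - frob (fps_coef X 1) * fps_coef Y 1 != 0.

Let om : fps L := fpsT L - fpsC th.
Lemma om_coef0 : fps_coef (fpsT L - fpsC th) 0 != 0.
Proof. by rewrite fps_coefB /= sub0r oppr_eq0 th_neq0. Qed.

Lemma wronskian_cancel A B : A * wronskian X Y = B * wronskian X Y -> A = B.
Proof.
have [U -> U0] := wronskian_coef0 TX.1 TY.1.
have := indep; rewrite -U0 => nz; rewrite [A * _]mulrA [B * _]mulrA => /(fps_mulIr nz).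
by rewrite [A * _]mulrC [B * _]mulrC => /fps_mulT_inj.
Qed.

(** Cramer's rule: the coordinates are ratios of Wronskians, which lie in F[[t]]
    since all Wronskians satisfy the same equation. *)
Lemma tateS_basis Z : tateS Z -> exists a c, Z = embS a * X + embS c * Y.
Proof.
move=> TZ; have [U defW U0] := wronskian_coef0 TX.1 TY.1.
have nz := indep; rewrite -U0 in nz.
have [V defV _] := wronskian_coef0 TZ.1 TY.1.
have [V' defV' _] := wronskian_coef0 TX.1 TZ.1.
have [a ea] := frob_ratio om_coef0 (frobS_wronskian TX TY) (frobS_wronskian TZ TY) defW defV nz.
have [c ec] := frob_ratio om_coef0 (frobS_wronskian TX TY) (frobS_wronskian TX TZ) defW defV' nz.
exists a, c; apply: wronskian_cancel.
rewrite mulrDl ![_ * _ * wronskian _ _]mulrAC -ea -ec /wronskian; ring.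
Qed.

Lemma embS_inj : injective embS.
Proof.
move=> a a' e; apply: fpsP => n; have := congr1 (fun A => fps_coef A n) e.
exact: fmorph_inj.
Qed.

Lemma tateS_free a c a' c' :
  embS a * X + embS c * Y = embS a' * X + embS c' * Y -> a = a' /\ c = c'.
Proof.
move=> e; split; apply: embS_inj; apply: wronskian_cancel.
  have := congr1 (fun Z => wronskian Z Y) e.
  rewrite /wronskian !rmorphD !rmorphM /= !frobS_emb => e'.
  move: e'; set x := frobS X; set y := frobS Y => e'.
  transitivity ((embS a * X + embS c * Y) * y - (embS a * x + embS c * y) * Y); first by ring.
  by rewrite e'; ring.
have := congr1 (fun Z => wronskian X Z) e.
rewrite /wronskian !rmorphD !rmorphM /= !frobS_emb => e'.
move: e'; set x := frobS X; set y := frobS Y => e'.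
transitivity (X * (embS a * x + embS c * y) - x * (embS a * X + embS c * Y)); first by ring.
by rewrite e'; ring.
Qed.

Lemma tateSD A B : tateS A -> tateS B -> tateS (A + B).
Proof.
move=> [A0 eA] [B0 eB]; split; first by rewrite fps_coefD A0 B0 addr0.
by rewrite mulrDr -eA -eB /phiS !rmorphD /=; ring.
Qed.

Lemma tateSZ a A : tateS A -> tateS (embS a * A).
Proof.
move=> [A0 eA]; split; first by rewrite fps_coefM big_ord1 A0 mulr0.
by rewrite mulrCA -eA /phiS !rmorphM /= !frobS_emb; ring.
Qed.

End Basis.
End TateSeries.

(** * Generating GL_2 over a local ring *)
Lemma sum_ord2 (V : nmodType) (f : 'I_2 -> V) : \sum_i f i = f 0 + f 1.
Proof. by rewrite big_ord_recl big_ord1; congr (f _ + f _); apply: val_inj. Qed.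

Section GL2.
Variable R : comUnitRingType.
Implicit Types (A B : 'M[R]_2) (a b c d x y : R).

Definition mx2 a b c d : 'M[R]_2 :=
  \matrix_(i, j) if i == 0 then if j == 0 then a else b else if j == 0 then c else d.

Lemma mx2P A : A = mx2 (A 0 0) (A 0 1) (A 1 0) (A 1 1).
Proof.
by apply/matrixP => -[[|[|//]] ?] [[|[|//]] ?]; rewrite mxE /=; congr (A _ _); apply: val_inj.
Qed.

Lemma mulmx2 a b c d a' b' c' d' :
  mx2 a b c d *m mx2 a' b' c' d' =
  mx2 (a * a' + b * c') (a * b' + b * d') (c * a' + d * c') (c * b' + d * d').
Proof.
apply/matrixP => i j; rewrite !mxE !big_ord_recl big_ord0 addr0 !mxE /=.
by case: (i == 0); case: (j == 0).
Qed.

Lemma det_mx2 a b c d : \det (mx2 a b c d) = a * d - b * c.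
Proof.
rewrite (expand_det_row _ 0) !big_ord_recl big_ord0 addr0 /cofactor !det_mx11 !mxE /=.
by rewrite addn0 expr0 expr1 mul1r mulN1r mulrN.
Qed.

(** The Bruhat decomposition of X gives an antidiagonal element, and conjugating
    the upper transvections by it gives the lower ones.  Every A of determinant
    1 with a unit A 1 0 is a product of three transvections; over a local ring
    one more lower transvection makes A 1 0 a unit. *)
Lemma local_SL2_generated (G : 'M[R]_2 -> Prop) X :
    (forall a b, a + b \is a GRing.unit -> a \is a GRing.unit \/ b \is a GRing.unit) ->
    (forall A B, G A -> G B -> G (A *m B)) ->
    (forall A, G A -> A \in unitmx /\ G (invmx A)) ->
    (forall a, G (mx2 1 a 0 1)) -> G X -> X 1 0 \is a GRing.unit ->
  forall A, \det A = 1 -> G A.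
Proof.
move=> loc GM GV GE GX; rewrite [X]mx2P [in X in is_true X]mxE /=.
move: (X 0 0) (X 0 1) (X 1 0) (X 1 1) GX (mx2P X) => a b c d GX eX uc.
pose D := a * d - b * c.
have uD : D \is a GRing.unit by have [] := GV X GX; rewrite unitmxE eX det_mx2.
have hc : c * c^-1 = 1 := mulrV uc.
(* the antidiagonal element of the Bruhat decomposition of X *)
have GY : G (mx2 0 (- D / c) c 0).
  have -> : mx2 0 (- D / c) c 0 = mx2 1 (- (a / c)) 0 1 *m X *m mx2 1 (- (d / c)) 0 1.
    by rewrite eX !mulmx2 /D; congr mx2; ring: hc.
  by apply: (GM) => //; apply: GM.
have hD : D * D^-1 = 1 := mulrV uD.
clearbody D; have GF r : G (mx2 1 0 r 1).
  have [uY GYV] := GV _ GY.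
  have eV : invmx (mx2 0 (- D / c) c 0) = mx2 0 c^-1 (- c / D) 0.
    rewrite -[RHS]mul1mx -(mulVmx uY) -mulmxA mulmx2 -[LHS]mulmx1; congr (_ *m _).
    by rewrite [LHS]mx2P !mxE /=; congr mx2; ring: hc hD.
  have -> : mx2 1 0 r 1 = mx2 0 (- D / c) c 0 *m mx2 1 (- (D * r / (c * c))) 0 1 *m invmx (mx2 0 (- D / c) c 0).
    by rewrite eV !mulmx2 invrM //; congr mx2; ring: hc hD.
  by apply: (GM) => //; apply: GM.
have G1 A : A 1 0 \is a GRing.unit -> \det A = 1 -> G A.
  rewrite (mx2P A) [mx2 _ _ _ _ 1 0]mxE /= det_mx2.
  move: (A 0 0) (A 0 1) (A 1 0) (A 1 1) => p q r s ur detA.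
  have -> : mx2 p q r s = mx2 1 ((p - 1) / r) 0 1 *m mx2 1 0 r 1 *m mx2 1 ((s - 1) / r) 0 1.
    have hr := mulrV ur.
    have -> : q = (p * s - 1) / r by rewrite -detA; ring: hr.
    by rewrite !mulmx2; congr mx2; ring: hr.
  by apply: (GM) => //; apply: GM.
move=> A detA; case: (boolP (A 1 0 \is a GRing.unit)) => [/G1|nu]; first exact.
have -> : A = (A *m mx2 1 0 1 1) *m mx2 1 0 (-1) 1.
  rewrite -mulmxA mulmx2 [LHS]mx2P [in RHS](mx2P A) mulmx2.
  by congr mx2; ring.
apply: GM => //; apply: G1; last by rewrite det_mulmx detA det_mx2; ring.
rewrite (mx2P A) mulmx2 mxE /= !mulr1.
have us : A 1 1 \is a GRing.unit.
  move: detA; rewrite (mx2P A) det_mx2 !mxE /= => e.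
  have [|/[!unitrM]/andP[]|] // := loc (A 0 0 * A 1 1) (- (A 0 1 * A 1 0)).
    by rewrite e unitr1.
  by rewrite unitrN unitrM (negPf nu) andbF.
have [| |] // := loc (A 1 0 + A 1 1) (- A 1 0); first by rewrite addrAC subrr add0r.
by rewrite unitrN (negPf nu).
Qed.

Lemma local_GL2_generated (G : 'M[R]_2 -> Prop) X :
    (forall a b, a + b \is a GRing.unit -> a \is a GRing.unit \/ b \is a GRing.unit) ->
    (forall A B, G A -> G B -> G (A *m B)) ->
    (forall A, G A -> A \in unitmx /\ G (invmx A)) ->
    (forall a, G (mx2 1 a 0 1)) -> G X -> X 1 0 \is a GRing.unit ->
    (forall d, d \is a GRing.unit -> exists2 A, G A & \det A = d) ->
  forall A, A \in unitmx -> G A.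
Proof.
move=> loc GM GV GE GX uX Gdet A uA.
have [B GB detB] := Gdet _ uA; have [uB GBV] := GV _ GB.
rewrite -(mulKVmx uB A); apply: (GM) => //.
apply: (local_SL2_generated loc GM GV GE GX uX).
by rewrite det_mulmx det_inv detB mulVr.
Qed.

End GL2.

(** * Galois action on the Tate module *)
Section Action.
Variables (F : finFieldType) (L : fieldType) (iota : {rmorphism ratfun F -> L}).
Variable b : ratfun F.
Local Notation embS := (embS iota).
Local Notation frobS := (frobS iota).
Local Notation frob := (frob iota).
Local Notation tateS := (tateS iota b).
Implicit Types s : Gal iota.

Definition galS s : {rmorphism fps L -> fps L} := fps_map (galfun s).

Lemma galM s s' x : (s * s')%g x = s (s' x). Proof. by []. Qed.
Lemma gal1 x : (1%g : Gal iota) x = x. Proof. by []. Qed.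

Lemma galS_mul s s' X : galS (s * s')%g X = galS s (galS s' X).
Proof. by apply: fpsP. Qed.
Lemma galS1 X : galS 1%g X = X. Proof. by apply: fpsP. Qed.

Lemma galS_emb s a : galS s (embS a) = embS a.
Proof. by apply: fpsP => n /=; rewrite gal_fix. Qed.

Lemma galS_frob s X : galS s (frobS X) = frobS (galS s X).
Proof. by apply: fpsP => n /=; rewrite !frobE rmorphXn. Qed.

Lemma galS_T s : galS s (fpsT L) = fpsT L. Proof. exact: fps_mapT. Qed.

Lemma galS_tate s X : tateS X -> tateS (galS s X).
Proof.
move=> [X0 eX]; split; first by rewrite /= X0 rmorph0.
rewrite -[in RHS](galS_T s) -rmorphM -eX /phiS rmorphB rmorphD !rmorphM /= !galS_frob.
by congr (_ * _ + _ * _ - _); apply/esym; rewrite fps_mapC /= gal_fix.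
Qed.

Lemma galS_wronskian s X Y : galS s (wronskian iota X Y) = wronskian iota (galS s X) (galS s Y).
Proof. by rewrite /wronskian rmorphB !rmorphM /= !galS_frob. Qed.

Definition acts (e : 'I_2 -> fps L) s (A : 'M[fps F]_2) : Prop :=
  forall j, galS s (e j) = \sum_i embS (A i j) * e i.

Definition comb (e : 'I_2 -> fps L) (v : 'cV[fps F]_2) := \sum_i embS (v i 0) * e i.

Definition basisS (e : 'I_2 -> fps L) : Prop :=
  (forall i, tateS (e i)) /\ (forall X, tateS X -> exists! v, X = comb e v).

Section Basis.
Variable e : 'I_2 -> fps L.
Hypothesis bas_e : basisS e.

Lemma comb_tate v : tateS (comb e v).
Proof.
rewrite /comb !big_ord_recl big_ord0 addr0.
by apply: tateSD; apply: tateSZ; apply: bas_e.1.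
Qed.

Lemma comb_inj : injective (comb e).
Proof.
move=> u v euv; have [w [_ uniq_w]] := bas_e.2 _ (comb_tate u).
by rewrite -(uniq_w u) // -(uniq_w v).
Qed.

Lemma comb_mul (A : 'M[fps F]_2) v :
  comb e (A *m v) = \sum_j embS (v j 0) * \sum_i embS (A i j) * e i.
Proof.
rewrite /comb; under [RHS]eq_bigr do rewrite mulr_sumr.
rewrite exchange_big; apply: eq_bigr => i _ /=; rewrite mxE rmorph_sum mulr_suml.
by apply: eq_bigr => j _; rewrite rmorphM /=; ring.
Qed.

Lemma acts_comb s A v : acts e s A -> galS s (comb e v) = comb e (A *m v).
Proof.
move=> sA; rewrite comb_mul /comb rmorph_sum; apply: eq_bigr => j _.
by rewrite rmorphM /= galS_emb sA.
Qed.

(** The matrix relation is a relation between linear maps.  This reduces products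
    and inverses of automorphisms to those of matrices. *)
Lemma actsP s A : (forall v, galS s (comb e v) = comb e (A *m v)) <-> acts e s A.
Proof.
split=> [h j|sA v]; last exact: acts_comb.
have comb_delta (B : 'M[fps F]_2) : comb e (B *m delta_mx j 0) = \sum_i embS (B i j) * e i.
  by rewrite -colE; apply: eq_bigr => i _; rewrite mxE.
rewrite -comb_delta -h -[delta_mx j 0]mul1mx comb_delta; congr (galS s _).
rewrite (bigD1 j) //= mxE eqxx rmorph1 mul1r big1 ?addr0 // => i /negPf ne.
by rewrite mxE ne rmorph0 mul0r.
Qed.

Lemma acts_exists s : exists A, acts e s A.
Proof.
have colP j : exists v, galS s (e j) = comb e v.
  by have [v []] := bas_e.2 _ (galS_tate s (bas_e.1 j)); exists v.
exists (\matrix_(i, j) projT1 (cid (colP j)) i 0) => j.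
by rewrite [LHS](projT2 (cid (colP j))); apply: eq_bigr => i _; rewrite mxE.
Qed.

Lemma mul_cV_inj (A B : 'M[fps F]_2) : (forall v : 'cV_2, A *m v = B *m v) -> A = B.
Proof.
move=> h; apply/matrixP => i j; have := congr1 (fun u : 'cV_2 => u i 0) (h (delta_mx j 0)).
by rewrite -!colE !mxE.
Qed.

Lemma acts_uniq s A B : acts e s A -> acts e s B -> A = B.
Proof.
move=> /actsP sA /actsP sB; apply: mul_cV_inj => v; apply: comb_inj.
by rewrite -sA -sB.
Qed.

Lemma acts_mul s s' A B : acts e s A -> acts e s' B -> acts e (s * s')%g (A *m B).
Proof.
move=> /actsP sA /actsP sB; apply/actsP => v.
by rewrite galS_mul sB sA mulmxA.
Qed.

Lemma acts1 : acts e 1%g 1%:M.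
Proof. by apply/actsP => v; rewrite mul1mx galS1. Qed.

Lemma acts_inv s A : acts e s A -> A \in unitmx /\ acts e (s^-1)%g (invmx A).
Proof.
move=> sA; have [B sB] := acts_exists (s^-1)%g.
have AB : A *m B = 1%:M.
  by apply: acts_uniq acts1; rewrite -(mulgV s); apply: acts_mul.
have [uA _] := mulmx1_unit AB; split=> //.
by rewrite -[invmx A]mulmx1 -AB mulKmx.
Qed.

(** The Wronskian is alternating and F[[t]]-bilinear. *)
Lemma acts_det s A : acts e s A ->
  galS s (wronskian iota (e 0) (e 1)) = embS (\det A) * wronskian iota (e 0) (e 1).
Proof.
move=> sA; have -> : \det A = A 0 0 * A 1 1 - A 0 1 * A 1 0 by rewrite {1}[A]mx2P det_mx2.
rewrite galS_wronskian !sA !sum_ord2 /wronskian.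
by rewrite rmorphB !rmorphD !rmorphM /= !frobS_emb; ring.
Qed.

End Basis.
End Action.

(** * Total ramification of Carlitz torsion at theta *)
Section PlaceValues.
Variables (F : finFieldType) (L : fieldType) (iota : {rmorphism ratfun F -> L}).
Variables (ell : {poly F}) (w : qvaluation L).
Hypothesis irr_ell : irreducible_poly ell.
Hypothesis w_ell : w (rpol iota ell) = 1.
Hypothesis w_unit : forall p, ~~ (ell %| p) -> w (rpol iota p) = 0.

Lemma place_val_poly n p1 : ~~ (ell %| p1) -> w (rpol iota (ell ^+ n * p1)) = n%:R.
Proof.
move=> nd; have ell0 : rpol iota ell != 0.
  by rewrite rpol_eq0 -size_poly_gt0; case: irr_ell => /ltnW.
have p10 : rpol iota p1 != 0 by rewrite rpol_eq0; apply: contraNneq nd => ->; rewrite dvdp0.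
by rewrite rmorphM rmorphXn qvalM ?expf_neq0 // qvalX // w_ell w_unit // mul1r addr0.
Qed.

Lemma place_val_int a : a != 0 -> exists z : int, w (iota a) = z%:~R.
Proof.
have [n [d [d0 ->]]] := fraction_div a; rewrite mulf_eq0 invr_eq0 !tofrac_eq0 (negPf d0) orbF => n0.
have sz : (1 < size ell)%N by case: irr_ell.
have [i [n1 [en un]]] := poly_multiplicity sz n0.
have [k [d1 [ed ud]]] := poly_multiplicity sz d0.
exists (i%:Z - k%:Z); rewrite fmorph_div -![iota (tofrac _)]/(rpol iota _).
rewrite qval_div ?rpol_eq0 // en ed !place_val_poly // rmorphB /=.
by rewrite -!pmulrn.
Qed.

End PlaceValues.

Section Carlitz.
Variables (F : finFieldType) (L : fieldType) (iota : {rmorphism ratfun F -> L}).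
Hypothesis sepL : separable_closure iota.
Local Notation embS := (embS iota).
Local Notation frobS := (frobS iota).
Local Notation q := #|F|.
Local Notation om := (fpsT L - fpsC (th iota)).

Lemma carlitz_coefS V n : frobS V = om * V ->
  fps_coef V n.+1 ^+ q + th iota * fps_coef V n.+1 = fps_coef V n.
Proof.
move=> eV; have : fps_coef (frobS V) n.+1 = fps_coef (om * V) n.+1 by rewrite eV.
rewrite mulrBl fps_coefB fps_coefTM fps_coefCM -[LHS]/(frob iota _) frobE => ->.
by rewrite subrK.
Qed.

Lemma carlitz_coef0 V : frobS V = om * V -> fps_coef V 0 ^+ q = - th iota * fps_coef V 0.
Proof.
move=> eV; have : fps_coef (frobS V) 0 = fps_coef (om * V) 0 by rewrite eV.
by rewrite mulrBl fps_coefB fps_coefTM0 fps_coefCM -[LHS]/(frob iota _) frobE sub0r mulNr.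
Qed.

Lemma carlitz_coef_zero V n m : frobS V = om * V -> (m <= n)%N ->
  fps_coef V n = 0 -> fps_coef V m = 0.
Proof.
move=> eV /subnK <-; elim: (n - m)%N => // k IH; rewrite addSn => V0; apply: IH.
by rewrite -(carlitz_coefS _ eV) V0 mulr0 addr0 expr0n gtn_eqF // (ltnW (finNzRing_gt1 F)).
Qed.

Variable U : fps L.
Hypotheses (eU : frobS U = om * U) (U0 : fps_coef U 0 != 0).

Lemma carlitz_coef_neq0 n : fps_coef U n != 0.
Proof. by apply: contraNneq U0 => /(carlitz_coef_zero eU (leq0n n)) ->. Qed.

(** The first component is a (q-1)-st root of - theta, and each further one is a
    root of x^q + theta x = y with w(y) <= 1/(q-1), where x^q is the dominant
    term. *)
Lemma carlitz_val (w : qvaluation L) n : w (th iota) = 1 ->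
  w (fps_coef U n) * ((q.-1 * q ^ n)%N)%:R = 1.
Proof.
move=> wth; have q1 := finNzRing_gt1 F; set Q : rat := q%:R.
have Q2 : 2 <= Q by rewrite ler_nat.
have eQ1 : q.-1%:R = Q - 1 by rewrite -subn1 natrB // ltnW.
have th0 := th_neq0 iota; elim: n => [|n IH].
  have := congr1 w (carlitz_coef0 eU).
  rewrite expn0 muln1 eQ1 qvalX // mulNr qvalN qvalM // wth -/Q => e; lra.
have [x0 y0] := (carlitz_coef_neq0 n.+1, carlitz_coef_neq0 n).
have e := carlitz_coefS n eU; move: x0 y0 e IH.
set x := fps_coef U n.+1; set y := fps_coef U n => x0 y0 e IH.
have QnE : 1 <= (q ^ n)%:R :> rat by rewrite ler1n expn_gt0 ltnW.
have y_gt0 : 0 < w y.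
  rewrite ltNge; apply/negP => y_le0.
  by have := mulr_le0_ge0 y_le0 (ler0n _ (q.-1 * q ^ n)); rewrite IH ler10.
have y_le : w y * (Q - 1) <= 1.
  rewrite -[leRHS]IH natrM eQ1; apply: ler_wpM2l; first exact: ltW.
  by apply: ler_peMr => //; lra.
have [lt|le] := ltP (w x * Q) (1 + w x).
  have dom : vgt w (w (x ^+ q)) (th iota * x).
    by rewrite vgtE ?mulf_neq0 // qvalX // qvalM // wth.
  have [_] := qval_dom (expf_neq0 _ x0) dom.
  rewrite e qvalX // => wy; rewrite -[RHS]IH wy !natrM expnS natrM -/Q; ring.
have : vge w (1 + w x) y.
  rewrite -e vgeD // vgeE ?expf_neq0 ?mulf_neq0 // ?qvalX // qvalM // wth //.
rewrite vgeE // => h; exfalso.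
have Q1 : 0 <= Q - 1 by lra.
by have := ler_wpM2r Q1 h; lra.
Qed.

(** The conjugate satisfies the same equation as U. *)
Lemma carlitz_conj (s : Gal iota) : exists2 a, galS s U = embS a * U & fps_coef a 0 != 0.
Proof.
have om0 : fps_coef om 0 != 0 by apply: om_coef0.
have es : frobS (galS s U) = om * galS s U.
  rewrite -galS_frob eU rmorphM; congr (_ * _).
  rewrite rmorphB /= galS_T; congr (_ - _).
  by rewrite /= fps_mapC /= gal_fix.
have [a ea] := @frob_ratio _ _ iota om 0 U (galS s U) U (galS s U) om0 eU es
  (esym (mul1r _)) (esym (mul1r _)) U0.
exists a => //; apply: contraNneq U0 => a0.
have := congr1 (fun A => fps_coef A 0) ea.
by rewrite fps_coefM big_ord1 /= a0 rmorph0 mul0r => /eqP; rewrite fmorph_eq0.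
Qed.

(** The n-th component has degree N = (q-1)q^n over K by its value at theta, and
    its conjugates are among the N components of the series a U with a a unit
    modulo t^(n+1).  So each of them is a conjugate. *)
Lemma carlitz_surjective d : fps_coef d 0 != 0 -> exists s : Gal iota, galS s U = embS d * U.
Proof.
move=> d0; have irrX : irreducible_poly ('X : {poly F}).
  by rewrite -['X]subr0; apply: irredp_XsubC.
have [w [w_ell w_unit]] := place_valuation sepL irrX.
have wth : w (th iota) = 1 by [].
pose z' n := fps_coef (embS d * U) n.
have [|s sP] := @gal_compact _ _ iota sepL unit (fun=> fps_coef U) (fun=> z').
  move=> n; pose N := (q.-1 * q ^ n)%N.
  have N0 : (0 < N)%N.
    by rewrite muln_gt0 expn_gt0 (ltnW (finNzRing_gt1 F)) -subn1 subn_gt0 finNzRing_gt1.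
  (* the n-th coefficient of embS c * U, for c = a + f_0 t + f_1 t^2 + ... *)
  pose g (a : F) (f : {ffun 'I_n -> F}) : L :=
    scalar iota a * fps_coef U n + \sum_(i < n) scalar iota (f i) * fps_coef U (n - i.+1).
  pose S := [seq g a f | a <- enum (predC1 (0 : F)), f <- enum {ffun 'I_n -> F}].
  have szS : size S = N.
    by rewrite size_allpairs /N -!cardE card_ffun card_ord cardC1.
  have memS a : fps_coef a 0 != 0 -> fps_coef (embS a * U) n \in S.
    move=> a0; apply/allpairsP; exists (fps_coef a 0, [ffun i : 'I_n => fps_coef a i.+1]).
    rewrite !mem_enum; split=> //.
    rewrite fps_coefM big_ord_recl subn0; congr (_ + _).
    by apply: eq_bigr => i _; rewrite ffunE.
  have [||||s _ es] := @gal_orbit_all _ _ iota sepL _ iota (fun a => ex_intro _ a erefl) N (fps_coef U n) S (z' n).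
  - apply: (deg_bound (place_val_int irrX w_ell w_unit) (carlitz_coef_neq0 n)) => i z /andP[i0 iN] e.
    have NE := carlitz_val n wth; rewrite -/N in NE.
    have : (z * N%:Z)%:~R = i%:R :> rat.
      by rewrite rmorphM /= -e -pmulrn mulrAC NE mul1r.
    rewrite [RHS]pmulrn => /eqP; rewrite eqr_int => /eqP ez.
    have : (0 < z * N%:Z)%R /\ (z * N%:Z < N%:Z)%R by rewrite ez; split.
    case; rewrite pmulr_lgt0 ?ltz_nat // => z0; rewrite gtr_pMl ?ltz_nat //.
    by move: z0; lia.
  - by rewrite szS.
  - move=> s _; have [a ea a0] := carlitz_conj s.
    by have <- : fps_coef (embS a * U) n = s (fps_coef U n); [rewrite -ea | apply: memS].
  - exact: memS.
  exists s => _ m le_mn; have [a ea _] := carlitz_conj s.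
  have esm k : s (fps_coef U k) = fps_coef (embS a * U) k by rewrite -ea.
  apply/eqP; rewrite esm -subr_eq0 -fps_coefB -mulrBl -rmorphB; apply/eqP.
  apply: (@carlitz_coef_zero _ n) le_mn _.
    by rewrite rmorphM /= frobS_emb eU mulrCA.
  by rewrite rmorphB mulrBl fps_coefB -esm es subrr.
by exists s; apply: fpsP => n; rewrite -[LHS]/(s _) (sP tt).
Qed.

End Carlitz.

(** * Closure of a subfield for a valuation, and Hensel's lemma *)
Record subfield (L : fieldType) := Subfield {
  subfield_pred : {pred L};
  subfield_predP : divring_closed subfield_pred
}.
HB.instance Definition _ L (E : subfield L) :=
  GRing.isDivringClosed.Build L (subfield_pred E) (subfield_predP E).

Section Taylor.
Variables (L : fieldType) (w : qvaluation L).
Local Notation vint := (vge w 0).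

Lemma vint_taylor1 (f : {poly L}) x h : (forall i, vint f`_i) -> vint x -> vint h ->
  exists2 r, vint r & f.[x + h] = f.[x] + h * r.
Proof.
move=> + x0 h0; elim/poly_ind: f => [|f c IH] f0.
  by exists 0; rewrite ?vge0 // !horner0 mulr0 addr0.
have [i|r r0 er] := IH; first by have := f0 i.+1; rewrite coefD coefMX coefC /= addr0.
exists (f.[x] + r * (x + h)); last by rewrite !hornerE er; ring.
rewrite vgeD ?vintM ?vgeD // vint_horner // => i.
by have := f0 i.+1; rewrite coefD coefMX coefC /= addr0.
Qed.

Lemma vint_deriv (f : {poly L}) : (forall i, vint f`_i) -> forall i, vint f^`()`_i.
Proof.
move=> f0 i; rewrite coef_deriv -mulr_natr.
move: f`_i.+1 (f0 i.+1) => y y0; elim: (i.+1) => [|n IH]; first by rewrite mulr0 vge0.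
by rewrite -natr1 mulrDr mulr1 vgeD.
Qed.

Lemma vint_taylor2 (f : {poly L}) x h : (forall i, vint f`_i) -> vint x -> vint h ->
  exists2 r, vint r & f.[x + h] = f.[x] + h * f^`().[x] + h ^+ 2 * r.
Proof.
move=> + x0 h0; elim/poly_ind: f => [|f c IH] f0.
  by exists 0; rewrite ?vge0 // deriv0 !horner0 !mulr0 !addr0.
have f0' i : vint f`_i by have := f0 i.+1; rewrite coefD coefMX coefC /= addr0.
have [r r0 er] := IH f0'; exists (f^`().[x] + r * (x + h)); last by rewrite derivD derivM derivX derivC !hornerE er; ring.
by rewrite vgeD ?vintM ?vgeD // vint_horner //; apply: vint_deriv.
Qed.

End Taylor.

Section Closure.
Variables (L : fieldType) (w : qvaluation L) (K1 : subfield L).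
Hypothesis intK1 : forall x, x \in subfield_pred K1 -> x != 0 -> exists z : int, w x = z%:~R.

(** The elements of L which are limits of elements of K1.  This plays the role
    of the completion inside L. *)
Definition vclosure_pred : {pred L} :=
  [pred x | `[< forall N : nat, exists2 a, a \in subfield_pred K1 & vge w N%:R (x - a) >]].

Lemma vclosureP x :
  reflect (forall N : nat, exists2 a, a \in subfield_pred K1 & vge w N%:R (x - a))
    (x \in vclosure_pred).
Proof. by rewrite inE; apply: asboolP. Qed.

Lemma vbound x : exists M : nat, vge w (- M%:R) x.
Proof.
exists (Num.bound `|w x|); rewrite /vge; apply/orP; right.
rewrite lerNl; apply: le_trans (ltW (archi_boundP (normr_ge0 _))).
by rewrite -normrN ler_norm.
Qed.

Lemma qval_bound x : exists M : nat, w x < M%:R.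
Proof.
exists (Num.bound `|w x|); apply: le_lt_trans (archi_boundP (normr_ge0 _)).
exact: ler_norm.
Qed.

Lemma sub_vclosure x : x \in subfield_pred K1 -> x \in vclosure_pred.
Proof. by move=> xK; apply/vclosureP => N; exists x => //; rewrite subrr vge0. Qed.

Lemma vclosureB x y : x \in vclosure_pred -> y \in vclosure_pred -> x - y \in vclosure_pred.
Proof.
move=> /vclosureP xE /vclosureP yE; apply/vclosureP => N.
have [[a aK xa] [c cK yc]] := (xE N, yE N); exists (a - c); first exact: rpredB.
have -> : x - y - (a - c) = (x - a) - (y - c) by ring.
exact: vgeB.
Qed.

Lemma vclosureM x y : x \in vclosure_pred -> y \in vclosure_pred -> x * y \in vclosure_pred.
Proof.
move=> /vclosureP xE /vclosureP yE; apply/vclosureP => N.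
have [[Mx bx] [My by_]] := (vbound x, vbound y).
have [[a aK xa] [c cK yc]] := (xE (N + My)%N, yE (N + Mx)%N).
exists (a * c); first exact: rpredM.
have ba : vge w (- Mx%:R) a.
  have -> : a = x - (x - a) by ring.
  apply: vgeB => //; apply: vgeW xa.
  by rewrite lerNl; apply: le_trans (_ : 0 <= _); rewrite ?oppr_le0 ?ler0n.
have -> : x * y - a * c = (x - a) * y + a * (y - c) by ring.
rewrite vgeD //.
  by have := vgeM xa by_; rewrite natrD addrK.
by have := vgeM ba yc; rewrite natrD addrC addrK.
Qed.

Lemma vclosure_approx x : x \in vclosure_pred -> x != 0 -> forall N : nat,
  exists a, [/\ a \in subfield_pred K1, a != 0, w a = w x & vge w N%:R (x - a)].
Proof.
move=> /vclosureP xE x0 N; have [M xM] := qval_bound x.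
have [a aK xa] := xE (N + M)%N; exists a.
have vgtax : vgt w (w x) (a - x).
  rewrite -vgtN opprB; apply: vge_gt xa; apply: lt_le_trans xM _.
  by rewrite ler_nat leq_addl.
have [] := qval_dom x0 vgtax; rewrite addrC subrK => a0 wa; split=> //.
by apply: vgeW xa; rewrite ler_nat leq_addr.
Qed.

Lemma vclosureV x : x \in vclosure_pred -> x^-1 \in vclosure_pred.
Proof.
move=> xE; have [->|x0] := eqVneq x 0; first by rewrite invr0 sub_vclosure ?rpred0.
apply/vclosureP => N; have [M xM] := qval_bound x.
have [a [aK a0 wa xa]] := vclosure_approx xE x0 (N + (M + M)).
exists a^-1; first exact: rpredVr.
have -> : x^-1 - a^-1 = (x - a) * (- (x * a)^-1) by field; rewrite x0 a0.
have vxa : vge w (- (M%:R + M%:R)) (- (x * a)^-1).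
  rewrite vgeN vgeE ?invr_eq0 ?mulf_neq0 // qvalV ?mulf_neq0 // qvalM // wa.
  by rewrite lerN2 lerD // ltW.
by have := vgeM xa vxa; rewrite !natrD addrK.
Qed.

Lemma vclosure_divring : divring_closed vclosure_pred.
Proof.
split=> [|x y|x y xE yE]; first by rewrite sub_vclosure ?rpred1.
  exact: vclosureB.
by apply: vclosureM => //; apply: vclosureV.
Qed.
Definition vclosure := Subfield vclosure_divring.

Lemma vclosure_int x : x \in subfield_pred vclosure -> x != 0 -> exists z : int, w x = z%:~R.
Proof.
move=> xE x0; have [a [aK a0 <- _]] := vclosure_approx xE x0 0.
exact: intK1.
Qed.

(** Newton iteration starting at c: each step squares the error, and the result
    is approximated in K1 again.  The starting point itself is only known at
    positive distance from x, and this distance is at least 1 because f(c) has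
    integral value. *)
Lemma vclosure_hensel (f : {poly L}) x c :
    f \is a polyOver (subfield_pred vclosure) -> (forall i, vge w 0 f`_i) ->
    root f x -> vge w 0 x -> f^`().[x] != 0 -> w f^`().[x] = 0 ->
    c \in subfield_pred K1 -> vgt w 0 (x - c) ->
  x \in subfield_pred vclosure.
Proof.
move=> fE f0 /rootP fx x0 f'x0 wf'x cK xc.
suff approx (N : nat) : exists2 a, a \in subfield_pred K1 & vge w N%:R (x - a) && vgt w 0 (x - a).
  by apply/vclosureP => N; have [a aK /andP[xa _]] := approx N; exists a.
have step a : a \in subfield_pred K1 -> vgt w 0 (x - a) ->
    exists r, [/\ vge w 0 r, f^`().[a] != 0, w f^`().[a] = 0
      & f.[a] = - ((x - a) * f^`().[a] + (x - a) ^+ 2 * r)].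
  move=> aK xa; have h0 := vgtW xa.
  have a0 : vge w 0 a by have -> : a = x - (x - a) by [ring]; apply: vgeB.
  have [r r0 er] := vint_taylor2 f0 a0 h0.
  have hN0 : vge w 0 (- (x - a)) by rewrite vgeN.
  have [r' r'0 er'] := vint_taylor1 (vint_deriv f0) x0 hN0.
  move: er'; have -> : x - (x - a) = a by ring.
  move=> er'; exists r; have [|] := @qval_dom _ w (f^`().[x]) (- (x - a) * r') f'x0.
    by rewrite wf'x -[0]addr0 mulrC; apply: vgtM; rewrite ?vgtN.
  rewrite -er' wf'x => nz wz; split=> //.
  by apply/eqP; rewrite -addr_eq0 addrA -er addrC subrK fx.
elim: N => [|N [a aK /andP[xaN xa]]]; first by exists c; rewrite // vgtW.
have [r [r0 nz wz fa]] := step a aK xa.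
have aE : a \in subfield_pred vclosure by apply: sub_vclosure.
(* for N = 0 the squared error is not yet small enough, but the value of
   x - a is that of f(a), a positive integer *)
have [N0|N0] := posnP N.
  exists a; rewrite // xa andbT N0.
  have [->|h0] := eqVneq (x - a) 0; first exact: vge0.
  have xa' : 0 < w (x - a) by rewrite -(vgtE _ _ h0).
  have dom : vgt w (w ((x - a) * f^`().[a])) ((x - a) ^+ 2 * r).
    rewrite qvalM // wz addr0 -[w (x - a)]add0r mulrC; apply: vgtM => //.
    by rewrite vgtE ?expf_neq0 // qvalX //; lra.
  have [] := qval_dom (mulf_neq0 h0 nz) dom.
  rewrite -[_ + _]opprK -fa oppr_eq0 qvalN qvalM // wz addr0 => fa0 wfa.
  have [|z ez] := vclosure_int _ fa0; first exact: rpred_horner.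
  by rewrite vgeE // -wfa ez ler1z; move: xa'; rewrite -wfa ez ltr0z.
have dE : a - f.[a] / f^`().[a] \in subfield_pred vclosure.
  by rewrite rpredB ?rpred_div ?rpred_horner ?polyOver_deriv.
have [a' a'K aa'] := vclosureP _ dE N.+1.
exists a' => //.
suff xa'N : vge w N.+1%:R (x - a') by rewrite xa'N (vge_gt _ xa'N) // ltr0n.
have -> : x - a' = (- (x - a) ^+ 2 * (r / f^`().[a])) + (a - f.[a] / f^`().[a] - a').
  by rewrite fa; field.
apply: vgeD; last exact: aa'.
have leN : N.+1%:R <= (N + N)%:R :> rat by rewrite ler_nat -addn1 leq_add2l.
apply: (vgeW leN); rewrite natrD mulNr vgeN expr2 -[_%:R + _]addr0; apply: vgeM.
  exact: vgeM.
by rewrite -[0]addr0; apply: vgeM; first exact: r0; rewrite vgeE ?invr_eq0 // qvalV // wz oppr0.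
Qed.

End Closure.

(** * Separability and nearby roots *)
Lemma separable_bezout (L : fieldType) (p u v : {poly L}) c :
  c != 0 -> u * p + v * p^`() = c%:P -> separable_poly p.
Proof.
move=> c0 e; rewrite unlock; apply/Bezout_coprimepP; exists (u, v) => /=.
by rewrite e polyC_eqp1.
Qed.

Lemma finField_card_eq0 (F : finFieldType) (L : fieldType) (c : {rmorphism F -> L}) :
  #|F|%:R = 0 :> L.
Proof.
rewrite -(rmorph_nat c) -[RHS](rmorph0 c); congr (c _).
by rewrite -FinRing.Theory.zmodXgE -cardsT expg_cardG ?inE.
Qed.

(** An irreducible polynomial h divides X^N - X, where N is the order of the
    finite field F[X]/(h). *)
Lemma finField_irreducible_separable (F : finFieldType) (p : {poly F}) :
  irreducible_poly p -> separable_poly p.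
Proof.
move=> irr_p; have p0 : p != 0 by rewrite -size_poly_gt0; case: irr_p => /ltnW.
have lc0 : (lead_coef p)^-1 != 0 by rewrite invr_eq0 lead_coef_eq0.
pose h := (lead_coef p)^-1 *: p.
have eqp_h : h %= p := eqp_scale p lc0.
have h_monic : h \is monic by rewrite monicE lead_coefZ mulVf // lead_coef_eq0.
have irr_h : irreducible_poly h.
  split=> [|r sz_r]; first by rewrite (eqp_size eqp_h); case: irr_p.
  by rewrite (eqp_dvdr _ eqp_h) => /(apply_irredp irr_p sz_r) /eqp_ltrans ->; rewrite eqp_sym.
pose hI : monic_irreducible_poly h := (irr_h, h_monic).
pose N := #|{poly %/ h with hI}|.
rewrite -(eqp_separable eqp_h); apply: (@dvdp_separable _ ('X^N - 'X)).
  have : in_qpoly h ('X^N - 'X) = 0.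
    by rewrite rmorphB rmorphXn /= [_ ^+ _](@expf_card {poly %/ h with hI}) subrr.
  by move/val_eqP; rewrite /= -Pdiv.IdomainMonic.modpE ?mk_monicE.
apply: (@separable_bezout _ _ 0 1 (- 1)); first by rewrite oppr_eq0 oner_neq0.
rewrite mul0r add0r mul1r derivB derivXn derivX -mulr_natl /N card_qfpoly.
rewrite natrX -polyC1 -(rmorph_nat (@polyC F)) (@finField_card_eq0 F F idfun) rmorph0 expr0n.
have -> : ((size h).-1 == 0)%N = false by have := irr_h.1; case: (size h) => [|[]].
by rewrite mul0r add0r -polyCN.
Qed.

Section NearRoot.
Variables (L : fieldType) (w : qvaluation L).
Hypothesis rootL : forall p : {poly L}, separable_poly p -> (1 < size p)%N -> exists x, root p x.

(** The value of g at x is the sum of the values of the differences of x and the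
    roots of g, so one of these differences has positive value. *)
Lemma near_root (g : {poly L}) x : separable_poly g -> w (lead_coef g) = 0 ->
  vgt w 0 g.[x] -> exists2 r, root g r & vgt w 0 (x - r).
Proof.
move=> sep_g wlc gx; have [rs uniq_rs def_g] := separable_split rootL sep_g.
have lc0 : lead_coef g != 0 by rewrite lead_coef_eq0 separable_poly_neq0.
have rsP r : (r \in rs) = root g r by rewrite def_g rootZ // root_prod_XsubC.
apply: contrapT => no_r.
have far r : r \in rs -> x - r != 0 /\ w (x - r) <= 0.
  rewrite rsP => gr; have nr : ~~ vgt w 0 (x - r) by apply/negP => h; apply: no_r; exists r.
  by move: nr; rewrite /vgt negb_or -leNgt => /andP[].
have : (\prod_(r <- rs) (x - r) != 0) /\ w (\prod_(r <- rs) (x - r)) <= 0.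
  elim: rs far {uniq_rs def_g rsP} => [|r rs IH] far; first by rewrite big_nil oner_neq0 qval1.
  have [r0 wr] := far r (mem_head _ _).
  have [|p0 wp] := IH; first by move=> t ts; apply: far; rewrite inE ts orbT.
  by rewrite big_cons mulf_neq0 // qvalM //; split=> //; lra.
case=> p0 wp; move: gx; rewrite def_g hornerZ horner_prod.
have -> : \prod_(r <- rs) ('X - r%:P).[x] = \prod_(r <- rs) (x - r).
  by apply: eq_bigr => r _; rewrite hornerXsubC.
by rewrite vgtE ?mulf_neq0 // qvalM // wlc add0r ltNge wp.
Qed.

End NearRoot.

(** * A henselian field at ell with large residue field *)
Section LocalField.
Variables (F : finFieldType) (L : fieldType) (iota : {rmorphism ratfun F -> L}).
Hypothesis sepL : separable_closure iota.
Local Notation q := #|F|.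
Local Notation scalar := (scalar iota).
Local Notation th := (th iota).
Variables (ell : {poly F}) (w : qvaluation L) (vpi : L).
Hypotheses (irr_ell : irreducible_poly ell) (ell_nX : ~~ (ell %| 'X)).
Hypotheses (vpiX : vpi ^+ q.-1 = rpol iota ell) (w_vpi : w vpi = 1).
Hypothesis w_unit : forall p, ~~ (ell %| p) -> w (rpol iota p) = 0.

Lemma q_gt1 : (1 < q)%N. Proof. exact: finNzRing_gt1. Qed.
Lemma q1_gt0 : (0 < q.-1)%N. Proof. by rewrite -subn1 subn_gt0 q_gt1. Qed.

Lemma vpi_neq0 : vpi != 0.
Proof.
apply/negP => /eqP e; move: vpiX; rewrite e expr0n gtn_eqF ?q1_gt0 // => /esym/eqP.
by rewrite rpol_eq0; apply/negP; rewrite -size_poly_gt0; case: irr_ell => /ltnW.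
Qed.

(** The algebraic closure of F in L.  It is a field of representatives for the
    residue field of the local field constructed below. *)
Definition const_pred : {pred L} := [pred c | `[< algebraicOver scalar c >]].
Lemma constP c : reflect (algebraicOver scalar c) (c \in const_pred).
Proof. by rewrite inE; apply: asboolP. Qed.
Lemma const_divring : divring_closed const_pred.
Proof.
split=> [|x y /constP ax /constP ay|x y /constP ax /constP ay]; apply/constP.
- exact: algebraic1.
- exact: algebraic_sub.
exact: algebraic_div.
Qed.
Definition constf := Subfield const_divring.
Local Notation "x \inK" := (x \in subfield_pred constf) (at level 70).

Lemma scalar_const a : scalar a \inK.
Proof. by apply/constP; apply: algebraic_id. Qed.

Lemma root_const (g : {poly L}) x : g \is a polyOver (subfield_pred constf) -> g != 0 ->
  root g x -> x \inK.
Proof.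
move=> gk g0 gx; apply/constP/integral_algebraic.
apply: (integral_root g0 gx) => _ /(nthP 0)[i _ <-].
by apply/integral_algebraic/constP; apply: (polyOverP gk).
Qed.

Lemma rpolC a : rpol iota a%:P = scalar a. Proof. by []. Qed.

Lemma w_const c : c \inK -> c != 0 -> w c = 0.
Proof.
have w_scalar a : vge w 0 (scalar a).
  have [->|a0] := eqVneq a 0; first by rewrite rmorph0 vge0.
  rewrite -rpolC vgeE ?rpol_eq0 ?polyC_eq0 // w_unit //; apply/negP => /dvdp_leq.
  rewrite polyC_eq0 size_polyC => /(_ a0); rewrite a0 leqNgt.
  by case: irr_ell => ->.
have half x : x \inK -> vge w 0 x.
  move=> /constP/integral_algebraic[p p_mon px].
  apply: (vint_root _ _ px) => [|i]; first by rewrite map_monic.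
  by rewrite coef_map; apply: w_scalar.
move=> ck c0; have := half _ ck; have := half c^-1; rewrite rpredV => /(_ ck).
by rewrite !vgeE ?invr_eq0 // qvalV //; lra.
Qed.

Lemma const_vint c : c \inK -> vge w 0 c.
Proof.
by move=> ck; have [->|c0] := eqVneq c 0; rewrite ?vge0 // vgeE // w_const.
Qed.

Lemma kpoly_vint (h : {poly L}) : h \is a polyOver (subfield_pred constf) ->
  forall i, vge w 0 h`_i.
Proof. by move=> hk i; apply/const_vint/(polyOverP hk). Qed.

Lemma vint_vpi : vge w 0 vpi. Proof. by rewrite vgeE ?vpi_neq0 // w_vpi. Qed.

(** The lowest term of a polynomial in vpi dominates, as nonzero constants have
    value 0. *)
Lemma kpoly_val (h : {poly L}) : h \is a polyOver (subfield_pred constf) -> h != 0 ->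
  exists i c u, [/\ h.[vpi] = vpi ^+ i * u, c \inK, c != 0 & vgt w 0 (u - c)].
Proof.
move=> hk h0; have [|i [h1 [eh nd]]] := @poly_multiplicity L 'X h _ h0; first by rewrite size_polyX.
have h1k : h1 \is a polyOver (subfield_pred constf).
  apply/polyOverP => j; have := polyOverP hk (i + j)%N.
  by rewrite eh coefXnM ltnNge leq_addr /= addKn.
exists i, h1`_0, h1.[vpi]; split.
- by rewrite eh hornerM hornerXn.
- exact: (polyOverP h1k).
- by rewrite -horner_coef0; move: nd; rewrite -['X]subr0 dvdp_XsubCl.
have [r r0 er] := vint_taylor1 (kpoly_vint h1k) (vge0 w 0) vint_vpi.
rewrite -{1}[vpi]add0r er horner_coef0 addrC addKr mulrC -[0]addr0.
by apply: vgtM => //; rewrite vgtE ?vpi_neq0 // w_vpi.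
Qed.

Lemma near_const_val u c : c \inK -> c != 0 -> vgt w 0 (u - c) -> u != 0 /\ w u = 0.
Proof.
move=> ck c0 uc; have wc := w_const ck c0.
have [|] := @qval_dom _ w c (u - c) c0; first by rewrite wc.
by rewrite addrC subrK wc.
Qed.

(** The field of rational functions in vpi over the constants. *)
Definition kfrac_pred : {pred L} :=
  [pred x | `[< exists h g, [/\ h \is a polyOver (subfield_pred constf),
     g \is a polyOver (subfield_pred constf), g.[vpi] != 0 & x = h.[vpi] / g.[vpi]] >]].
Lemma kfracP x : reflect (exists h g, [/\ h \is a polyOver (subfield_pred constf),
     g \is a polyOver (subfield_pred constf), g.[vpi] != 0 & x = h.[vpi] / g.[vpi]])
  (x \in kfrac_pred).
Proof. by rewrite inE; apply: asboolP. Qed.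

Lemma kfrac_divring : divring_closed kfrac_pred.
Proof.
split=> [|x y /kfracP[h [g [hk gk g0 ->]]] /kfracP[h' [g' [hk' gk' g0' ->]]]
  |x y /kfracP[h [g [hk gk g0 ->]]] /kfracP[h' [g' [hk' gk' g0' ->]]]]; apply/kfracP.
- by exists 1, 1; rewrite !hornerC divr1 rpred1 oner_neq0; split.
- exists (h * g' - h' * g), (g * g'); rewrite !hornerE mulf_neq0 // !rpredM // rpredB ?rpredM //.
  by split=> //; field; rewrite g0 g0'.
have [h'0|h'0] := eqVneq h'.[vpi] 0.
  by exists 0, 1; rewrite h'0 mul0r invr0 mulr0 !hornerC mul0r rpred0 rpred1 oner_neq0; split.
exists (h * g'), (g * h'); rewrite !hornerE mulf_neq0 // !rpredM //.
by split=> //; field; rewrite g0 g0' h'0.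
Qed.
Definition kfrac := Subfield kfrac_divring.

Lemma sub_kfrac c : c \inK -> c \in subfield_pred kfrac.
Proof.
move=> ck; apply/kfracP; exists c%:P, 1.
by rewrite polyOverC ck rpred1 !hornerC divr1 oner_neq0; split.
Qed.

Lemma vpi_kfrac : vpi \in subfield_pred kfrac.
Proof.
apply/kfracP; exists 'X, 1.
by rewrite polyOverX rpred1 hornerX hornerC divr1 oner_neq0; split.
Qed.

Lemma kfrac_val x : x \in subfield_pred kfrac -> x != 0 ->
  exists i j c u, [/\ x = vpi ^+ i / vpi ^+ j * u, c \inK, c != 0 & vgt w 0 (u - c)].
Proof.
case/kfracP=> h [g [hk gk g0 ->]]; rewrite mulf_eq0 invr_eq0 (negPf g0) orbF => h0.
have nz (r : {poly L}) : r.[vpi] != 0 -> r != 0 by apply: contraNneq => ->; rewrite horner0.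
have [i [c [u [eh ck c0 uc]]]] := kpoly_val hk (nz _ h0).
have [j [d [v [eg dk d0 vd]]]] := kpoly_val gk (nz _ g0).
have [u0 wu] := near_const_val ck c0 uc; have [v0 wv] := near_const_val dk d0 vd.
have wd := w_const dk d0; have wc := w_const ck c0.
exists i, j, (c / d), (u / v); split.
- by rewrite eh eg; have := expf_neq0 j vpi_neq0; move: (vpi ^+ j) => t t0; field; rewrite v0 t0.
- by rewrite rpred_div.
- by rewrite mulf_neq0 ?invr_eq0.
have -> : u / v - c / d = (v * d)^-1 * ((u - c) * d - (v - d) * c) by field; rewrite v0 d0.
rewrite -[0]addr0; apply: vgtM; first by rewrite vgeE ?invr_eq0 ?mulf_neq0 // qvalV ?mulf_neq0 // qvalM // wv wd.
by apply: vgtB; rewrite mulrC -[0]addr0; apply: vgtM => //; apply: const_vint.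
Qed.

Lemma kfrac_int x : x \in subfield_pred kfrac -> x != 0 -> exists z : int, w x = z%:~R.
Proof.
move=> xK x0; have [i [j [c [u [-> ck c0 uc]]]]] := kfrac_val xK x0.
have [u0 wu] := near_const_val ck c0 uc; have nz m := expf_neq0 m vpi_neq0.
exists (i%:Z - j%:Z); rewrite qvalM ?mulf_neq0 ?invr_eq0 // qval_div // !qvalX ?vpi_neq0 // w_vpi wu.
by rewrite !mul1r addr0 rmorphB /= -!pmulrn.
Qed.

Lemma kfrac_residue x : x \in subfield_pred kfrac -> vge w 0 x ->
  exists2 c, c \inK & vgt w 0 (x - c).
Proof.
move=> xK x_ge0; have [->|x0] := eqVneq x 0; first by exists 0; rewrite ?rpred0 // subrr vgt0.
have [x_gt0|] := boolP (vgt w 0 x); first by exists 0; rewrite ?rpred0 // subr0.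
rewrite vgtE // -leNgt => x_le0; have wx : w x = 0.
  by apply/eqP; rewrite eq_le x_le0 -vgeE.
have [i [j [c [u [ex ck c0 uc]]]]] := kfrac_val xK x0.
have [u0 wu] := near_const_val ck c0 uc; have nz m := expf_neq0 m vpi_neq0.
move: wx; rewrite ex qvalM ?mulf_neq0 ?invr_eq0 // qval_div // !qvalX ?vpi_neq0 // w_vpi wu.
rewrite !mul1r addr0 => /eqP; rewrite subr_eq0 eqr_nat => /eqP ij.
by exists c; rewrite // ij mulfV // mul1r.
Qed.

(** The vpi-adic closure of this field in L. *)
Definition Ehat := vclosure w kfrac.
Local Notation "x \inE" := (x \in subfield_pred Ehat) (at level 70).

Lemma Ehat_int x : x \inE -> x != 0 -> exists z : int, w x = z%:~R.
Proof. exact: (vclosure_int kfrac_int). Qed.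

Lemma kfrac_Ehat x : x \in subfield_pred kfrac -> x \inE.
Proof. exact: sub_vclosure. Qed.

Lemma Ehat_residue x : x \inE -> vge w 0 x -> exists2 c, c \inK & vgt w 0 (x - c).
Proof.
move=> /vclosureP/(_ 1%N)[a aK xa] x0; have xa' : vgt w 0 (x - a) by apply: vge_gt xa.
have [|c ck ac] := kfrac_residue aK.
  have -> : a = x - (x - a) by ring.
  by rewrite vgeB // vgtW.
by exists c; rewrite // -(subrK a x) -addrA vgtD.
Qed.

Lemma Ehat_hensel (f : {poly L}) x c :
    f \is a polyOver (subfield_pred Ehat) -> (forall i, vge w 0 f`_i) ->
    root f x -> vge w 0 x -> f^`().[x] != 0 -> w f^`().[x] = 0 ->
    c \inK -> vgt w 0 (x - c) -> x \inE.
Proof.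
move=> fE f0 fx x0 nz wz ck xc.
exact: (vclosure_hensel kfrac_int fE f0 fx x0 nz wz (sub_kfrac ck) xc).
Qed.

(** A separable polynomial over the constants splits over the constants, so that
    approximate roots are close to constants. *)
Lemma near_const_root (g : {poly L}) x : g \is a polyOver (subfield_pred constf) ->
  separable_poly g -> vgt w 0 g.[x] -> exists2 c, c \inK & vgt w 0 (x - c).
Proof.
move=> gk sep_g gx; have g0 := separable_poly_neq0 sep_g.
have [|r gr xr] := @near_root _ w sepL.2 g x sep_g _ gx.
  by apply: w_const; rewrite ?lead_coef_eq0 // lead_coefE (polyOverP gk).
by exists r; rewrite // (root_const gk g0 gr).
Qed.

(** By Hensel's lemma for ell(x) - vpi^(q-1), of which theta is a root; modulo
    vpi this is the separable polynomial ell. *)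
Lemma th_Ehat : th \inE.
Proof.
pose g : {poly L} := map_poly scalar ell.
have gk : g \is a polyOver (subfield_pred constf).
  by apply/polyOverP => i; rewrite coef_map; apply: scalar_const.
have sep_ell := finField_irreducible_separable irr_ell.
have horner_th (p : {poly F}) : (map_poly scalar p).[th] = rpol iota p.
  elim/poly_ind: p => [|p a IH]; first by rewrite !rmorph0 horner0.
  by rewrite rmorphD rmorphM /= map_polyX map_polyC hornerMXaddC IH [RHS]rmorphD rmorphM.
have w_th : w th = 0 by rewrite -[th]/(rpol iota 'X) w_unit.
have th_int : vge w 0 th by rewrite vgeE ?th_neq0 // w_th.
have rpol_int p : vge w 0 (rpol iota p).
  by rewrite -horner_th vint_horner // => i; rewrite coef_map; apply/const_vint/scalar_const.
have w_ell : vgt w 0 (rpol iota ell).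
  rewrite -vpiX vgtE ?expf_neq0 ?vpi_neq0 // qvalX ?vpi_neq0 // w_vpi mul1r.
  by rewrite ltr0n q1_gt0.
have sep_g : separable_poly g by rewrite separable_map.
have [|c ck thc] := near_const_root (x := th) gk sep_g; first by rewrite horner_th.
have vpiE : vpi \inE by apply/kfrac_Ehat/vpi_kfrac.
have [l0 wl] : rpol iota ell^`() != 0 /\ w (rpol iota ell^`()) = 0.
  have := sep_ell; rewrite unlock => /Bezout_eq1_coprimepP[[a d] /= ab].
  have e1 : rpol iota d * rpol iota ell^`() = 1 - rpol iota ell * rpol iota a.
    by rewrite -(rmorph1 (rpol iota)) -ab rmorphD !rmorphM /=; ring.
  have small : vgt w (w 1) (- (rpol iota ell * rpol iota a)).
    by rewrite qval1 vgtN mulrC -[0]addr0; apply: vgtM.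
  have [] := qval_dom (oner_neq0 L) small; rewrite -e1 qval1 mulf_eq0 negb_or.
  case/andP=> d0 l0; rewrite qvalM // => e; split=> //.
  have := rpol_int d; have := rpol_int ell^`(); rewrite !vgeE //; lra.
apply: (@Ehat_hensel (g - (rpol iota ell)%:P) th c) => //.
- rewrite rpredB ?polyOverC -?vpiX ?rpredX //.
  by apply/polyOverP => i; apply/kfrac_Ehat/sub_kfrac/(polyOverP gk).
- move=> i; rewrite coefB coefC vgeB ?kpoly_vint //; case: (i == 0)%N; rewrite ?vge0 //.
- by rewrite rootE hornerD hornerN hornerC horner_th subrr.
- by rewrite derivB derivC subr0 deriv_map horner_th.
by rewrite derivB derivC subr0 deriv_map horner_th.
Qed.

Lemma iota_Ehat a : iota a \inE.
Proof.
have rpolE p : rpol iota p \inE.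
  elim/poly_ind: p => [|p c IH]; first by rewrite rmorph0 rpred0.
  rewrite rmorphD rmorphM; apply: rpredD; first by apply: rpredM => //; apply: th_Ehat.
  exact/kfrac_Ehat/sub_kfrac/scalar_const.
have [n [d [d0 ->]]] := fraction_div a.
by rewrite fmorph_div; apply: rpred_div; apply: rpolE.
Qed.

Definition Eloc : intermediate iota := Intermediate (subfield_predP Ehat) iota_Ehat.

Lemma q_natr : q%:R = 0 :> L. Proof. exact: (finField_card_eq0 scalar). Qed.
Lemma q1_natr : q.-1%:R = -1 :> L.
Proof. by rewrite -subn1 natrB ?q_natr ?sub0r // ltnW // q_gt1. Qed.

Lemma radical_separable (a : L) : a != 0 -> separable_poly ('X^(q.-1) - a%:P : {poly L}).
Proof.
move=> a0; apply: (@separable_bezout _ _ 1 'X (- a)); first by rewrite oppr_eq0.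
rewrite derivB derivXn derivC subr0 -mulr_natl -polyC_natr q1_natr.
rewrite mul1r mulrCA -exprS prednK ?q1_gt0 // !polyCN polyC1; ring.
Qed.

Lemma artin_deriv (a s : L) : ('X^q + a *: 'X - s%:P : {poly L})^`() = a%:P.
Proof.
rewrite derivB derivD derivXn derivZ derivX derivC subr0 -mulr_natl -polyC_natr q_natr.
by rewrite mul0r add0r alg_polyC.
Qed.

Lemma artin_separable (a s : L) : a != 0 -> separable_poly ('X^q + a *: 'X - s%:P : {poly L}).
Proof.
move=> a0; apply: (@separable_bezout _ _ 0 1 a) => //.
by rewrite mul0r add0r mul1r artin_deriv.
Qed.

Lemma size_artin (a s : L) : size ('X^q + a *: 'X - s%:P : {poly L}) = q.+1.
Proof.
rewrite -addrA size_polyDl ?size_polyXn //.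
apply: leq_ltn_trans (size_polyD _ _) _.
rewrite size_polyN gtn_max !ltnS; apply/andP; split.
  by apply: leq_trans (size_scale_leq _ _) _; rewrite size_polyX q_gt1.
exact: leq_trans (size_polyC_leq1 _) (ltnW q_gt1).
Qed.

Lemma artin_monic (a s : L) : ('X^q + a *: 'X - s%:P : {poly L}) \is monic.
Proof.
rewrite monicE lead_coefE size_artin /= coefB coefD coefXn eqxx coefZ coefX coefC.
by rewrite !gtn_eqF ?q_gt1 ?(ltnW q_gt1) // mulr0 addr0 subr0.
Qed.

Lemma artin_root (a s : L) : exists x : L, a != 0 -> x ^+ q + a * x = s.
Proof.
have [->|a0] := eqVneq a 0; first by exists 0.
have [||x /rootP] := sepL.2 ('X^q + a *: 'X - s%:P).
- exact: artin_separable.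
- by rewrite size_artin ltnS ltnW // q_gt1.
by rewrite !hornerE => /eqP; rewrite subr_eq0 => /eqP ex; exists x.
Qed.

Lemma artin_vint (a s x : L) : vge w 0 a -> vge w 0 s -> x ^+ q + a * x = s -> vge w 0 x.
Proof.
move=> a0 s0 ex; apply: (vint_root (artin_monic a s)); last first.
  by rewrite rootE !hornerE ex subrr.
move=> i; rewrite coefB coefD coefXn coefZ coefX coefC.
apply: vgeB; last by case: (i == 0)%N; rewrite ?vge0.
by apply: vgeD; [case: (i == q) | case: (i == 1)%N]; rewrite ?mulr1 ?mulr0 ?vge0 ?vint1.
Qed.

Lemma Ehat_near (f : {poly L}) x c :
    f \is a polyOver (subfield_pred Ehat) -> (forall i, vge w 0 f`_i) ->
    root f x -> f^`().[x] != 0 -> w f^`().[x] = 0 ->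
    c \inE -> vge w 0 c -> vgt w 0 (x - c) -> x \inE.
Proof.
move=> fE f0 fx nz wz cE c0 xc; have [d dk cd] := Ehat_residue cE c0.
have x0 : vge w 0 x by rewrite -(subrK c x) vgeD // vgtW.
apply: (Ehat_hensel fE f0 fx x0 nz wz dk).
by rewrite -(subrK c x) -addrA vgtD.
Qed.

Lemma unit_residue a c : a != 0 -> w a = 0 -> vgt w 0 (a - c) -> c != 0.
Proof.
by move=> a0 wa; apply: contraTneq => ->; rewrite subr0 vgtE // wa ltxx.
Qed.

(** The reduction of x^q + a x = s is separable since a is a unit, and its roots
    are constants. *)
Lemma Ehat_artin (a s x : L) : a \inE -> s \inE -> a != 0 -> w a = 0 -> vge w 0 s ->
  x ^+ q + a * x = s -> x \inE.
Proof.
move=> aE sE a0 wa s0 ex; have av : vge w 0 a by rewrite vgeE // wa.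
have [al alk aal] := Ehat_residue aE av; have [sg sgk ssg] := Ehat_residue sE s0.
have x0 := artin_vint av s0 ex.
have al0 := unit_residue a0 wa aal.
have [|||c ck xc] := @near_const_root ('X^q + al *: 'X - sg%:P) x.
- by rewrite rpredB ?rpredD ?polyOverZ ?polyOverXn ?polyOverX ?polyOverC.
- exact: artin_separable.
- rewrite !hornerE.
  have -> : x ^+ q + al * x - sg = (s - sg) - x * (a - al) by rewrite -ex; ring.
  by apply: vgtB => //; rewrite -[0]addr0; apply: vgtM.
apply: (@Ehat_hensel ('X^q + a *: 'X - s%:P) x c) => //.
- by rewrite rpredB ?rpredD ?polyOverZ ?polyOverXn ?polyOverX ?polyOverC.
- move=> i; rewrite coefB coefD coefXn coefZ coefX coefC.
  apply: vgeB; last by case: (i == 0)%N; rewrite ?vge0.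
  by apply: vgeD; [case: (i == q) | case: (i == 1)%N]; rewrite ?mulr1 ?mulr0 ?vge0 ?vint1.
- by rewrite rootE !hornerE ex subrr.
- by rewrite artin_deriv hornerC.
by rewrite artin_deriv hornerC.
Qed.

Lemma Ehat_radical (a x : L) : a \inE -> a != 0 -> w a = 0 -> x ^+ q.-1 = a -> x \inE.
Proof.
move=> aE a0 wa ex; have av : vge w 0 a by rewrite vgeE // wa.
have [al alk aal] := Ehat_residue aE av; have al0 := unit_residue a0 wa aal.
have x0 : x != 0 by apply: contraNneq a0 => x0; rewrite -ex x0 expr0n gtn_eqF ?q1_gt0.
have wx : w x = 0.
  have := congr1 w ex; rewrite qvalX // wa => /eqP; rewrite mulf_eq0 pnatr_eq0.
  by rewrite (gtn_eqF q1_gt0) orbF => /eqP.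
have [|||c ck xc] := @near_const_root ('X^(q.-1) - al%:P) x.
- by rewrite rpredB ?polyOverXn ?polyOverC.
- exact: radical_separable.
- by rewrite !hornerE ex.
have dE : ('X^(q.-1) - a%:P)^`().[x] = - x ^+ q.-2.
  rewrite derivB derivXn derivC subr0 -mulr_natl -polyC_natr q1_natr hornerM hornerC hornerXn.
  by rewrite mulN1r.
apply: (@Ehat_hensel ('X^(q.-1) - a%:P) x c) => //.
- by rewrite rpredB ?polyOverXn ?polyOverC.
- move=> i; rewrite coefB coefXn coefC.
  by apply: vgeB; [case: (i == _)%N | case: (i == 0)%N]; rewrite ?vge0 ?vint1.
- by rewrite rootE !hornerE ex subrr.
- by rewrite vgeE // wx.
- by rewrite dE oppr_eq0 expf_neq0.
by rewrite dE qvalN qvalX // wx mul0r.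
Qed.

Lemma vpi_Ehat : vpi \inE. Proof. exact/kfrac_Ehat/vpi_kfrac. Qed.

End LocalField.

(** * Transvections from the bad place ell *)
Lemma dependent_choice (T : Type) (P : T -> Prop) (R : T -> T -> Prop) :
    (forall x, P x -> exists y, P y /\ R x y) ->
  forall x0, P x0 -> exists f : nat -> T, f 0%N = x0 /\ forall n, P (f n) /\ R (f n) (f n.+1).
Proof.
move=> step x0 P0; pose next (x : {x | P x}) : {x | P x} :=
  let h := cid (step _ (proj2_sig x)) in exist P (proj1_sig h) (proj1 (proj2_sig h)).
pose g n := iter n next (exist P x0 P0).
exists (fun n => proj1_sig (g n)); split=> // n; split; first exact: proj2_sig (g n).
by rewrite /= /next; case: (cid _) => y [].
Qed.

(** The field E stands for the local field Eloc above, of which only the listed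
    properties are used.  The value w is normalised by w(vpi) = 1, so that
    w(b) = - n (q-1) for n = - v_ell(b). *)
Section LocalTate.
Variables (F : finFieldType) (L : fieldType) (iota : {rmorphism ratfun F -> L}).
Hypothesis sepL : separable_closure iota.
Variable b : ratfun F.
Local Notation q := #|F|.
Local Notation scalar := (scalar iota).
Local Notation frob := (frob iota).
Local Notation th := (th iota).
Local Notation bb := (bb iota b).
Local Notation embS := (embS iota).
Local Notation frobS := (frobS iota).
Local Notation tateS := (tateS iota b).
Variables (w : qvaluation L) (vpi : L) (E : intermediate iota) (n : nat).
Hypotheses (vpi0 : vpi != 0) (vpiE : vpi \in carrier E) (w_vpi : w vpi = 1).
Hypothesis E_int : forall x, x \in carrier E -> x != 0 -> exists z : int, w x = z%:~R.
Hypothesis E_near : forall (f : {poly L}) x c,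
    f \is a polyOver (carrier E) -> (forall i, vge w 0 f`_i) ->
    root f x -> f^`().[x] != 0 -> w f^`().[x] = 0 ->
    c \in carrier E -> vge w 0 c -> vgt w 0 (x - c) -> x \in carrier E.
Hypothesis E_artin : forall a s x : L, a \in carrier E -> s \in carrier E ->
  a != 0 -> w a = 0 -> vge w 0 s -> x ^+ q + a * x = s -> x \in carrier E.
Hypothesis E_radical : forall a x : L, a \in carrier E -> a != 0 -> w a = 0 ->
  x ^+ q.-1 = a -> x \in carrier E.
Hypotheses (w_th : w th = 0) (n_gt0 : (0 < n)%N) (co_qn : coprime q n).
Hypotheses (b0 : bb != 0) (w_b : w bb = - (n * q.-1)%:R).

Let q_gt0 : (0 < q)%N. Proof. exact: ltnW (q_gt1 F). Qed.
Let th0 : th != 0. Proof. exact: th_neq0. Qed.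
Let thE : th \in carrier E. Proof. exact: carrier_base. Qed.
Let bbE : bb \in carrier E. Proof. exact: carrier_base. Qed.
Let th_int : vge w 0 th. Proof. by rewrite vgeE // w_th. Qed.
Let Q : rat := q%:R.
Let Q2 : 2 <= Q. Proof. by rewrite ler_nat q_gt1. Qed.
Let Qm_gt0 : 0 < Q - 1. Proof. by rewrite subr_gt0 (lt_le_trans _ Q2) // ltr1n. Qed.
Let Qp_gt0 : 0 < Q + 1. Proof. by rewrite addr_gt0 // ltr0n. Qed.
Let q1E : q.-1%:R = Q - 1 :> rat.
Proof. by rewrite -subn1 natrB. Qed.

(** For a unit t and small nu, the equation x^N (x - t) = nu has a root close to
    t, which belongs to E by Hensel's lemma.  It is applied
    with N = q and N = q-1. *)
Section UnitRoot.
Variables (N : nat) (t nu : L).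
Hypotheses (t0 : t != 0) (wt : w t = 0) (nu0 : nu != 0) (nu_small : vgt w 0 nu).
Let f : {poly L} := 'X^(N.+1) - t *: 'X^N - nu%:P.
Hypothesis sep_f : separable_poly f.
Hypothesis f'_unit : forall x, x != 0 -> w x = 0 -> f^`().[x] != 0 /\ w f^`().[x] = 0.

Lemma unit_root_aux : exists x, [/\ x ^+ N * (x - t) = nu, x != 0, w x = 0, vgt w 0 (x - t)
  & t \in carrier E -> nu \in carrier E -> x \in carrier E].
Proof.
have lcf : lead_coef f = 1.
  have size_low : (size (- (t *: 'X^N) - nu%:P : {poly L})%R < N.+2)%N.
    apply: leq_ltn_trans (size_polyD _ _) _; rewrite !size_polyN gtn_max !ltnS.
    rewrite (leq_trans (size_scale_leq _ _)) ?size_polyXn //=.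
    exact: leq_trans (size_polyC_leq1 _) _.
  by rewrite /f -addrA lead_coefDl ?lead_coefXn // size_polyXn.
have ft : f.[t] = - nu by rewrite /f !hornerE exprS; ring.
have [||r fr tr] := @near_root _ w sepL.2 f t sep_f.
- by rewrite lcf qval1.
- by rewrite ft vgtN.
have tt' : vgt w (w t) (r - t) by rewrite wt -vgtN opprB.
have [] := qval_dom t0 tt'; rewrite addrC subrK wt => r0 wr.
exists r; split=> //.
- move/rootP: fr; rewrite /f !hornerE exprS => /eqP; rewrite subr_eq0 => /eqP <-; ring.
- by rewrite -vgtN opprB.
move=> tE nuE; have [nz wz] := f'_unit r0 wr.
have t_int : vge w 0 t by rewrite vgeE // wt.
apply: (@E_near f r t) => //; last by rewrite -vgtN opprB.
- by rewrite !rpredB ?polyOverZ ?polyOverXn ?polyOverC.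
move=> i; rewrite !coefB coefZ !coefXn coefC.
apply: vgeB; last by case: (i == 0)%N; rewrite ?vge0 ?vgtW.
by apply: vgeB; case: (i == _); rewrite ?mulr1 ?mulr0 ?vge0 ?vint1.
Qed.
End UnitRoot.

Let q_nat0 : q%:R = 0 :> L. Proof. exact: (finField_card_eq0 scalar). Qed.

Lemma unit_root_q t nu : t != 0 -> w t = 0 -> nu != 0 -> vgt w 0 nu ->
  exists x, [/\ x ^+ q * (x - t) = nu, x != 0, w x = 0, vgt w 0 (x - t)
  & t \in carrier E -> nu \in carrier E -> x \in carrier E].
Proof.
move=> t0 wt nu0 nus.
have f' : ('X^(q.+1) - t *: 'X^q - nu%:P : {poly L})^`() = 'X^q.
  rewrite !derivB derivZ !derivXn derivC subr0 -mulr_natl -[X in _ - _ *: X]mulr_natl.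
  by rewrite -!polyC_natr -addn1 natrD q_nat0 add0r mul0r scaler0 subr0 mul1r addn1.
apply: unit_root_aux => // [|x x0 wx]; last by rewrite f' hornerXn expf_neq0 // qvalX // wx mul0r.
apply: (@separable_bezout _ _ 1 (- ('X - t%:P)) (- nu)); first by rewrite oppr_eq0.
by rewrite f' mul1r -mul_polyC exprS polyCN; ring.
Qed.

Lemma unit_root_q1 t nu : t != 0 -> w t = 0 -> nu != 0 -> vgt w 0 nu ->
  exists x, [/\ x ^+ q.-1 * (x - t) = nu, x != 0, w x = 0, vgt w 0 (x - t)
  & t \in carrier E -> nu \in carrier E -> x \in carrier E].
Proof.
move=> t0 wt nu0 nus; have q1 := q_gt1 F.
have eq1 : q.-1 = q.-2.+1 by rewrite prednK // -subn1 subn_gt0.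
have f' : ('X^(q.-1.+1) - t *: 'X^(q.-1) - nu%:P : {poly L})^`() = t *: 'X^(q.-2).
  rewrite !derivB derivZ !derivXn derivC subr0 -mulr_natl -[X in _ - _ *: X]mulr_natl.
  rewrite -!polyC_natr prednK // q_nat0 mul0r (q1_natr iota).
  by rewrite polyCN mulN1r scalerN opprK add0r.
apply: unit_root_aux => // [|x x0 wx]; last first.
  by rewrite f' !hornerE mulf_neq0 ?expf_neq0 // qvalM ?expf_neq0 // qvalX // wt wx mul0r.
apply: (@separable_bezout _ _ 1 (- (t^-1 *: 'X^2 - 'X)) (- nu)); first by rewrite oppr_eq0.
rewrite f' mul1r -!mul_polyC eq1 !exprS polyCN.
have tV : t%:P * t^-1%:P = 1 :> {poly L} by rewrite -polyCM mulfV.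
by move: ('X^_) => P; rewrite expr0 mulr1; ring: tV.
Qed.

(** A root m of phi(t) in E.  The power X0 = m^(q-1) is a root of
    theta + b X = X^(q+1), and since b has negative value there is one close to
    - theta / b.  Writing it as - (theta / b) / Z turns the equation into
    Z^q (Z - 1) = c0 with small c0.  The root m itself lies in E because X0 is a
    unit times vpi^(n(q-1)). *)
Lemma exists_m1 : exists m : L, [/\ m \in carrier E, m != 0, w m = n%:R
  & th + bb * m ^+ q.-1 = (m ^+ q.-1) ^+ q.+1].
Proof.
pose c0 := (- (th / bb)) ^+ q.+1 / th.
have tb0 : - (th / bb) != 0 by rewrite oppr_eq0 mulf_neq0 ?invr_eq0.
have w_tb : w (- (th / bb)) = (n * q.-1)%:R by rewrite qvalN qval_div // w_th w_b opprK add0r.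
have c00 : c0 != 0 by rewrite mulf_neq0 ?invr_eq0 ?expf_neq0.
have c0s : vgt w 0 c0.
  rewrite vgtE // qval_div ?expf_neq0 // w_th subr0 qvalX // w_tb mulr_gt0 ?ltr0n //.
  by rewrite muln_gt0 n_gt0 -subn1 subn_gt0 q_gt1.
have [Z [eZ Z0 wZ _ ZE]] := unit_root_q (oner_neq0 L) (qval1 w) c00 c0s.
have {}ZE : Z \in carrier E.
  by apply: ZE; rewrite ?rpred1 // /c0 rpred_div ?rpredX ?rpredN ?rpred_div.
pose X0 := - (th / bb) / Z.
have X00 : X0 != 0 by rewrite mulf_neq0 ?invr_eq0.
have wX0 : w X0 = (n * q.-1)%:R by rewrite qval_div // w_tb wZ subr0.
have eX0 : th + bb * X0 = X0 ^+ q.+1.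
  have : th * Z ^+ q * (Z - 1) = (- (th / bb)) ^+ q.+1.
    by rewrite -mulrA eZ /c0; field.
  rewrite /X0 expr_div_n => <-; rewrite exprS.
  have := expf_neq0 q Z0; move: (Z ^+ q) => Zq Zq0; field.
  by rewrite Zq0 Z0 b0.
have [m em] : exists m, m ^+ q.-1 = X0.
  have [||m /rootP] := sepL.2 ('X^(q.-1) - X0%:P).
  - exact: (radical_separable iota).
  - rewrite size_XnsubC -?subn1 ?subn_gt0 ?q_gt1 // ltnS subn_gt0; exact: q_gt1.
  by rewrite !hornerE => /eqP; rewrite subr_eq0 => /eqP em; exists m.
have q1 : (0 < q.-1)%N by rewrite -subn1 subn_gt0 q_gt1.
have m0 : m != 0 by apply: contraNneq X00 => m0; rewrite -em m0 expr0n gtn_eqF.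
have wm : w m = n%:R.
  have := congr1 w em; rewrite qvalX // wX0 natrM => /mulIf -> //.
  by rewrite pnatr_eq0 -lt0n.
exists m; rewrite em; split=> //.
have -> : m = (m / vpi ^+ n) * vpi ^+ n by rewrite divfK ?expf_neq0.
rewrite rpredM ?rpredX // (E_radical _ _ _ (erefl _)) //.
- by rewrite expr_div_n em rpred_div ?rpredX // /X0 rpred_div ?rpredN ?rpred_div.
- by rewrite expf_neq0 // mulf_neq0 ?invr_eq0 ?expf_neq0.
rewrite qvalX ?mulf_neq0 ?invr_eq0 ?expf_neq0 // qval_div ?expf_neq0 // qvalX // w_vpi wm.
by rewrite mul1r subrr mul0r.
Qed.

Section Twist.
Variable m : L.
Hypotheses (mE : m \in carrier E) (m0 : m != 0) (wm : w m = n%:R).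
Hypothesis em : th + bb * m ^+ q.-1 = (m ^+ q.-1) ^+ q.+1.

(** In the coordinate x -> m x the operator phi(t) becomes
    psi = (theta + mu tau)(1 - tau); Dop is its left factor (phi_twist). *)
Definition mu := (m ^+ q.-1) ^+ q.+1.
Definition Dop s := th * s + mu * frob s.
Definition psi x := Dop (x - frob x).

Lemma mu_neq0 : mu != 0. Proof. by rewrite !expf_neq0. Qed.
Lemma w_mu : w mu = n%:R * (Q - 1) * (Q + 1).
Proof. by rewrite /mu !qvalX ?expf_neq0 // wm q1E -[q.+1%:R]natr1. Qed.
Lemma muE : mu \in carrier E. Proof. by rewrite /mu !rpredX. Qed.

Lemma phi_twist x :
  th * (m * x) + bb * frob (m * x) - frob (frob (m * x)) = m * psi x.
Proof.
have fm : frob m = m * m ^+ q.-1 by rewrite frobE -exprS prednK.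
have fX : frob (m ^+ q.-1) = (m ^+ q.-1) ^+ q by rewrite frobE.
have eX : m ^+ q.-1 * (m ^+ q.-1) ^+ q = th + bb * m ^+ q.-1 by rewrite -exprS em.
rewrite /psi /Dop rmorphB !rmorphM /= fm rmorphM /= fm fX /mu exprS.
move: eX; move: (m ^+ q.-1) => X; move: (X ^+ q) => P eX; ring: eX.
Qed.

(** Writing a solution of theta s + mu s^q = a as s = a / r gives the equation
    r^(q-1) (r - theta) = mu a^(q-1) for the unit r. *)
Lemma Dop_solve a : a != 0 -> vgt w 0 (mu * a ^+ q.-1) ->
  exists r, [/\ Dop (a / r) = a, r != 0, w r = 0 & a \in carrier E -> r \in carrier E].
Proof.
move=> a0 small; have nu0 : mu * a ^+ q.-1 != 0 by rewrite mulf_neq0 ?mu_neq0 ?expf_neq0.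
have [r [er r0 wr _ rE]] := unit_root_q1 th0 w_th nu0 small.
exists r; split=> //; last by move=> aE; rewrite rE // rpredM ?muE ?rpredX.
have aq : a ^+ q = a * a ^+ q.-1 by rewrite -exprS prednK.
have rq : r ^+ q = r * r ^+ q.-1 by rewrite -exprS prednK.
rewrite /Dop frobE expr_div_n aq rq.
rewrite [mu * _](_ : _ = a * (mu * a ^+ q.-1) / (r * r ^+ q.-1)); last by rewrite !mulrA [mu * a]mulrC.
rewrite -er; have := expf_neq0 q.-1 r0; move: (r ^+ q.-1) => P P0; field.
by rewrite P0 r0.
Qed.

Lemma artin_schreier s : exists x : L, x - frob x = s.
Proof.
have [x] := artin_root sepL (-1) (- s).
rewrite oppr_eq0 oner_neq0 => /(_ isT) e; exists x.
by rewrite frobE -[s]opprK -e; ring.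
Qed.

(** Division by psi inside the integral elements of E: after inverting Dop, the
    remaining Artin-Schreier equation is unramified and solvable in E. *)
Lemma psi_step_int z : z \in carrier E -> vge w 0 z -> z != 0 ->
  exists z', [/\ z' \in carrier E, vge w 0 z', z' != 0 & psi z' = z].
Proof.
move=> zE z_int z0; have small : vgt w 0 (mu * z ^+ q.-1).
  rewrite mulrC -[0]addr0; apply: vgtM; first exact: vintX.
  by rewrite vgtE ?mu_neq0 // w_mu !mulr_gt0 ?ltr0n ?Qm_gt0 ?Qp_gt0.
have [r [er r0 wr rE]] := Dop_solve z0 small.
have sE : z / r \in carrier E by rewrite rpred_div ?rE.
have s_int : vge w 0 (z / r) by rewrite -[0]addr0 vgeM // vgeE ?invr_eq0 // qvalV // wr oppr0.
have [x ex] := artin_schreier (z / r).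
have ex' : x ^+ q + (-1) * x = - (z / r) by rewrite -ex frobE; ring.
have m1_0 : -1 != 0 :> L by rewrite oppr_eq0 oner_neq0.
have wm1 : w (-1) = 0 by rewrite qvalN qval1.
exists x; split.
- by apply: (E_artin _ _ _ _ _ ex'); rewrite ?rpredN ?rpred1 ?vgeN.
- by apply: (artin_vint _ _ ex'); rewrite ?vgeN // vint1.
- by apply: contraNneq z0 => x0; rewrite -er -ex x0 rmorph0 subrr /Dop rmorph0 !mulr0 addr0.
by rewrite /psi ex.
Qed.

Lemma artin_schreier_val s x : s != 0 -> w s < 0 -> x - frob x = s -> x != 0 /\ w x * Q = w s.
Proof.
move=> s0 ws ex; have x0 : x != 0.
  by apply: contraNneq s0 => x0; rewrite -ex x0 rmorph0 subrr.
split=> //; have wx : w x < 0.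
  rewrite ltNge; apply/negP => wx; have : vge w 0 s.
    by rewrite -ex frobE vgeB ?vintX // vgeE.
  by rewrite vgeE // leNgt ws.
have dom : vgt w (w (- x ^+ q)) x.
  rewrite qvalN qvalX // vgtE // -[ltRHS]mulr1; by rewrite ltr_nM2l // ltr1n q_gt1.
have [|_] := qval_dom _ dom; first by rewrite oppr_eq0 expf_neq0.
by rewrite qvalN qvalX // addrC -(frobE iota) ex => ->.
Qed.

(** For negative values the Artin-Schreier equation is ramified and divides the
    value by q.  The lower bound ensures that Dop is invertible at u. *)
Lemma psi_step_neg u : u != 0 -> w u < 0 -> - (n%:R * (Q + 1)) < w u ->
  exists u', [/\ u' != 0, w u' * Q = w u & psi u' = u].
Proof.
move=> u0 wu_neg wu_gt; have small : vgt w 0 (mu * u ^+ q.-1).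
  have u0' : u ^+ q.-1 != 0 by rewrite expf_neq0.
  rewrite vgtE ?mulf_neq0 ?mu_neq0 // qvalM ?mu_neq0 // w_mu qvalX // q1E.
  have -> : n%:R * (Q - 1) * (Q + 1) + w u * (Q - 1) = (Q - 1) * (n%:R * (Q + 1) + w u) by ring.
  rewrite mulr_gt0 ?Qm_gt0 //; lra.
have [r [er r0 wr _]] := Dop_solve u0 small.
have s0 : u / r != 0 by rewrite mulf_neq0 ?invr_eq0.
have ws : w (u / r) = w u by rewrite qval_div // wr subr0.
have [x ex] := artin_schreier (u / r).
have [|x0 wx] := artin_schreier_val s0 _ ex; first by rewrite ws.
by exists x; split; rewrite // ?wx // /psi ex.
Qed.

(** The kernel of psi is larger than F: take x - x^q = s for a nonzero s killed
    by Dop, i.e. s^(q-1) = - theta / mu. *)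
Lemma exists_u0 : exists u, [/\ u != 0, w u * Q = - (n%:R * (Q + 1)), u - frob u != 0 & psi u = 0].
Proof.
have q1 : (0 < q.-1)%N by rewrite -subn1 subn_gt0 q_gt1.
have tm0 : - (th / mu) != 0 by rewrite oppr_eq0 mulf_neq0 ?invr_eq0 ?mu_neq0.
have [||s /rootP] := sepL.2 ('X^(q.-1) - (- (th / mu))%:P).
- exact: (radical_separable iota).
- by rewrite size_XnsubC // ltnS.
rewrite !hornerE => /eqP; rewrite addrC addr_eq0 => /eqP/oppr_inj/esym es.
have s0 : s != 0 by apply: contraNneq tm0 => s0; rewrite -es s0 expr0n gtn_eqF.
have ws : w s = - (n%:R * (Q + 1)).
  have := congr1 w es; rewrite qvalX // qvalN qval_div ?mu_neq0 // w_th w_mu q1E sub0r => e.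
  have Q10 : Q - 1 != 0 by rewrite gt_eqF ?Qm_gt0.
  by apply: (mulIf Q10); rewrite e; ring.
have [x ex] := artin_schreier s.
have [|x0 wx] := artin_schreier_val s0 _ ex.
  by rewrite ws oppr_lt0 mulr_gt0 ?ltr0n ?Qp_gt0.
exists x; rewrite wx ws ex; split=> //.
rewrite /psi ex /Dop frobE -(prednK q_gt0) exprS es; field.
exact: mu_neq0.
Qed.

Lemma exists_zs : exists zs : nat -> L, [/\ zs 0%N = 1,
  forall k, zs k \in carrier E, forall k, vge w 0 (zs k) & forall k, psi (zs k.+1) = zs k].
Proof.
have [||z [z0 zP]] := @dependent_choice L
  (fun z => [/\ z \in carrier E, vge w 0 z & z != 0]) (fun z z' => psi z' = z) _ 1.
- move=> z [zE z_int nz]; have [z' [? ? ? ?]] := psi_step_int zE z_int nz.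
  by exists z'.
- by rewrite rpred1 vint1 oner_neq0.
by exists z; split=> // k; have [[? ? ?] ?] := zP k.
Qed.

Lemma exists_us : exists us : nat -> L, [/\ us 0%N - frob (us 0%N) != 0, psi (us 0%N) = 0,
  forall k, us k != 0, forall k, w (us k) * Q ^+ k.+1 = - (n%:R * (Q + 1))
  & forall k, psi (us k.+1) = us k].
Proof.
have [u0 [nz wu0 du0 psiu0]] := exists_u0.
have np : 0 < n%:R * (Q + 1) by rewrite mulr_gt0 ?ltr0n ?Qp_gt0.
have Q1 : 1 < Q by apply: lt_le_trans Q2; rewrite ltr1n.
have Q0 : 0 < Q by apply: lt_trans Q1.
have [||u [u00 uP]] := @dependent_choice L
  (fun u => [/\ u != 0, w u < 0 & - (n%:R * (Q + 1)) < w u])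
  (fun u u' => psi u' = u /\ w u' * Q = w u) _ u0.
- move=> u [nzu wu_neg wu_gt]; have [u' [nzu' wu' psiu']] := psi_step_neg nzu wu_neg wu_gt.
  have wu'_neg : w u' < 0 by rewrite -(pmulr_llt0 _ Q0) wu'.
  exists u'; split=> //; split=> //; apply: lt_trans wu_gt _.
  by rewrite -wu' -[ltRHS]mulr1 ltr_nM2l.
- have wu_neg : w u0 < 0 by rewrite -(pmulr_llt0 _ Q0) wu0 oppr_lt0.
  by split=> //; rewrite -wu0 -[ltRHS]mulr1 ltr_nM2l.
exists u; rewrite u00; split=> // k; try by have [[? ? ?] []] := uP k.
elim: k => [|k IH]; first by rewrite expr1 u00.
by have [_ [_ e]] := uP k; rewrite exprS mulrA e.
Qed.

End Twist.

Lemma phiS_coef X k : fps_coef (phiS iota b X) k =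
  th * fps_coef X k + bb * frob (fps_coef X k) - frob (frob (fps_coef X k)).
Proof. by rewrite fps_coefB fps_coefD !fps_coefCM. Qed.

(** The index shift puts the t-torsion point m z_0 in degree 1. *)
Definition mser (m : L) (z : nat -> L) : fps L := Fps (fun k => if k is k'.+1 then m * z k' else 0).

Lemma mser_tate m z : m != 0 -> th + bb * m ^+ q.-1 = (m ^+ q.-1) ^+ q.+1 ->
  psi m (z 0%N) = 0 -> (forall k, psi m (z k.+1) = z k) -> tateS (mser m z).
Proof.
move=> m0 em z0 zS; split=> //; apply: fpsP => -[|[|k]]; rewrite phiS_coef ?fps_coefTM0 ?fps_coefTM /=.
- by rewrite !rmorph0 !mulr0 addr0 subr0.
- by rewrite phi_twist // z0 mulr0.
by rewrite phi_twist // zS.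
Qed.

Lemma tateS_coef_zero X k l : tateS X -> (l <= k)%N -> fps_coef X k = 0 -> fps_coef X l = 0.
Proof.
move=> [_ eX] /subnK <-; elim: (k - l)%N => // i IH; rewrite addSn => X0; apply: IH.
by rewrite -fps_coefTM -eX phiS_coef X0 !rmorph0 !mulr0 addr0 subr0.
Qed.

(** The components are roots of the polynomials x^q + theta x - s, which are
    separable modulo the place since theta is a unit there. *)
Lemma carlitz_unramified U : frobS U = (fpsT L - fpsC th) * U ->
  forall k, fps_coef U k \in carrier E /\ vge w 0 (fps_coef U k).
Proof.
move=> eU; have base s x : s \in carrier E -> vge w 0 s -> x ^+ q + th * x = s ->
    x \in carrier E /\ vge w 0 x.
  move=> sE s0 ex; split; first exact: (E_artin thE sE th0 w_th s0 ex).
  exact: (artin_vint th_int s0 ex).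
elim=> [|k [IHE IHv]]; last exact: (base _ _ IHE IHv (carlitz_coefS _ eU)).
apply: (base 0); rewrite ?rpred0 ?vge0 // (carlitz_coef0 eU); ring.
Qed.

(** Elements of Gal(L/E) fix X, whose components lie in E, and the Wronskian, so
    they map Y to Y + a X.  The component Y_(k+1) = m u_k has value
    n - n(q+1)/q^(k+1), with n(q+1) prime to q, hence degree at least q^(k+1)
    over E; this is the number of the possible images a X + Y in degree k+1. *)
Theorem local_transvections : exists X Y, [/\ tateS X, tateS Y,
    fps_coef X 1 * frob (fps_coef Y 1) - frob (fps_coef X 1) * fps_coef Y 1 != 0
  & forall a, exists s : Gal iota, galS s X = X /\ galS s Y = Y + embS a * X].
Proof.
have [m [mE m0 wm em]] := exists_m1.
have [z [z0 zE z_int zS]] := exists_zs mE m0 wm.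
have [u [du0 psiu0 nzu wu uS]] := exists_us mE m0 wm.
pose X := mser m z; pose Y := mser m u.
have TX : tateS X.
  by apply: mser_tate => //; rewrite z0 /psi rmorph1 subrr /Dop rmorph0 !mulr0 addr0.
have TY : tateS Y by apply: mser_tate.
have indep : fps_coef X 1 * frob (fps_coef Y 1) - frob (fps_coef X 1) * fps_coef Y 1 != 0.
  rewrite /= z0 mulr1 rmorphM /=.
  have -> : m * (frob m * frob (u 0%N)) - frob m * (m * u 0%N) = - (m * frob m * (u 0%N - frob (u 0%N))) by ring.
  by rewrite oppr_eq0 !mulf_neq0 // frobE expf_neq0.
exists X, Y; split=> // a.
have XE k : fps_coef X k \in carrier E by case: k => [|k]; rewrite /= ?rpred0 ?rpredM.
pose j : {rmorphism ifield E -> L} := val.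
have fixE (s : Gal iota) : (forall e, s (j e) = j e) -> forall x, x \in carrier E -> s x = x.
  by move=> sj x xE; apply: (sj (@IField _ _ _ E x xE)).
have galX (s : Gal iota) : (forall e, s (j e) = j e) -> galS s X = X.
  by move=> sj; apply: fpsP => k; apply: (fixE s sj).
have [U eW _] := wronskian_coef0 iota TX.1 TY.1.
have eU : frobS U = (fpsT L - fpsC th) * U.
  apply: (@fps_mulT_inj L 2); have := frobS_wronskian TX TY.
  by rewrite eW rmorphM rmorphXn /= frobST mulrCA.
have galW (s : Gal iota) : (forall e, s (j e) = j e) -> galS s (wronskian iota X Y) = wronskian iota X Y.
  move=> sj; rewrite eW rmorphM rmorphXn /= galS_T; congr (_ * _); apply: fpsP => k.
  exact: (fixE s sj _ (carlitz_unramified eU k).1).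
have galY (s : Gal iota) : (forall e, s (j e) = j e) -> exists a', galS s Y = Y + embS a' * X.
  move=> sj; have [a' [c eY]] := tateS_basis TX TY indep (galS_tate s TY).
  exists a'; have := galW s sj; rewrite galS_wronskian galX // eY => e.
  suff -> : c = 1 by rewrite rmorph1 mul1r addrC.
  apply: (@embS_inj F L iota); rewrite rmorph1; apply: (wronskian_cancel TX TY indep).
  rewrite mul1r -[RHS]e /wronskian rmorphD !rmorphM /= !frobS_emb; ring.
pose z1 (i : bool) := if i then fps_coef X else fps_coef Y.
pose z2 (i : bool) := if i then fps_coef X else fps_coef (Y + embS a * X).
suff [s sP] : exists s : Gal iota, forall i k, s (z1 i k) = z2 i k.
  exists s; split; apply: fpsP => k; first exact: (sP true).
  exact: (sP false).
apply: (gal_compact sepL) => k.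
pose N := (q ^ k.+1)%N.
pose g (f : {ffun 'I_k.+1 -> F}) := fps_coef Y k.+1 + \sum_(i < k.+1) scalar (f i) * fps_coef X (k.+1 - i).
pose S := [seq g f | f <- enum {ffun 'I_k.+1 -> F}].
have memS a' : fps_coef (Y + embS a' * X) k.+1 \in S.
  apply/mapP; exists [ffun i : 'I_k.+1 => fps_coef a' i]; first by rewrite mem_enum.
  rewrite fps_coefD fps_coefM big_ord_recr /= subnn mulr0 addr0; congr (_ + _).
  by apply: eq_bigr => i _; rewrite ffunE.
have [|||||s sj es] := @gal_orbit_all _ _ iota sepL _ j _ N (fps_coef Y k.+1) S (fps_coef (Y + embS a * X) k.+1).
- by move=> c; exists (ibase E c).
- apply: (@deg_bound L w) => [e e0||i t /andP[i0 iN] e].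
  + by apply: E_int; [apply: ifvalP | rewrite fmorph_eq0].
  + by rewrite /= mulf_neq0.
  have : w (u k) * i%:R = (t - (n * i)%N%:Z)%:~R.
    move: e; rewrite /= qvalM // wm rmorphB /= => <-.
    by rewrite -[((n * i)%N%:Z)%:~R]/((n * i)%N%:R) natrM; ring.
  move: (t - _) => t' {}e.
  have eN : (n * q.+1 * i)%N%:Z = - t' * N%:Z.
    have h : (n * q.+1 * i)%N%:R = (- t' * N%:Z)%:~R :> rat.
      rewrite [RHS]rmorphM rmorphN /= -e -[(N%:Z)%:~R]/(N%:R) /N natrX -/Q.
      by rewrite mulNr mulrAC wu !natrM -[q.+1%:R]natr1 -/Q mulNr opprK.
    by apply/eqP; rewrite -(eqr_int rat) -h.
  have dvd : (N %| n * q.+1 * i)%N.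
    by have : (N%:Z %| (n * q.+1 * i)%N%:Z)%Z by rewrite eN dvdz_mull.
  have co : coprime N (n * q.+1) by rewrite coprimeXl // coprimeMr co_qn coprimenS.
  by move: dvd; rewrite Gauss_dvdr // => /dvdn_leq; rewrite i0 leqNgt iN => /(_ isT).
- by rewrite size_map -cardE card_ffun card_ord.
- move=> s sj; have [a' ea'] := galY s sj.
  have <- : fps_coef (galS s Y) k.+1 = s (fps_coef Y k.+1) by [].
  by rewrite ea'.
- exact: memS.
exists s => -[] l le_lk; first exact: (fixE s sj _ (XE l)).
have [a' ea'] := galY s sj.
have esl i : s (fps_coef Y i) = fps_coef (Y + embS a' * X) i by rewrite -ea'.
have zero : fps_coef (embS (a' - a) * X) k.+1 = 0.
  have : fps_coef (Y + embS a' * X) k.+1 - fps_coef (Y + embS a * X) k.+1 = 0.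
    by rewrite -esl es subrr.
  by rewrite -fps_coefB => <-; congr (fps_coef _ _); rewrite rmorphB; ring.
have /eqP := tateS_coef_zero (tateSZ (a' - a) TX) (leqW le_lk) zero.
rewrite rmorphB mulrBl fps_coefB subr_eq0 => /eqP e.
by rewrite -[LHS]/(s (fps_coef Y l)) esl !fps_coefD e.
Qed.

End LocalTate.

(** * The hypotheses on b, and bases of the Tate module *)
Lemma scale_qvaluation (L : fieldType) (w : qvaluation L) (c : rat) : 0 <= c ->
  exists w' : qvaluation L, forall x, w' x = c * w x.
Proof.
move=> c0; have wM x y : x != 0 -> y != 0 -> c * w (x * y) = c * w x + c * w y.
  by move=> x0 y0; rewrite qvalM // mulrDr.
have wD x y : x != 0 -> y != 0 -> x + y != 0 -> Num.min (c * w x) (c * w y) <= c * w (x + y).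
  move=> x0 y0 xy0; apply: le_trans (ler_wpM2l c0 (qvalD w x0 y0 xy0)).
  by rewrite minr_pMr.
by exists (QValuation wM wD).
Qed.

Section PrimeIdeals.
Variable F : finFieldType.
Implicit Types (I : prime_idealr {poly F}) (p : {poly F}).

Lemma prime_ideal_principal I : (exists2 p, p \in I & p != 0) ->
  exists2 ell, irreducible_poly ell & forall p, (p \in I) = (ell %| p).
Proof.
case=> p0 p0I nzp0.
have ex_n : exists n, `[< exists p, [/\ p \in I, p != 0 & size p = n] >].
  by exists (size p0); apply/asboolP; exists p0.
case: (ex_minnP ex_n) => n /asboolP[g [gI g0 sz_g]] min_n.
have memI p : (p \in I) = (g %| p).
  apply/idP/idP => [pI|/dvdpP[r ->]]; last exact: idealMr.
  rewrite /dvdp; apply: contraT => nz.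
  have : (size (p %% g)%R < n)%N by rewrite -sz_g ltn_modp.
  rewrite ltnNge min_n //; apply/asboolP; exists (p %% g); split=> //.
  have -> : p %% g = p - p %/ g * g by rewrite {2}(divp_eq p g) addrC addKr.
  by rewrite rpredB // idealMr.
exists g => //; split=> [|r sz_r r_g].
  rewrite ltnNge; apply/negP => sz1; move: (idealr1 I); rewrite memI dvdp1.
  by move: g0 sz1; rewrite -size_poly_gt0; case: (size g) => [|[]].
have [t def_g] := dvdpP _ _ r_g.
have t0 : t != 0 by apply: contraNneq g0 => t0; rewrite def_g t0 mul0r.
have r0 : r != 0 by apply: contraNneq g0 => r0; rewrite def_g r0 mulr0.
have : t * r \in I by rewrite -def_g.
rewrite prime_idealrM !memI => /orP[gt|gr]; last by rewrite /eqp r_g gr.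
have := dvdp_leq t0 gt; rewrite {1}def_g size_mul //.
move: sz_r r0 t0; rewrite -!size_poly_gt0.
by case: (size r) (size t) => [|[|i]] // [|j] // _ _ _; rewrite addSn !addnS ltnNge leq_addr.
Qed.

Variables (I : prime_idealr {poly F}) (ell : {poly F}).
Hypothesis memI : forall p, (p \in I) = (ell %| p).

Lemma ideal_powE n p : ideal_pow I n p <-> ell ^+ n %| p.
Proof.
split=> [[m [a [u [uI ->]]]]|/dvdpP[r ->]].
  apply: (big_ind (fun p => ell ^+ n %| p)) => [|x y|i _]; rewrite ?dvdp0 //.
    exact: dvdp_add.
  apply: dvdp_mull; rewrite -[n in ell ^+ n]card_ord -prodr_const.
  elim/big_rec2: _ => // j x y _ xy; apply: dvdp_mul => //.
  by rewrite -memI.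
exists 1%N, (fun=> r), (fun _ _ => ell); split=> [i j|]; first by rewrite memI.
by rewrite big_ord1 prodr_const card_ord.
Qed.

Lemma ideal_ordE p n : ideal_ord I p n -> exists2 p1, p = ell ^+ n * p1 & ~~ (ell %| p1).
Proof.
case=> /ideal_powE/dvdpP[p1 ->] nd; exists p1; first exact: mulrC.
by apply/negP => h; apply: nd; apply/ideal_powE; rewrite exprS dvdp_mul.
Qed.

Variables (L : fieldType) (iota : {rmorphism ratfun F -> L}) (w : qvaluation L).
Hypotheses (irr_ell : irreducible_poly ell) (w_ell : w (rpol iota ell) = 1).
Hypothesis w_unit : forall p, ~~ (ell %| p) -> w (rpol iota p) = 0.

Lemma valuationE b v : valuation I b v -> iota b != 0 /\ w (iota b) = v%:~R.
Proof.
move=> [n [d [m [k [d0 -> /ideal_ordE[n1 en un] /ideal_ordE[d1 ed ud] ->]]]]].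
have ell0 : ell != 0 by rewrite -size_poly_gt0; case: irr_ell => /ltnW.
have n0 : n != 0.
  by rewrite en mulf_neq0 ?expf_neq0 //; apply: contraNneq un => ->; rewrite dvdp0.
rewrite fmorph_div -![iota (tofrac _)]/(rpol iota _).
split; first by rewrite mulf_neq0 ?invr_eq0 ?rpol_eq0.
rewrite qval_div ?rpol_eq0 // en ed !(place_val_poly irr_ell w_ell w_unit) // rmorphB /=.
by rewrite -!pmulrn.
Qed.

End PrimeIdeals.

Section Final.
Variables (F : finFieldType) (L : fieldType) (iota : {rmorphism ratfun F -> L}).
Hypothesis sepL : separable_closure iota.
Variable b : ratfun F.
Local Notation q := #|F|.
Local Notation scalar := (scalar iota).
Local Notation frob := (frob iota).
Local Notation embS := (embS iota).
Local Notation tateS := (tateS iota b).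
Local Notation phi := (phi2 b).
Local Notation ser e := (fun i : 'I_2 => Fps (e i)).

(** The valuation at ell is multiplied by q-1 so that a (q-1)-st root of ell gets
    value 1.  The hypothesis on the ideal says that ell does not divide X, i.e.
    that theta is a unit at ell. *)
Lemma exists_local_transvections (I : prime_idealr {poly F}) v :
    (exists2 p : {poly F}, p \in I & p != 0) ->
    ~ (forall p : {poly F}, (p \in I) = ('X %| p)) ->
    valuation I b v -> v < 0 -> coprime q `|v|%N ->
  exists X Y, [/\ tateS X, tateS Y,
    fps_coef X 1 * frob (fps_coef Y 1) - frob (fps_coef X 1) * fps_coef Y 1 != 0
  & forall a, exists s : Gal iota, galS s X = X /\ galS s Y = Y + embS a * X].
Proof.
move=> nzI I_nX vb v_neg co; have [ell irr_ell memI] := prime_ideal_principal nzI.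
have ell_nX : ~~ (ell %| 'X).
  apply/negP => ellX; apply: I_nX => p; rewrite memI; apply: eqp_dvdl.
  have irrX : irreducible_poly ('X : {poly F}) by rewrite -['X]subr0; apply: irredp_XsubC.
  by apply: (apply_irredp irrX) ellX; case: irr_ell => /gtn_eqF ->.
have [w0 [w_ell w_unit]] := place_valuation sepL irr_ell.
have [bb0 wb] := valuationE memI irr_ell w_ell w_unit vb.
have q1 : (0 < q.-1)%N by rewrite -subn1 subn_gt0 q_gt1.
have ell0 : rpol iota ell != 0 by rewrite rpol_eq0 -size_poly_gt0; case: irr_ell => /ltnW.
have [vpi vpiX] : exists vpi, vpi ^+ q.-1 = rpol iota ell.
  have [||x /rootP] := sepL.2 ('X^(q.-1) - (rpol iota ell)%:P).
  - exact: (radical_separable iota).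
  - by rewrite size_XnsubC // ltnS.
  by rewrite !hornerE => /eqP; rewrite subr_eq0 => /eqP ex; exists x.
have vpi0 : vpi != 0 by apply: contraNneq ell0 => e; rewrite -vpiX e expr0n gtn_eqF.
have [w wE] := scale_qvaluation w0 (ler0n rat q.-1).
have w_vpi : w vpi = 1 by have := congr1 w0 vpiX; rewrite qvalX // w_ell wE mulrC.
have w_u p : ~~ (ell %| p) -> w (rpol iota p) = 0 by move=> nd; rewrite wE w_unit // mulr0.
have w_th : w (th iota) = 0 by apply: (w_u 'X).
pose E := Eloc sepL irr_ell ell_nX vpiX w_vpi w_u.
have n_gt0 : (0 < `|v|)%N by rewrite absz_gt0 lt_eqF.
apply: (@local_transvections F L iota sepL b w vpi E `|v|%N) => //.
- exact: vpi_Ehat.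
- exact: (Ehat_int irr_ell vpiX w_vpi w_u).
- exact: (Ehat_near irr_ell vpiX w_vpi w_u).
- exact: (Ehat_artin sepL irr_ell vpiX w_vpi w_u).
- exact: (Ehat_radical sepL irr_ell vpiX w_vpi w_u).
rewrite wE wb natrM mulrC -mulNr; congr (_ * _).
by rewrite [`|v|%N%:R]pmulrn abszE ltr0_norm // rmorphN opprK.
Qed.

Lemma torsion_lift x : exists x', dact iota phi 'X x' = x.
Proof.
pose f : {poly L} := - 'X^(q * q) + bb iota b *: 'X^q + th iota *: 'X - x%:P.
have q0 : q%:R = 0 :> L := finField_card_eq0 scalar.
have f' : f^`() = (th iota)%:P.
  have dX m : m%:R = 0 :> L -> ('X^m : {poly L})^`() = 0.
    by move=> m0; rewrite derivXn -mulr_natr -polyC_natr m0 mulr0.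
  rewrite /f derivB !derivD derivN !derivZ !dX ?natrM ?q0 ?mulr0 // derivX derivC.
  by rewrite scaler0 !oppr0 !add0r addr0 alg_polyC.
have sep_f : separable_poly f.
  by apply: (@separable_bezout _ _ 0 1 (th iota)); rewrite ?th_neq0 // f' mul0r mul1r add0r.
have [|x' /rootP] := sepL.2 f sep_f.
  rewrite ltnNge; apply/negP => /size1_polyC ef.
  have := f'; rewrite ef derivC => /esym/eqP; rewrite polyC_eq0.
  by rewrite (negPf (th_neq0 iota)).
rewrite /f !hornerE => e; exists x'; rewrite dact_t !frobE -exprM.
by apply/eqP; rewrite -subr_eq0 -[X in _ == X]e; apply/eqP; ring.
Qed.

(** Torsion points extend to Tate sequences by successive division by t. *)
Lemma torsion_tate k x : torsion iota phi k x -> exists2 z, tate iota phi z & z k = x.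
Proof.
elim: k x => [|k IH] x.
  rewrite /torsion expr0 dact1 => ->; exists (fun=> 0) => //.
  by split=> k; rewrite /torsion /dact tact0r.
rewrite /torsion exprSr dactM => /IH[z Tz zk].
have [z' [z'0 z'P]] := @dependent_choice L (fun=> True) (fun y y' => dact iota phi 'X y' = y)
   (fun y _ => let: ex_intro y' ey' := torsion_lift y in ex_intro _ y' (conj I ey')) x I.
pose t n := if (n <= k)%N then z n else z' (n - k.+1)%N.
exists t; last by rewrite /t ltnn subnn.
have z0 : z 0%N = 0 by case/tateSP: Tz.
have tS n : dact iota phi 'X (t n.+1) = t n.
  rewrite /t; case: (ltngtP n k) => [lt|gt|->].
  - by case: Tz => _ ->.
  - by rewrite subSn // (z'P _).2.
  by rewrite subnn z'0 -zk.
split=> //; elim=> [|n IHn]; first by rewrite /t /torsion expr0 dact1.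
by rewrite /torsion exprSr dactM tS.
Qed.

Lemma tate_basisS e : tate_basis iota phi e -> basisS iota b (ser e).
Proof.
case=> Te bas_e; have combE v k : fps_coef (comb iota (ser e) v) k
    = \sum_i tate_scale iota phi (v i 0) (e i) k.
  by rewrite fps_coef_sum; apply: eq_bigr => i _; rewrite tate_scaleE.
split=> [i|X]; first exact/tateSP.
have -> : X = Fps (fps_coef X) by case: X.
move=> /tateSP/bas_e[v [vP v_uniq]]; exists v; split.
  by apply: fpsP => k; rewrite combE -vP.
by move=> u eu; apply: v_uniq => k; rewrite -combE -eu.
Qed.

Lemma basisS_tate (e : 'I_2 -> fps L) : basisS iota b e ->
  tate_basis iota phi (fun i => fps_coef (e i)).
Proof.
case=> Te bas_e; have eE i : e i = Fps (fps_coef (e i)) by case: (e i).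
have Te' i : tate iota phi (fps_coef (e i)) by apply/tateSP; rewrite -eE.
have combE v k : fps_coef (comb iota e v) k
    = \sum_i tate_scale iota phi (v i 0) (fps_coef (e i)) k.
  by rewrite fps_coef_sum; apply: eq_bigr => i _; rewrite tate_scaleE // -eE.
split=> // x /tateSP/bas_e[v [vP v_uniq]]; exists v; split=> [k|u uP].
  by rewrite -combE -vP.
by apply: v_uniq; apply: fpsP => k; rewrite combE -uP.
Qed.

Lemma tadic_matrixE e (s : Gal iota) A : tate_basis iota phi e ->
  tadic_matrix phi e s A <-> acts (ser e) s A.
Proof.
case=> Te _; have sumE j k : fps_coef (\sum_i embS (A i j) * Fps (e i)) k
    = \sum_i tate_scale iota phi (A i j) (e i) k.
  by rewrite fps_coef_sum; apply: eq_bigr => i _; rewrite tate_scaleE.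
split=> [h j|h j k]; first by apply: fpsP => k; rewrite sumE -h.
by rewrite -sumE -h.
Qed.

(** SL_2(F) fixes no line: one of the two elementary matrices moves the
    coordinate vector v of x.  The determinant in the conclusion vanishes exactly
    when s x is an F-multiple of x. *)
Lemma mod_t_moves x : mod_t_image_contains_SL2 iota phi -> torsion iota phi 1 x -> x != 0 ->
  exists s : Gal iota, x * frob (s x) - frob x * s x != 0.
Proof.
case=> u [tor_u bas_u] SL tor_x x0; have [v [ex v_uniq]] := bas_u x tor_x.
have {}ex : x = scalar (v 0 0) * ifval (u 0) + scalar (v 1 0) * ifval (u 1) by rewrite ex sum_ord2.
have [A detA moves] : exists2 A : 'M[F]_2, \det A = 1
    & v 0 0 * (A *m v) 1 0 - v 1 0 * (A *m v) 0 0 != 0.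
  have [v10|v1] := eqVneq (v 1 0) 0; last first.
    exists (mx2 1 1 0 1); first by rewrite det_mx2; ring.
    rewrite !mxE !sum_ord2 !mxE /=.
    have -> : v 0 0 * (0 * v 0 0 + 1 * v 1 0) - v 1 0 * (1 * v 0 0 + 1 * v 1 0) = - (v 1 0 * v 1 0) by ring.
    by rewrite oppr_eq0 mulf_neq0.
  exists (mx2 1 0 1 1); first by rewrite det_mx2; ring.
  rewrite !mxE !sum_ord2 !mxE /= v10.
  have -> : v 0 0 * (1 * v 0 0 + 1 * 0) - 0 * (1 * v 0 0 + 0 * 0) = v 0 0 * v 0 0 by ring.
  rewrite mulf_neq0 //; apply: contraNneq x0 => v00.
    by rewrite ex v00 v10 rmorph0 !mul0r addr0.
  by rewrite ex v00 v10 rmorph0 !mul0r addr0.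
have [s1 s1A] := SL A detA.
pose G (y z : L) := exists t : ifield (torsion_field iota phi 1), y = ifval t /\ z = ifval (s1 t).
have pG : pembedding iota G.
  split.
  - by move=> a; exists (ibase _ a); rewrite gal_fix.
  - by move=> _ _ _ _ [t [-> ->]] [t' [-> ->]]; exists (t - t'); rewrite rmorphB.
  - by move=> _ _ _ _ [t [-> ->]] [t' [-> ->]]; exists (t * t'); rewrite rmorphM.
  - by move=> _ _ [t [-> ->]]; exists t^-1; rewrite fmorphV.
  by move=> z [t [/esym t0 ->]]; have -> : t = 0 by [apply: val_inj]; rewrite rmorph0.
have [s sP] := gal_extend sepL pG; exists s.
have su i : s (ifval (u i)) = ifval (s1 (u i)) by apply: sP; exists (u i).
have esx : s x = scalar ((A *m v) 0 0) * ifval (u 0) + scalar ((A *m v) 1 0) * ifval (u 1).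
  have val_s1 i : ifval (s1 (u i)) = scalar (A 0 i) * ifval (u 0) + scalar (A 1 i) * ifval (u 1).
    by rewrite s1A sum_ord2.
  have fix_scalar a : s (scalar a) = scalar a by apply: gal_fix.
  rewrite ex rmorphD !rmorphM /= !fix_scalar !su !val_s1 !mxE !sum_ord2 !rmorphD !rmorphM /=; ring.
apply: contraNneq moves => /eqP; rewrite subr_eq0 => /eqP e.
have [c ec] : exists c, s x = scalar c * x.
  have [|c ec] := @frob_fixed F L iota (s x / x).
    rewrite fmorph_div; apply: (mulIf (_ : x * frob x != 0)).
      by rewrite mulf_neq0 // fmorph_eq0.
    have fx0 : frob x != 0 by rewrite fmorph_eq0.
    rewrite [LHS](_ : _ = x * frob (s x)); last by field.
    by rewrite e; field.
  by exists c; rewrite -ec divfK.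
have tor_sx : torsion iota phi 1 (s x).
  move: tor_x; rewrite ec /torsion !expr1 !dact_t => tx.
  by rewrite !rmorphM /= !frob_scalar -[RHS](mulr0 (scalar c)) -tx; ring.
have [v' [_ v'_uniq]] := bas_u _ tor_sx.
have eAv : A *m v = c *: v.
  rewrite -(v'_uniq (A *m v)) ?sum_ord2 // -(v'_uniq (c *: v)) // sum_ord2 ec ex !mxE !rmorphM /=; ring.
by rewrite eAv !mxE; apply/eqP; ring.
Qed.

End Final.

(** * Surjectivity of the t-adic representation *)
Section Surjectivity.
Variables (F : finFieldType) (L : fieldType) (iota : {rmorphism ratfun F -> L}).
Hypothesis sepL : separable_closure iota.
Variable b : ratfun F.
Local Notation scalar := (scalar iota).
Local Notation frob := (frob iota).
Local Notation frobS := (frobS iota).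
Local Notation embS := (embS iota).
Local Notation tateS := (tateS iota b).
Local Notation phi := (phi2 b).
Local Notation ser e := (fun i : 'I_2 => Fps (e i)).

Definition pair_of (X Y : fps L) (i : 'I_2) := if i == 0 then X else Y.

Lemma cV2P (R : Type) (v : 'cV[R]_2) : v = \col_i (if i == 0 then v 0 0 else v 1 0).
Proof.
by apply/matrixP => -[[|[|//]] ?] [[|//] ?]; rewrite mxE /=; congr (v _ _); apply: val_inj.
Qed.

Lemma pair_basisS X Y : tateS X -> tateS Y ->
    fps_coef X 1 * frob (fps_coef Y 1) - frob (fps_coef X 1) * fps_coef Y 1 != 0 ->
  basisS iota b (pair_of X Y).
Proof.
move=> TX TY indep; split=> [i|Z TZ]; first by rewrite /pair_of; case: (i == 0).
have [a [c eZ]] := tateS_basis TX TY indep TZ.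
have combE v : comb iota (pair_of X Y) v = embS (v 0 0) * X + embS (v 1 0) * Y.
  by rewrite /comb sum_ord2.
exists (\col_i (if i == 0 then a else c)); split; first by rewrite combE !mxE.
move=> v; rewrite combE eZ => /(tateS_free TX TY indep)[-> ->].
by rewrite -cV2P.
Qed.

Lemma fps_unitD (a c : fps F) : a + c \is a GRing.unit ->
  a \is a GRing.unit \/ c \is a GRing.unit.
Proof.
rewrite !fps_unitE fps_coefD; have [->|] := eqVneq (fps_coef a 0) 0; last by left.
by rewrite add0r; right.
Qed.

(** The three ingredients of local_GL2_generated, for a basis whose first vector
    is fixed by the transvections. *)
Lemma acts_all X Y : tateS X -> tateS Y ->
    fps_coef X 1 * frob (fps_coef Y 1) - frob (fps_coef X 1) * fps_coef Y 1 != 0 ->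
    (forall a, exists s : Gal iota, galS s X = X /\ galS s Y = Y + embS a * X) ->
    mod_t_image_contains_SL2 iota phi ->
  forall A : 'M[fps F]_2, A \in unitmx -> exists s : Gal iota, acts (pair_of X Y) s A.
Proof.
move=> TX TY indep trans SL.
have bas := pair_basisS TX TY indep.
have x0 : fps_coef X 1 != 0.
  by apply: contraNneq indep => ->; rewrite rmorph0 !mul0r subrr.
have tor_x : torsion iota phi 1 (fps_coef X 1).
  have /tateSP[tor _] : tateS (Fps (fps_coef X)) by move: TX; case: (X).
  exact: tor.
have [s moves] := mod_t_moves sepL SL tor_x x0.
have [M sM] := acts_exists bas s.
apply: (@local_GL2_generated _ (fun A => exists s : Gal iota, acts (pair_of X Y) s A) M).
- exact: fps_unitD.
- by move=> A B [s1 s1A] [s2 s2B]; exists (s1 * s2)%g; apply: acts_mul.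
- by move=> A [s1 s1A]; have [uA s1V] := acts_inv bas s1A; split=> //; exists (s1^-1)%g.
- move=> a; have [s1 [s1X s1Y]] := trans a; exists s1 => j; rewrite sum_ord2 /pair_of !mxE /=.
  case: (j == 0); rewrite ?s1X ?s1Y rmorph1 ?rmorph0 !mul1r ?mul0r ?addr0 //.
  exact: addrC.
- by exists s.
- rewrite fps_unitE; apply: contraNneq moves => M10.
  have -> : s (fps_coef X 1) = scalar (fps_coef (M 0 0) 0) * fps_coef X 1.
    have e1 : galS s X = embS (M 0 0) * X + embS (M 1 0) * Y by have := sM 0; rewrite sum_ord2.
    rewrite -[LHS]/(fps_coef (galS s X) 1) e1.
    rewrite fps_coefD !fps_coefM !big_ord_recl !big_ord0 /= TX.1 TY.1 M10 rmorph0.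
    by rewrite !mulr0 !mul0r !addr0.
  by rewrite rmorphM /= frob_scalar; apply/eqP; ring.
(* determinants: the Wronskian is t^2 times a Carlitz Tate element U *)
move=> d; rewrite fps_unitE => d0.
have [U eW U0] := wronskian_coef0 iota TX.1 TY.1.
have eU : frobS U = (fpsT L - fpsC (th iota)) * U.
  apply: (@fps_mulT_inj L 2); have := frobS_wronskian TX TY.
  by rewrite eW rmorphM rmorphXn /= frobST mulrCA.
have [s1 s1U] : exists s : Gal iota, galS s U = embS d * U.
  by apply: (carlitz_surjective sepL eU) => //; rewrite U0.
have [A s1A] := acts_exists bas s1; exists A; first by exists s1.
apply: (@embS_inj F L iota); apply: (wronskian_cancel TX TY indep).
have := acts_det s1A; rewrite /pair_of /= => <-.
by rewrite eW rmorphM rmorphXn /= galS_T s1U mulrCA.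
Qed.

Lemma basis_change e0 e : basisS iota b e0 -> basisS iota b e ->
  exists P : 'M[fps F]_2, forall v, comb iota e v = comb iota e0 (P *m v).
Proof.
move=> bas0 bas; have colP j : exists v, e j = comb iota e0 v.
  by have [v []] := bas0.2 _ (bas.1 j); exists v.
exists (\matrix_(i, j) projT1 (cid (colP j)) i 0) => v.
rewrite comb_mul; apply: eq_bigr => j _; congr (_ * _).
by rewrite [LHS](projT2 (cid (colP j))); apply: eq_bigr => i _; rewrite mxE.
Qed.

Lemma acts_all_change e0 e : basisS iota b e0 -> basisS iota b e ->
    (forall A : 'M[fps F]_2, A \in unitmx -> exists s : Gal iota, acts e0 s A) ->
  forall A : 'M[fps F]_2, A \in unitmx -> exists s : Gal iota, acts e s A.
Proof.
move=> bas0 bas all0 A uA.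
have [P eP] := basis_change bas0 bas; have [P' eP'] := basis_change bas bas0.
have PP' : P *m P' = 1%:M.
  by apply: mul_cV_inj => v; apply: (comb_inj bas0); rewrite -mulmxA -eP -eP' mul1mx.
have P'P : P' *m P = 1%:M := mulmx1C PP'.
have [uP uP'] := mulmx1_unit PP'.
have uPAP : P *m A *m P' \in unitmx by rewrite !unitmx_mul uP uA uP'.
have [s sA] := all0 _ uPAP.
exists s; apply/actsP => v.
rewrite !eP (acts_comb (P *m v) sA); congr (comb _ _ _).
by rewrite -!mulmxA [P' *m (P *m v)]mulmxA P'P mul1mx.
Qed.

(** Automorphisms of L restrict to K_2 and those of K_2 extend to L, so that both
    groups have the same image in GL_2(F[[t]]). *)
Section Tower.
Variable e : 'I_2 -> nat -> L.
Hypothesis bas_e : tate_basis iota phi e.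
Local Notation tower := (torsion_tower iota phi).

Let basS : basisS iota b (ser e). Proof. exact: tate_basisS. Qed.

Lemma gal_dact (s : Gal iota) a x : s (dact iota phi a x) = dact iota phi a (s x).
Proof.
rewrite /dact /tact rmorph_sum; apply: eq_bigr => i _.
by rewrite rmorphM rmorphXn /= gal_fix.
Qed.

Lemma torsion_tower_mem k x : torsion iota phi k x -> x \in carrier tower.
Proof.
move=> kx; rewrite inE; apply/asboolP; exists k.+1 => //.
by rewrite inE; apply/asboolP => E; apply; apply: torsionS.
Qed.

Lemma tower_ind (E : intermediate iota) :
  (forall k x, torsion iota phi k x -> x \in carrier E) ->
  forall x, x \in carrier tower -> x \in carrier E.
Proof.
by move=> torE x; rewrite inE => /asboolP[k _]; rewrite inE => /asboolP; apply=> y /torE.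
Qed.

Lemma gal_preimage (s : Gal iota) (E : intermediate iota) :
  exists E' : intermediate iota, forall x, (x \in carrier E') = (s x \in carrier E).
Proof.
have memE x : (x \in [pred x | s x \in carrier E]) = (s x \in carrier E) by [].
have dv : divring_closed [pred x | s x \in carrier E].
  split=> [|y z|y z]; rewrite !memE ?rmorph1 ?rpred1 // => yE zE.
    by rewrite rmorphB rpredB.
  by rewrite fmorph_div rpred_div.
have bs a : iota a \in [pred x | s x \in carrier E].
  by rewrite memE gal_fix carrier_base.
by exists (Intermediate dv bs).
Qed.

Lemma gal_tower (s : Gal iota) x : x \in carrier tower -> s x \in carrier tower.
Proof.
have [E memE] := gal_preimage s tower; rewrite -memE; apply: tower_ind => k y ky.
by rewrite memE; apply: (@torsion_tower_mem k); rewrite /torsion -gal_dact ky rmorph0.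
Qed.

(** Every torsion point is a component of an F[[t]]-combination of the basis. *)
Lemma gal_tower_eq (s s' : Gal iota) : (forall j k, s (e j k) = s' (e j k)) ->
  forall x, x \in carrier tower -> s x = s' x.
Proof.
move=> ss'; have eqS j : galS s (Fps (e j)) = galS s' (Fps (e j)).
  by apply: fpsP => k; apply: ss'.
have dv : divring_closed [pred x | s x == s' x].
  split=> [|y t|y t]; rewrite !inE ?rmorph1 // => /eqP ey /eqP et.
    by rewrite !rmorphB /= ey et.
  by rewrite !fmorph_div /= ey et.
have bs a : iota a \in [pred x | s x == s' x] by rewrite inE /= !gal_fix.
move=> x xT; apply/eqP; have := @tower_ind (Intermediate dv bs) _ x xT; apply=> k y ky.
have [z /tateSP Tz <-] := torsion_tate sepL ky; have [v [ez _]] := basS.2 _ Tz.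
rewrite inE /= -[z k]/(fps_coef (Fps z) k) ez.
rewrite -![_ (fps_coef _ k)]/(fps_coef (galS _ (comb iota (ser e) v)) k).
suff -> : galS s (comb iota (ser e) v) = galS s' (comb iota (ser e) v) by [].
rewrite /comb !rmorph_sum; apply: eq_bigr => i _; rewrite !rmorphM /= eqS.
by rewrite !galS_emb.
Qed.

Definition restricts (s : Gal iota) (s2 : Gal (@ibase _ _ iota tower)) : Prop :=
  forall y : ifield tower, s (ifval y) = ifval (s2 y).

Lemma tower_lift s2 : exists s, restricts s s2.
Proof.
pose G (y z : L) := exists t : ifield tower, y = ifval t /\ z = ifval (s2 t).
have pG : pembedding iota G.
  split.
  - by move=> a; exists (ibase _ a); rewrite gal_fix.
  - by move=> _ _ _ _ [t [-> ->]] [t' [-> ->]]; exists (t - t'); rewrite rmorphB.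
  - by move=> _ _ _ _ [t [-> ->]] [t' [-> ->]]; exists (t * t'); rewrite rmorphM.
  - by move=> _ _ [t [-> ->]]; exists t^-1; rewrite fmorphV.
  by move=> z [t [/esym t0 ->]]; have -> : t = 0 by [apply: val_inj]; rewrite rmorph0.
by have [s sP] := gal_extend sepL pG; exists s => y; apply: sP; exists y.
Qed.

Lemma tower_restrict (s : Gal iota) : exists s2, restricts s s2.
Proof.
pose f (y : ifield tower) : ifield tower := IField (gal_tower s (ifvalP y)).
pose g (y : ifield tower) : ifield tower := IField (gal_tower (s^-1)%g (ifvalP y)).
have fP : `[< is_Kaut (@ibase _ _ iota tower) f >].
  apply/asboolP; split.
  - by move=> y z; apply: val_inj; rewrite /= rmorphB.
  - by split=> [|y z]; apply: val_inj; rewrite /= ?rmorph1 ?rmorphM.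
  - by exists g => y; apply: val_inj; rewrite /= -galM ?mulVg ?mulgV gal1.
  by move=> a; apply: val_inj; rewrite /= gal_fix.
by exists (MkGal fP).
Qed.

(** All lifts of an automorphism of K_2 act by the same matrix, since the basis
    has components in K_2. *)
Lemma tower_iso : (forall A : 'M[fps F]_2, A \in unitmx -> exists s : Gal iota, acts (ser e) s A) ->
  tadic_induces_iso iota phi e.
Proof.
move=> all_e.
have exA s2 : exists A : GLmx 2 (fps F), forall s, restricts s s2 -> acts (ser e) s A.
  have [s ss2] := tower_lift s2; have [A sA] := acts_exists basS s.
  have [uA _] := acts_inv basS sA; exists (MkGLmx uA) => s' s's2 j.
  rewrite -sA; apply: fpsP => k.
  have ek : e j k \in carrier tower by apply: (@torsion_tower_mem k); apply: (bas_e.1 j).1.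
  by have := s's2 (IField ek); rewrite -ss2.
pose f s2 := projT1 (cid (exA s2)).
have fP s2 s : restricts s s2 -> acts (ser e) s (f s2) by rewrite /f; case: cid => A /= h /h.
have f_inj : injective f.
  move=> s1 s2 ef; have [s rs] := tower_lift s1; have [s' rs'] := tower_lift s2.
  have sA := fP _ _ rs; have s'A := fP _ _ rs'; rewrite -ef in s'A.
  apply: val_inj; apply: funext => y; apply: val_inj; rewrite /= -rs -rs'.
  apply: gal_tower_eq (ifvalP y) => j k.
  have := sA j; rewrite -s'A => /(congr1 (fun X => fps_coef X k)); exact.
have f_surj A : exists s2, f s2 = A.
  have [s sA] := all_e A (glvalP A); have [s2 rs] := tower_restrict s.
  by exists s2; apply: val_inj; apply: (acts_uniq basS (fP _ _ rs) sA).
exists f; split.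
- move=> s1 s2; have [s rs] := tower_lift s1; have [s' rs'] := tower_lift s2.
  apply: val_inj; apply: (acts_uniq basS (fP _ (s * s')%g _)).
    by move=> y; rewrite galM rs' rs.
  by apply: acts_mul; apply: fP.
- exists (fun A => projT1 (cid (f_surj A))) => [s2|A]; last by case: cid.
  by apply: f_inj; case: cid.
by move=> s s2 rs; apply/tadic_matrixE => //; apply: fP.
Qed.

End Tower.
End Surjectivity.

Theorem corollary6p7 (F : finFieldType) (Ksep : fieldType)
    (iota : {rmorphism ratfun F -> Ksep}) (b : ratfun F) :
  separable_closure iota ->
  (exists l : prime_idealr {poly F},
     [/\ exists2 p : {poly F}, p \in l & p != 0,
         ~ (forall p : {poly F}, (p \in l) = ('X %| p))
       & exists v : int, [/\ valuation l b v, v < 0 & coprime #|F| `|v|%N]]) ->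
  mod_t_image_contains_SL2 iota (phi2 b) ->
  (exists e, tate_basis iota (phi2 b) e) /\
  (forall e, tate_basis iota (phi2 b) e ->
     tadic_surjective iota (phi2 b) e /\ tadic_induces_iso iota (phi2 b) e).
Proof.
move=> sepL [l [nzl l_nX [v [vb v_neg co]]]] SL.
have [X [Y [TX TY indep trans]]] := exists_local_transvections sepL nzl l_nX vb v_neg co.
have bas0 := pair_basisS TX TY indep.
split; first by exists (fun i => fps_coef (pair_of X Y i)); apply: basisS_tate.
move=> e bas_e; have all_e := acts_all_change bas0 (tate_basisS bas_e)
  (acts_all sepL TX TY indep trans SL).
split; last exact: tower_iso.
move=> A; have [s sA] := all_e A (glvalP A); exists s.
exact/tadic_matrixE.
Qed.
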